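(* Let $V=H_3(\mathbb{O})$ be the exceptional Hermitian Jordan triple system of dimension 27. 1. The manifold $\mathcal{E}_1$ of minimal tripotents of $V$ is $\mathcal{E}_1=\{e\in V:\{e,e,e\}=2e,\ (e\mid e)=1\}=\{e\in V: e^{\#}=0,\ (e\mid e)=1\}$. For $e\in\mathcal{E}_1$ one has $V_2(e)=\mathbb{C}e$ and $\dim_{\mathbb{C}}V_1(e)=16$. The manifold $\mathcal{E}_1$ has real dimension $33$ and is a Cauchy–Riemann manifold of CR type $(16,1)$. 2. The manifold $\mathcal{E}_2$ of rank $2$ tripotents of $V$ is $\mathcal{E}_2=\{e\in V:\{e,e,e\}=2e,\ (e\mid e)=2\}=\{e\in V:\det e=0,\ (e^{\#}\mid e^{\#})=1,\ (e\mid e)=2\}$. For $e\in\mathcal{E}_2$ one has $\dim_{\mathbb{C}} V_2(e)=10$ and $\dim_{\mathbb{C}} V_1(e)=16$. The manifold $\mathcal{E}_2$ has real dimension $42$ and is a Cauchy–Riemann manifold of CR type $(16,10)$. 3. The manifold $\mathcal{E}_3$ of maximal tripotents of $V$ is $\mathcal{E}_3=\{e\in V:\{e,e,e\}=2e,\ (e\mid e)=3\}=\{e\in V:|\det e|^2=1,\ (e^{\#}\mid e^{\#})=3,\ (e\mid e)=3\}$. The manifold $\mathcal{E}_3$ is totally real of real dimension $27$.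
   Context: $\mathbb{O}_c$ is the real 8-dimensional division algebra of octonions with positive definite multiplicative norm $n$, Cayley conjugation $a\mapsto\widetilde a$ ($a\widetilde a=n(a)1$), and bilinear form $(a:b)=n(a+b)-n(a)-n(b)$ (so $(a:a)=2n(a)$). $\mathbb{O}=\mathbb{C}\otimes_{\mathbb{R}}\mathbb{O}_c$ is the complex octonion algebra; product, $n$, $\widetilde{\ }$ and $(\,:\,)$ are extended complex (multi)linearly/quadratically, and $a\mapsto\overline a$ is complex conjugation with respect to $\mathbb{O}_c$. $H_3(\mathbb{O})$ is the 27-dimensional complex vector space of matrices $a=\begin{pmatrix}\alpha_1&a_3&\widetilde{a_2}\\ \widetilde{a_3}&\alpha_2&a_1\\ a_2&\widetilde{a_1}&\alpha_3\end{pmatrix}$, $\alpha_i\in\mathbb{C}$, $a_i\in\mathbb{O}$, written $a=\sum\alpha_ie_i+\sum F_i(a_i)$. Put $(a:b)=\sum\alpha_i\beta_i+\sum(a_i:b_i)$; $a^{\#}=\sum_i(\alpha_j\alpha_k-n(a_i))e_i+\sum_iF_i\bigl((a_ja_k)^{\sim}-\alpha_ia_i\bigr)$, where $(i,j,k)$ is the even (cyclic) permutation of $(1,2,3)$ starting with $i$; $a\times b=(a+b)^{\#}-a^{\#}-b^{\#}$; $\det a=\frac13(a^{\#}:a)$; $\overline a=\sum\overline{\alpha_i}e_i+\sum F_i(\overline{a_i})$; $(a\mid b)=(a:\overline b)$. The triple product is $\{x,y,z\}=D(x,y)z=(x\mid y)z+(z\mid y)x-(x\times z)\times\overline y$. This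 is a positive Hermitian Jordan triple system. $e$ is a tripotent if $\{e,e,e\}=2e$. Tripotents $e,f$ are orthogonal if $D(e,f)=0$. A nonzero tripotent is minimal if it is not the sum of two nonzero orthogonal tripotents; it has rank $k$ if it is a sum of $k$ pairwise orthogonal minimal tripotents; it is maximal if no nonzero tripotent is orthogonal to it. The Peirce subspaces are $V_j(e)=\{y: D(e,e)y=jy\}$, $j=0,1,2$. A real submanifold $M$ of a complex vector space is a Cauchy–Riemann manifold of CR type $(s,t)$ if at each point the maximal complex subspace of the tangent direction has complex dimension $s$ and $\dim_{\mathbb{R}}M=2s+t$; it is totally real if that complex subspace is $0$. *)

(* Defs.v *)
From HB Require Import structures.
From mathcomp Require Import all_boot all_order all_algebra.
From mathcomp Require Import ring.
From mathcomp.real_closed Require Export complex.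
From mathcomp Require Import all_classical all_reals all_analysis.
Set Implicit Arguments.
Unset Strict Implicit.
Unset Printing Implicit Defensive.
Import Order.TTheory GRing.Theory Num.Theory.
Import numFieldNormedType.Exports.
Local Open Scope classical_set_scope.
Local Open Scope ring_scope.

(** * Octonions *)

(* Octonions with coefficients in [K]: column 0 is the coefficient of 1, columns
   1..7 are those of imaginary units u_0, ..., u_6.  The algebra O_c is
   [oct R] for R the real numbers, and O = C (x) O_c is [oct R[i]]: the
   structure constants are integers, so that extension of scalars amounts to
   taking coefficients in R[i]. *)
Definition oct (K : Type) := 'rV[K]_(1 + 7).

Section Octonions.
Variable K : comNzRingType.
Implicit Types (c : K) (a b x y : oct K) (u v : 'rV[K]_7).

Definition oct_re a : K := lsubmx a 0 0.
Definition oct_im a : 'rV[K]_7 := rsubmx a.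
Definition mk_oct c u : oct K := row_mx c%:M u.

(* Product of imaginary octonions without its real part.  It comes from the
   cyclic rule u_i u_(i+1) = u_(i+3), indices modulo 7: the products of units
   equal to u_k are u_(k+1) u_(k+3), u_(k+2) u_(k+6) and u_(k+4) u_(k+5). *)
Definition oct_cross u v : 'rV[K]_7 :=
  \row_(k < 7) \sum_(p <- [:: (1, 3); (2, 6); (4, 5)] : seq ('I_7 * 'I_7))
    (u 0 (k + p.1) * v 0 (k + p.2) - u 0 (k + p.2) * v 0 (k + p.1)).

Definition oct_mul a b : oct K :=
  mk_oct (oct_re a * oct_re b - \sum_k oct_im a 0 k * oct_im b 0 k)
    (oct_re a *: oct_im b + oct_re b *: oct_im a
       + oct_cross (oct_im a) (oct_im b)).

Definition oct_one : oct K := mk_oct 1 0.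
Definition oct_conj a : oct K := mk_oct (oct_re a) (- oct_im a).
Definition oct_norm a : K := \sum_k a 0 k ^+ 2.
Definition oct_form a b : K := oct_norm (a + b) - oct_norm a - oct_norm b.

Lemma mk_octK a : mk_oct (oct_re a) (oct_im a) = a.
Proof.
by rewrite /mk_oct /oct_re -mx11_scalar hsubmxK.
Qed.

Lemma oct_re_mk c u : oct_re (mk_oct c u) = c.
Proof. by rewrite /oct_re /mk_oct row_mxKl mxE eqxx. Qed.

Lemma oct_im_mk c u : oct_im (mk_oct c u) = u.
Proof. by rewrite /oct_im /mk_oct row_mxKr. Qed.

Lemma oct_eqP a b : oct_re a = oct_re b -> oct_im a = oct_im b -> a = b.
Proof. by move=> ab1 ab2; rewrite -(mk_octK a) -(mk_octK b) ab1 ab2. Qed.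

Lemma oct_reP c a b : oct_re (c *: a + b) = c * oct_re a + oct_re b.
Proof. by rewrite /oct_re !mxE. Qed.

Lemma oct_imP c a b : oct_im (c *: a + b) = c *: oct_im a + oct_im b.
Proof. by rewrite /oct_im linearP. Qed.

Lemma oct_normE a :
  oct_norm a = oct_re a ^+ 2 + \sum_k oct_im a 0 k ^+ 2.
Proof.
rewrite /oct_norm big_split_ord big_ord1; congr (_ ^+ 2 + _).
  by rewrite /oct_re mxE.
by apply: eq_bigr => k _; rewrite /oct_im mxE.
Qed.

Lemma oct_formE a b : oct_form a b = \sum_k 2%:R * a 0 k * b 0 k.
Proof.
rewrite /oct_form /oct_norm -!sumrB; apply: eq_bigr => k _.
by rewrite mxE; ring.
Qed.

Lemma oct_mul_linearl b c a x :
  oct_mul (c *: a + x) b = c *: oct_mul a b + oct_mul x b.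
Proof.
apply: oct_eqP; rewrite ?(oct_reP, oct_imP) !(oct_re_mk, oct_im_mk) oct_reP oct_imP;
  move: (oct_re a) (oct_re b) (oct_re x) (oct_im a) (oct_im b) (oct_im x)
    => a0 b0 x0 u v w.
  rewrite mulrBr mulr_sumr; under eq_bigr do rewrite !mxE mulrDl -mulrA.
  by rewrite big_split /=; ring.
by apply/rowP => k; rewrite !mxE !big_cons !big_nil /= !mxE; ring.
Qed.

Lemma oct_mul_linearr a c b x :
  oct_mul a (c *: b + x) = c *: oct_mul a b + oct_mul a x.
Proof.
apply: oct_eqP; rewrite ?(oct_reP, oct_imP) !(oct_re_mk, oct_im_mk) oct_reP oct_imP;
  move: (oct_re a) (oct_re b) (oct_re x) (oct_im a) (oct_im b) (oct_im x)
    => a0 b0 x0 u v w.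
  rewrite mulrBr mulr_sumr; under eq_bigr do rewrite !mxE mulrDr mulrCA.
  by rewrite big_split /=; ring.
by apply/rowP => k; rewrite !mxE !big_cons !big_nil /= !mxE; ring.
Qed.

Lemma oct_mulDl a b x : oct_mul (a + b) x = oct_mul a x + oct_mul b x.
Proof. by rewrite -[a in LHS]scale1r oct_mul_linearl scale1r. Qed.

Lemma oct_mulDr a b x : oct_mul x (a + b) = oct_mul x a + oct_mul x b.
Proof. by rewrite -[a in LHS]scale1r oct_mul_linearr scale1r. Qed.

Lemma oct_conj_linear c a b :
  oct_conj (c *: a + b) = c *: oct_conj a + oct_conj b.
Proof.
apply: oct_eqP; rewrite ?(oct_reP, oct_imP) !(oct_re_mk, oct_im_mk).
  by rewrite oct_reP.
by rewrite oct_imP opprD scalerN.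
Qed.

Lemma oct_conjD a b : oct_conj (a + b) = oct_conj a + oct_conj b.
Proof. by rewrite -[a in LHS]scale1r oct_conj_linear scale1r. Qed.

Lemma oct_form_linearr a c b x :
  oct_form a (c *: b + x) = c * oct_form a b + oct_form a x.
Proof.
rewrite !oct_formE mulr_sumr -big_split; apply: eq_bigr => k _ /=.
by rewrite !mxE; ring.
Qed.

Lemma oct_formC a b : oct_form a b = oct_form b a.
Proof. by rewrite /oct_form (addrC a) addrAC. Qed.

Lemma oct_form_linearl c a x b :
  oct_form (c *: a + x) b = c * oct_form a b + oct_form x b.
Proof. by rewrite oct_formC oct_form_linearr !(oct_formC b). Qed.

Lemma oct_mul1 a : oct_mul oct_one a = a.
Proof.
apply: oct_eqP; rewrite !(oct_re_mk, oct_im_mk).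
  by rewrite big1 ?subr0 ?mul1r // => k _; rewrite mxE mul0r.
rewrite scale1r scaler0 addr0; apply/rowP => k.
by rewrite !mxE !big_cons big_nil /= !mxE; ring.
Qed.

Lemma oct_mulr1 a : oct_mul a oct_one = a.
Proof.
apply: oct_eqP; rewrite !(oct_re_mk, oct_im_mk).
  by rewrite big1 ?subr0 ?mulr1 // => k _; rewrite [X in _ * X]mxE mulr0.
rewrite scale1r scaler0 add0r; apply/rowP => k.
by rewrite !mxE !big_cons big_nil /= !mxE; ring.
Qed.

Lemma oct_mul_conj a : oct_mul a (oct_conj a) = oct_norm a *: oct_one.
Proof.
rewrite oct_normE -[RHS]addr0.
apply: oct_eqP; rewrite ?(oct_reP, oct_imP) !(oct_re_mk, oct_im_mk);
  move: (oct_re a) (oct_im a) => a0 u.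
  rewrite [oct_re 0]mxE mxE addr0 mulr1 expr2 -sumrN; congr (_ + _).
  by apply: eq_bigr => k _; rewrite mxE; ring.
by apply/rowP => k; rewrite !mxE !big_cons big_nil /= !mxE; ring.
Qed.

Lemma oct_norm_mul a b : oct_norm (oct_mul a b) = oct_norm a * oct_norm b.
Proof.
rewrite !oct_normE !(oct_re_mk, oct_im_mk).
set a0 := oct_re a; set b0 := oct_re b.
set u := oct_im a; set v := oct_im b; clearbody a0 b0 u v; clear a b.
pose o (k : nat) : 'I_7 := inord k.
have big7 (F : 'I_7 -> K) : \sum_k F k =
    F (o 0%N) + F (o 1%N) + F (o 2%N) + F (o 3%N) + F (o 4%N) + F (o 5%N)
    + F (o 6%N).
  rewrite 7!big_ord_recl big_ord0 addr0 !addrA.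
  by do 6?congr (_ + _); congr F; apply/val_inj; rewrite /= inordK.
have oD (i j : nat) : (i < 7)%N -> o i + j%:R = o ((i + j) %% 7)%N.
  by move=> i7; apply/val_inj; rewrite Zp_nat /= !inordK ?ltn_mod // modnDmr.
have oS (i : nat) : (i < 7)%N -> o i + 1 = o ((i + 1) %% 7)%N := oD i 1%N.
rewrite !big7 !mxE !big_cons !big_nil /= !oD // !oS //.
rewrite /=.
by ring.
Qed.

End Octonions.

Lemma oct_norm_eq0 (R : realDomainType) (a : oct R) :
  oct_norm a = 0 -> a = 0.
Proof.
move=> /eqP; rewrite psumr_eq0 => [/allP a0|k _]; last exact: sqr_ge0.
apply/rowP => k; rewrite mxE; apply/eqP.
by rewrite -sqrf_eq0; apply: (a0 k); rewrite mem_index_enum.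
Qed.

(** * The exceptional Hermitian Jordan triple system *)

(* The matrix
     (  alpha_1   a_3     ~a_2    )
     (  ~a_3      alpha_2  a_1    )
     (  a_2       ~a_1     alpha_3 )
   is encoded by the pair of the row (alpha_1, alpha_2, alpha_3) and of the
   3 x 8 matrix with rows a_1, a_2, a_3.  Indices run over 'I_3, that is over
   integers modulo 3, and the cyclic permutation starting with i is
   (i, i + 1, i + 2). *)
Definition H3 (R : realType) : Type := ('rV[R[i]]_3 * 'M[R[i]]_(3, 1 + 7))%type.


Section H3.
Variable R : realType.
Local Notation C := R[i].
Implicit Types (c : C) (a b e f w x y z : H3 R) (i : 'I_3).

Definition diag a i : C := a.1 0 i.
Definition off a i : oct C := row i a.2.
Definition mk_H3 (alpha : 'I_3 -> C) (u : 'I_3 -> oct C) : H3 R :=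
  (\row_i alpha i, \matrix_i u i).

Definition form a b : C :=
  \sum_i diag a i * diag b i + \sum_i oct_form (off a i) (off b i).

Definition sharp a : H3 R := mk_H3
  (fun i => diag a (i + 1) * diag a (i + 2) - oct_norm (off a i))
  (fun i => oct_conj (oct_mul (off a (i + 1)) (off a (i + 2)))
            - diag a i *: off a i).

Definition freudenthal a b : H3 R := sharp (a + b) - sharp a - sharp b.

Definition detH a : C := 3%:R^-1 * form (sharp a) a.

Definition conjH a : H3 R := (map_mx conjc a.1, map_mx conjc a.2).

Definition herm a b : C := form a (conjH b).

Definition triple x y z : H3 R :=
  herm x y *: z + herm z y *: x - freudenthal (freudenthal x z) (conjH y).

Lemma mk_H3K a : mk_H3 (diag a) (off a) = a.
Proof.
case: a => a1 a2; congr pair; first by apply/rowP => i; rewrite mxE.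
by apply/row_matrixP => i; rewrite rowK.
Qed.

Lemma diag_mk alpha u i : diag (mk_H3 alpha u) i = alpha i.
Proof. by rewrite /diag mxE. Qed.

Lemma off_mk alpha u i : off (mk_H3 alpha u) i = u i.
Proof. by rewrite /off rowK. Qed.

Lemma H3_eqP a b :
  (forall i, diag a i = diag b i) -> (forall i, off a i = off b i) -> a = b.
Proof.
by move=> /funext ab1 /funext ab2; rewrite -(mk_H3K a) -(mk_H3K b) ab1 ab2.
Qed.

Lemma diagP c a b i : diag (c *: a + b) i = c * diag a i + diag b i.
Proof. by rewrite /diag !mxE. Qed.

Lemma offP c a b i : off (c *: a + b) i = c *: off a i + off b i.
Proof. by rewrite /off linearP. Qed.

Lemma diag_sharp a i : diag (sharp a) i =
  diag a (i + 1) * diag a (i + 2) - oct_norm (off a i).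
Proof. exact: diag_mk. Qed.

Lemma off_sharp a i : off (sharp a) i =
  oct_conj (oct_mul (off a (i + 1)) (off a (i + 2))) - diag a i *: off a i.
Proof. exact: off_mk. Qed.

Lemma diagB a b i : diag (a - b) i = diag a i - diag b i.
Proof. by rewrite /diag !mxE. Qed.

Lemma offB a b i : off (a - b) i = off a i - off b i.
Proof. by rewrite /off linearB. Qed.

Lemma diagD a b i : diag (a + b) i = diag a i + diag b i.
Proof. by rewrite /diag !mxE. Qed.

Lemma offD a b i : off (a + b) i = off a i + off b i.
Proof. by rewrite /off linearD. Qed.

Lemma dim_H3 : \dim {: H3 R} = 27%N.
Proof. by rewrite dimvf. Qed.

Lemma diag_freudenthal a b i :
  diag (freudenthal a b) i =
    diag a (i + 1) * diag b (i + 2) + diag b (i + 1) * diag a (i + 2)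
    - oct_form (off a i) (off b i).
Proof.
rewrite /freudenthal /oct_form.
move: sharp diag_sharp => s sE; rewrite !diagB !sE offD !diagD.
move: (oct_norm _) (oct_norm _) (oct_norm _) => n1 n2 n3.
move: (diag a _) (diag a _) (diag b _) (diag b _) => p q r t.
by ring.
Qed.

Lemma off_freudenthal a b i :
  off (freudenthal a b) i =
    oct_conj (oct_mul (off a (i + 1)) (off b (i + 2))
              + oct_mul (off b (i + 1)) (off a (i + 2)))
    - diag a i *: off b i - diag b i *: off a i.
Proof.
rewrite /freudenthal.
move: sharp off_sharp => s sE; rewrite !offB !sE !offD diagD.
move: (off a (i + 1)) (off a (i + 2)) (off b (i + 1)) (off b (i + 2))
  => a1 a2 b1 b2.
move: (@oct_mul C) (@oct_conj C)
  (@oct_mulDl C) (@oct_mulDr C) (@oct_conjD C) => m j mDl mDr jD.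
rewrite mDl !mDr !jD.
move: (j (m a1 a2)) (j (m a1 b2)) (j (m b1 a2)) (j (m b1 b2)) => p q r t.
move: (off a i) (off b i) => u v.
by apply/rowP => k; rewrite !mxE; ring.
Qed.

Lemma freudenthal_linearr a c b x :
  freudenthal a (c *: b + x) = c *: freudenthal a b + freudenthal a x.
Proof.
apply: H3_eqP => i.
  move: freudenthal diag_freudenthal => f fE.
  rewrite diagP !fE !diagP offP oct_form_linearr.
  move: (oct_form _ (off b i)) (oct_form _ (off x i)) => n1 n2.
  move: (diag a (i + 1)) (diag a (i + 2)) (diag b (i + 1)) (diag b (i + 2))
    (diag x (i + 1)) (diag x (i + 2)) => a1 a2 b1 b2 x1 x2.
  by ring.
move: freudenthal off_freudenthal => f fE.
rewrite offP !fE !diagP !offP.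
move: (off a (i + 1)) (off a (i + 2)) (off b (i + 1)) (off b (i + 2))
  (off x (i + 1)) (off x (i + 2)) => a1 a2 b1 b2 x1 x2.
move: (@oct_mul C) (@oct_conj C) (@oct_mul_linearl C) (@oct_mul_linearr C)
  (@oct_conj_linear C) => m j mPl mPr jP.
rewrite mPl mPr addrACA -scalerDr jP.
move: (j (m a1 b2 + m b1 a2)) (j (m a1 x2 + m x1 a2)) => p q.
move: (off a i) (off b i) (off x i) => u v w.
by apply/rowP => k; rewrite !mxE; ring.
Qed.

Lemma freudenthalC a b : freudenthal a b = freudenthal b a.
Proof.
by rewrite /freudenthal; move: sharp => s; rewrite (addrC a) addrAC.
Qed.

Lemma hermP c a b y : herm (c *: a + b) y = c * herm a y + herm b y.
Proof.
rewrite /herm; move: (conjH y) => z.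
rewrite /form mulrDr !mulr_sumr addrACA.
congr (_ + _); rewrite -big_split; apply: eq_bigr => i _ /=; first by rewrite diagP mulrDl mulrA.
by rewrite (offP c a b) oct_form_linearl.
Qed.

Lemma triple_linear x y c z w :
  triple x y (c *: z + w) = c *: triple x y z + triple x y w.
Proof.
rewrite /triple; move: freudenthal freudenthalC freudenthal_linearr => f fC fP.
rewrite fP (fC (_ + _)) fP !(fC (conjH y)) hermP.
move: (herm x y) (herm z y) (herm w y) (f _ _) (f _ _) => k l m p q.
rewrite scalerBr !scalerDr scalerDl !scalerA (mulrC k c) opprD.
by rewrite [_ + _ + (_ *: x + _)]addrACA [LHS]addrACA.
Qed.

Definition tripotent e : Prop := triple e e e = 2%:R *: e.

Definition orthogonal e f : Prop := forall z, triple e f z = 0.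

Definition minimal_tripotent e : Prop :=
  [/\ tripotent e, e <> 0 &
    ~ exists f g, [/\ tripotent f /\ f <> 0, tripotent g /\ g <> 0,
                      orthogonal f g & e = f + g]].

Definition has_rank (k : nat) e : Prop :=
  exists c : 'I_k -> H3 R,
    [/\ forall i : 'I_k, minimal_tripotent (c i),
        forall i j : 'I_k, i != j -> orthogonal (c i) (c j) &
        e = \sum_(i < k) c i].

Definition maximal_tripotent e : Prop :=
  tripotent e /\
    forall f, tripotent f -> f <> 0 -> ~ (orthogonal e f).

Definition peirce (j : nat) e : {vspace H3 R} :=
  passmx.leigenspace (linfun (triple e e)) j%:R.

Lemma peirceP j e y : y \in peirce j e <-> triple e e y = j%:R *: y.
Proof.
pose lin := GRing.isLinear.Build _ _ _ _ (triple e e) (triple_linear e e).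
pose D : {linear H3 R -> H3 R} := HB.pack (triple e e) lin.
rewrite /peirce /passmx.leigenspace memv_ker add_lfunE opp_lfunE scale_lfunE.
by rewrite id_lfunE (lfunE D) subr_eq0; split => /eqP.
Qed.

End H3.

(** * Real submanifolds and Cauchy-Riemann manifolds *)

Section Submanifolds.
Variable R : realType.

Fixpoint Ck_on (V W : normedModType R) (k : nat) (U : set V) (f : V -> W) :
    Prop :=
  if k is k'.+1 then
    (forall x, U x -> differentiable f x) /\ forall v, Ck_on k' U ('D_v f)
  else forall x, U x -> {for x, continuous f}.

(* Used for open [U] only. *)
Definition smooth_on (V W : normedModType R) (U : set V) (f : V -> W) : Prop :=
  forall k, Ck_on k U f.

(* Near each of its points, [M] is diffeomorphic to an open subset of R^d: [g]
   is a smooth parametrization, whose inverse is the restriction to [M] of the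
   smooth map [h].  [M] is required to be nonempty, so that it determines its
   dimension [d]. *)
Definition submanifold (V : normedModType R) (d : nat) (M : set V) : Prop :=
  M !=set0 /\ forall p, M p ->
    exists (W : set V) (U : set 'rV[R]_d) (g : 'rV[R]_d -> V)
           (h : V -> 'rV[R]_d),
      [/\ open W /\ W p, open U, smooth_on U g, smooth_on W h &
          g @` U = M `&` W /\ forall u, U u -> h (g u) = u].

(* Velocities at [p] of the smooth curves drawn on [M]. *)
Definition tangent (V : normedModType R) (M : set V) (p : V) : set V :=
  [set v | exists (c : R -> V) (eps : R),
     [/\ 0 < eps, smooth_on (ball (0 : R) eps) c,
         forall t, ball (0 : R) eps t -> M (c t),
         c 0 = p & 'D_1 c 0 = v]].

Variable E : vectType R[i].

(* Real and imaginary parts of the coordinates in a basis of [E].  This map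
   identifies [E] with a real normed space; the notions below do not depend on
   the basis, since a change of basis is a linear isomorphism. *)
Definition realify (x : E) : ('rV[R]_(\dim {:E}) * 'rV[R]_(\dim {:E}))%type :=
  (\row_i complex.Re (coord (vbasis {:E}) i x),
   \row_i complex.Im (coord (vbasis {:E}) i x)).

Definition real_submanifold (d : nat) (M : set E) : Prop :=
  submanifold d (realify @` M).

Definition real_tangent (M : set E) (p : E) : set E :=
  [set v | tangent (realify @` M) (realify p) (realify v)].

Definition maximal_complex_subspace (T : set E) (H : {vspace E}) : Prop :=
  [set` H] `<=` T /\
    forall H' : {vspace E}, [set` H'] `<=` T -> (H' <= H)%VS.

Definition CR_manifold (s t : nat) (M : set E) : Prop :=
  real_submanifold (s.*2 + t) M /\
    forall p, M p -> exists H : {vspace E},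
      maximal_complex_subspace (real_tangent M p) H /\ \dim H = s.

Definition totally_real (M : set E) : Prop :=
  forall p, M p -> maximal_complex_subspace (real_tangent M p) 0%VS.

End Submanifolds.

(* Main.v *)
(** The linear isometries k of V for [herm] with sharp (k u) = conj (k (conj (sharp u)))
    are automorphisms of the triple product and form a compact group: the phases,
    the planar rotations, the cyclic shift of the indices and the actions of real unit
    octonions generate all that is needed.  Maximizing Re (3 x1 + 2 x2 + x3) over an
    orbit gives an element whose derivatives along rotations vanish, hence a diagonal
    one.  Every tripotent is thus conjugate to e1, to e2 + e3 or to e1 + e2 + z e3 with
    |z| = 1, where the equations and the Peirce spaces can be read off.

    Charts are needed at one point of each orbit.  For E1: normalize the rank one
    elements h3 1 n(c) n(b) (bc)~ b c and turn their phase.  For E3: the Cayley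
    transform 2 (1 - i x)^-1 - 1 of the real elements x.  For E2: the map
    e |-> conj (sharp e) fibers E2 over E1, and the fiber of f is a sphere in the
    real 10-space of the fixed points of u |-> conj (f x u).

    Differentiating {e,e,e} = 2 e along a curve shows that v and i v are both tangent
    only if {e,e,v} = v, so that complex tangent spaces lie in V_1(e).  Conversely,
    each vector of V_1(e) is the velocity of a normalized rank one curve on E1, or of
    the image of e under the Peirce reflections of such a curve on E2. *)

(* Neither a spectral theory of Jordan triples nor a description of the automorphism group enters:
   compactness of the group and one first order condition give the diagonal form, on which the
   invariant algebraic statements are then checked. Automorphisms preserve the determinant, so the
   phases of an invertible diagonal element can be normalized only up to their product; this is why
   the third normal form keeps a parameter z, and why the charts of E3 also use multiplication by
   scalars. Continuity, boundedness and smoothness are needed for the same polynomial expressions.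
   They are obtained together, by working with an arbitrary algebra of functions. The fibers of E2
   over E1 are spheres in a varying real subspace without a preferred frame. A fixed frame is
   projected to that subspace, and the adjugate of the resulting matrix corrects the coordinates up
   to a positive factor. Curves are used in the form p + t q(t): the tripotent equation can then be
   divided by t, only continuity of q at 0 is needed, and the velocity of an explicit curve is read
   off as q(0). *)
From HB Require Import structures.
From mathcomp Require Import all_boot all_order all_algebra.
From mathcomp Require Import all_classical all_reals all_analysis.
From mathcomp Require Import ring lra.
Require Import Defs.
Set Implicit Arguments.
Unset Strict Implicit.
Unset Printing Implicit Defensive.
Import Order.TTheory GRing.Theory Num.Theory.
Import numFieldNormedType.Exports.
Local Open Scope classical_set_scope.
Local Open Scope ring_scope.

(** * Octonions *)

(* Locked copies of the operations: unification would otherwise unfold sums over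
   ordinals. *)
HB.lock Definition omul (K : comNzRingType) (a b : oct K) : oct K := oct_mul a b.
HB.lock Definition ocj (K : comNzRingType) (a : oct K) : oct K := oct_conj a.
HB.lock Definition onorm (K : comNzRingType) (a : oct K) : K := oct_norm a.
HB.lock Definition oform (K : comNzRingType) (a b : oct K) : K := oct_form a b.
HB.lock Definition ore (K : comNzRingType) (a : oct K) : K := oct_re a.
HB.lock Definition oone (K : comNzRingType) : oct K := oct_one K.

Section OctonionIdentities.
Variable K : comNzRingType.
Implicit Types (c : K) (a b d u : oct K).

(** Explicit coordinates: once [oct8P] has destructed the octonions and [oct8E] has computed, an
    octonion identity is a list of polynomial identities for [ring]. *)
Definition oct8 (x0 x1 x2 x3 x4 x5 x6 x7 : K) : oct K :=
  mk_oct x0 (\row_(k < 7) [:: x1; x2; x3; x4; x5; x6; x7]`_k).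

Variant oct8_spec : oct K -> Prop :=
  Oct8Spec x0 x1 x2 x3 x4 x5 x6 x7 : oct8_spec (oct8 x0 x1 x2 x3 x4 x5 x6 x7).

Lemma oct8P a : oct8_spec a.
Proof.
suff -> : a = oct8 (oct_re a) (oct_im a 0 (inord 0)) (oct_im a 0 (inord 1))
  (oct_im a 0 (inord 2)) (oct_im a 0 (inord 3)) (oct_im a 0 (inord 4))
  (oct_im a 0 (inord 5)) (oct_im a 0 (inord 6)) by [].
apply: oct_eqP; rewrite ?oct_re_mk ?oct_im_mk //; apply/rowP => k.
rewrite [RHS]mxE; case: k => [[|[|[|[|[|[|[|//]]]]]]] k7] /=;
  by congr (oct_im a 0 _); apply/val_inj; rewrite /= inordK.
Qed.

Lemma oct8_conj x0 x1 x2 x3 x4 x5 x6 x7 :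
  ocj (oct8 x0 x1 x2 x3 x4 x5 x6 x7) =
  oct8 x0 (- x1) (- x2) (- x3) (- x4) (- x5) (- x6) (- x7).
Proof.
rewrite ocj.unlock /oct_conj /oct8 oct_re_mk oct_im_mk; congr mk_oct; apply/rowP => k.
by rewrite !mxE; case: k => [[|[|[|[|[|[|[|//]]]]]]] k7].
Qed.

Lemma oct8_mul x0 x1 x2 x3 x4 x5 x6 x7 y0 y1 y2 y3 y4 y5 y6 y7 :
  omul (oct8 x0 x1 x2 x3 x4 x5 x6 x7) (oct8 y0 y1 y2 y3 y4 y5 y6 y7) =
  oct8 (x0 * y0 - (x1 * y1 + x2 * y2 + x3 * y3 + x4 * y4 + x5 * y5 + x6 * y6 + x7 * y7))
    (x0 * y1 + y0 * x1 + (x2 * y4 - x4 * y2 + (x3 * y7 - x7 * y3) + (x5 * y6 - x6 * y5)))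
    (x0 * y2 + y0 * x2 + (x3 * y5 - x5 * y3 + (x4 * y1 - x1 * y4) + (x6 * y7 - x7 * y6)))
    (x0 * y3 + y0 * x3 + (x4 * y6 - x6 * y4 + (x5 * y2 - x2 * y5) + (x7 * y1 - x1 * y7)))
    (x0 * y4 + y0 * x4 + (x5 * y7 - x7 * y5 + (x6 * y3 - x3 * y6) + (x1 * y2 - x2 * y1)))
    (x0 * y5 + y0 * x5 + (x6 * y1 - x1 * y6 + (x7 * y4 - x4 * y7) + (x2 * y3 - x3 * y2)))
    (x0 * y6 + y0 * x6 + (x7 * y2 - x2 * y7 + (x1 * y5 - x5 * y1) + (x3 * y4 - x4 * y3)))
    (x0 * y7 + y0 * x7 + (x1 * y3 - x3 * y1 + (x2 * y6 - x6 * y2) + (x4 * y5 - x5 * y4))).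
Proof.
rewrite omul.unlock /oct_mul /oct8 !oct_re_mk !oct_im_mk; congr mk_oct.
  rewrite !big_ord_recl big_ord0 !mxE /=; ring.
apply/rowP => k; rewrite !mxE !big_cons big_nil !mxE.
by case: k => [[|[|[|[|[|[|[|//]]]]]]] k7] /=; ring.
Qed.

Lemma oct8_lin c x0 x1 x2 x3 x4 x5 x6 x7 y0 y1 y2 y3 y4 y5 y6 y7 :
  c *: oct8 x0 x1 x2 x3 x4 x5 x6 x7 + oct8 y0 y1 y2 y3 y4 y5 y6 y7 =
  oct8 (c * x0 + y0) (c * x1 + y1) (c * x2 + y2) (c * x3 + y3) (c * x4 + y4)
    (c * x5 + y5) (c * x6 + y6) (c * x7 + y7).
Proof.
apply: oct_eqP; rewrite ?oct_reP ?oct_imP ?oct_re_mk ?oct_im_mk //.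
by apply/rowP => k; rewrite !mxE; case: k => [[|[|[|[|[|[|[|//]]]]]]] k7].
Qed.

Lemma oct8_zero : 0 = oct8 0 0 0 0 0 0 0 0.
Proof.
apply: oct_eqP; rewrite ?oct_re_mk ?oct_im_mk; first by rewrite /oct_re !mxE.
apply/rowP => k; rewrite !mxE.
by case: k => [[|[|[|[|[|[|[|//]]]]]]] k7].
Qed.

Lemma oct8_add x0 x1 x2 x3 x4 x5 x6 x7 y0 y1 y2 y3 y4 y5 y6 y7 :
  oct8 x0 x1 x2 x3 x4 x5 x6 x7 + oct8 y0 y1 y2 y3 y4 y5 y6 y7 =
  oct8 (x0 + y0) (x1 + y1) (x2 + y2) (x3 + y3) (x4 + y4)
    (x5 + y5) (x6 + y6) (x7 + y7).
Proof. by rewrite -[oct8 x0 _ _ _ _ _ _ _]scale1r oct8_lin !mul1r. Qed.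

Lemma oct8_scale c x0 x1 x2 x3 x4 x5 x6 x7 :
  c *: oct8 x0 x1 x2 x3 x4 x5 x6 x7 =
  oct8 (c * x0) (c * x1) (c * x2) (c * x3) (c * x4) (c * x5) (c * x6) (c * x7).
Proof. by rewrite -[LHS]addr0 oct8_zero oct8_lin !addr0. Qed.

Lemma oct8_opp x0 x1 x2 x3 x4 x5 x6 x7 :
  - oct8 x0 x1 x2 x3 x4 x5 x6 x7 =
  oct8 (- x0) (- x1) (- x2) (- x3) (- x4) (- x5) (- x6) (- x7).
Proof. by rewrite -scaleN1r oct8_scale !mulN1r. Qed.

Lemma oct8_one : oone K = oct8 1 0 0 0 0 0 0 0.
Proof.
rewrite oone.unlock; congr mk_oct; apply/rowP => k; rewrite !mxE.
by case: k => [[|[|[|[|[|[|[|//]]]]]]] k7].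
Qed.

Lemma oct8_norm x0 x1 x2 x3 x4 x5 x6 x7 :
  onorm (oct8 x0 x1 x2 x3 x4 x5 x6 x7) =
  x0 * x0 + x1 * x1 + x2 * x2 + x3 * x3 + x4 * x4 + x5 * x5 + x6 * x6 + x7 * x7.
Proof.
rewrite onorm.unlock oct_normE oct_re_mk oct_im_mk !big_ord_recl big_ord0 !mxE /=; ring.
Qed.

Lemma oct8_form x0 x1 x2 x3 x4 x5 x6 x7 y0 y1 y2 y3 y4 y5 y6 y7 :
  oform (oct8 x0 x1 x2 x3 x4 x5 x6 x7) (oct8 y0 y1 y2 y3 y4 y5 y6 y7) =
  2 * (x0 * y0 + x1 * y1 + x2 * y2 + x3 * y3 + x4 * y4 + x5 * y5 + x6 * y6
    + x7 * y7).
Proof.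
rewrite oform.unlock /oct_form oct8_add.
by have := oct8_norm; rewrite onorm.unlock => E; rewrite !E; ring.
Qed.

Lemma oct8_re x0 x1 x2 x3 x4 x5 x6 x7 :
  ore (oct8 x0 x1 x2 x3 x4 x5 x6 x7) = x0.
Proof. by rewrite ore.unlock oct_re_mk. Qed.

Definition oct8E := (oct8_conj, oct8_mul, oct8_lin, oct8_add, oct8_scale,
  oct8_opp, oct8_norm, oct8_form, oct8_re, oct8_one, oct8_zero).

Lemma onormE a : onorm a = oct_norm a.
Proof. by rewrite onorm.unlock. Qed.

Lemma ocj_omulE a b : ocj (omul a b) = oct_conj (oct_mul a b).
Proof. by rewrite ocj.unlock omul.unlock. Qed.

Lemma oform_octE a b : oform a b = oct_form a b.
Proof. by rewrite oform.unlock. Qed.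

Lemma omul_linearl b c a d : omul (c *: a + d) b = c *: omul a b + omul d b.
Proof. by rewrite omul.unlock oct_mul_linearl. Qed.

Lemma omul_linearr a c b d : omul a (c *: b + d) = c *: omul a b + omul a d.
Proof. by rewrite omul.unlock oct_mul_linearr. Qed.

Lemma omulDl a b d : omul (a + b) d = omul a d + omul b d.
Proof. by rewrite omul.unlock oct_mulDl. Qed.

Lemma omulDr a b d : omul d (a + b) = omul d a + omul d b.
Proof. by rewrite omul.unlock oct_mulDr. Qed.

Lemma ocjD a b : ocj (a + b) = ocj a + ocj b.
Proof. by rewrite ocj.unlock oct_conjD. Qed.

Lemma oformC a b : oform a b = oform b a.
Proof. by rewrite oform.unlock oct_formC. Qed.

Lemma oform_linearl c a d b : oform (c *: a + d) b = c * oform a b + oform d b.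
Proof. by rewrite oform.unlock oct_form_linearl. Qed.

Lemma onorm_mul a b : onorm (omul a b) = onorm a * onorm b.
Proof. by rewrite onorm.unlock omul.unlock oct_norm_mul. Qed.

Lemma oformN a b : oform a b = onorm (a + b) - onorm a - onorm b.
Proof. by rewrite oform.unlock onorm.unlock. Qed.

Lemma oformE a b : oform a b = \sum_k 2%:R * a 0 k * b 0 k.
Proof. by rewrite oform.unlock oct_formE. Qed.

Lemma ocjK a : ocj (ocj a) = a.
Proof. by case: (oct8P a) => *; rewrite !oct8E !opprK. Qed.

Lemma ocjM a b : ocj (omul a b) = omul (ocj b) (ocj a).
Proof. by case: (oct8P a) => *; case: (oct8P b) => *; rewrite !oct8E; congr oct8; ring. Qed.

Lemma onorm_conj a : onorm (ocj a) = onorm a.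
Proof. by case: (oct8P a) => *; rewrite !oct8E !mulrNN. Qed.

Lemma onormZ c a : onorm (c *: a) = c ^+ 2 * onorm a.
Proof. by case: (oct8P a) => *; rewrite !oct8E; ring. Qed.

Lemma oform_re a b : oform a b = 2 * ore (omul a (ocj b)).
Proof. by case: (oct8P a) => *; case: (oct8P b) => *; rewrite !oct8E; ring. Qed.

Lemma oformxx a : oform a a = 2 * onorm a.
Proof. by case: (oct8P a) => *; rewrite !oct8E. Qed.

Lemma ocj_mulK a b : omul (ocj a) (omul a b) = onorm a *: b.
Proof. by case: (oct8P a) => *; case: (oct8P b) => *; rewrite !oct8E; congr oct8; ring. Qed.

Lemma omulK_conj a b : omul (omul a b) (ocj b) = onorm b *: a.
Proof. by case: (oct8P a) => *; case: (oct8P b) => *; rewrite !oct8E; congr oct8; ring. Qed.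

(** The real part is an associative and cyclic trace on the octonions, although the product is not
    associative. This is the source of [oform_mul_cycle] and thus of the symmetry of the cubic
    form. *)
Lemma ore_cycle a b d :
  ore (omul d (omul a b)) = ore (omul a (omul b d)).
Proof.
by case: (oct8P a) => *; case: (oct8P b) => *; case: (oct8P d) => *; rewrite !oct8E; ring.
Qed.

Lemma oform_mul_cycle a b d :
  oform (ocj (omul a b)) d = oform (ocj (omul b d)) a.
Proof.
rewrite [LHS]oformC [RHS]oformC !oform_re !ocjK.
by rewrite ore_cycle.
Qed.

(** This and the next two are Moufang identities, with [ocj u] in the role of the inverse of u. Each
    says that the product of two of the components transformed by [spin] is the conjugate of the
    transformed third one; [aut_spin] uses one for each off-diagonal entry. *)
Lemma oct_moufang_right u a b :
  omul (omul a u) (omul (omul (ocj u) b) (ocj u)) =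
  onorm u *: omul (omul a b) (ocj u).
Proof.
case: (oct8P a) => *; case: (oct8P b) => *; case: (oct8P u) => *; rewrite !oct8E.
by congr oct8; ring.
Qed.

Lemma oct_moufang_left u a b :
  omul (omul (omul (ocj u) b) (ocj u)) (omul u a) =
  onorm u *: omul (ocj u) (omul b a).
Proof.
case: (oct8P a) => *; case: (oct8P b) => *; case: (oct8P u) => *; rewrite !oct8E.
by congr oct8; ring.
Qed.

Lemma oct_moufang_middle u a b :
  omul (omul u a) (omul b u) = omul (omul u (omul a b)) u.
Proof.
case: (oct8P a) => *; case: (oct8P b) => *; case: (oct8P u) => *; rewrite !oct8E.
by congr oct8; ring.
Qed.

Lemma omulZl c a b : omul (c *: a) b = c *: omul a b.
Proof.
by case: (oct8P a) => *; case: (oct8P b) => *; rewrite !oct8E; congr oct8; ring.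
Qed.

Lemma omulZr c a b : omul a (c *: b) = c *: omul a b.
Proof.
by case: (oct8P a) => *; case: (oct8P b) => *; rewrite !oct8E; congr oct8; ring.
Qed.

Lemma ocjZ c a : ocj (c *: a) = c *: ocj a.
Proof. by case: (oct8P a) => *; rewrite !oct8E; congr oct8; ring. Qed.

Lemma omulr0 a : omul a 0 = 0.
Proof. by rewrite -[0](scale0r 0) omulZr !scale0r. Qed.

Lemma omul0r a : omul 0 a = 0.
Proof. by rewrite -[0](scale0r 0) omulZl !scale0r. Qed.

Lemma ocj0 : ocj 0 = 0 :> oct K.
Proof. by rewrite -[0](scale0r 0) ocjZ !scale0r. Qed.

Lemma onorm0 : onorm (0 : oct K) = 0.
Proof. by rewrite -[0](scale0r 0) onormZ expr0n mul0r. Qed.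

Lemma oform0r a : oform a 0 = 0.
Proof. by rewrite oformN addr0 onorm0 subr0 subrr. Qed.

Lemma oform0l a : oform 0 a = 0.
Proof. by rewrite oformC oform0r. Qed.

(* Conjugation by the scaled rotation (c, s; -s, c) of the plane of the first
   two indices; each identity is homogeneous, with n = c^2 + s^2. *)
Section Rotation.
Variables (c s x1 x2 : K) (a1 a2 a3 : oct K).
Let n := c * c + s * s.
Let r := ore a3.

Definition rot_x1 := c * c * x1 + 2 * (c * s) * r + s * s * x2.
Definition rot_x2 := s * s * x1 - 2 * (c * s) * r + c * c * x2.
Definition rot_a1 := c *: a1 - s *: ocj a2.
Definition rot_a2 := c *: a2 + s *: ocj a1.
Definition rot_a3 := (c * c) *: a3 - (s * s) *: ocj a3
  + (c * s * (x2 - x1)) *: oone K.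

(** The entries of the adjugate of a rotated element are compared with the rotated adjugate, up to a
    power of n. With c and s free these are polynomial identities; n = 1 is set only in
    [aut_rot]. *)
Lemma rot_det : rot_x1 * rot_x2 - onorm rot_a3 =
  n * n * (x1 * x2 - onorm a3).
Proof.
rewrite /rot_x1 /rot_x2 /rot_a3 /r /n.
by case: (oct8P a3) => *; rewrite !oct8E; ring.
Qed.

Lemma rot_norm_a1 : onorm rot_a1 =
  c * c * onorm a1 - 2 * (c * s) * ore (omul a1 a2) + s * s * onorm a2.
Proof.
rewrite /rot_a1; case: (oct8P a1) => *; case: (oct8P a2) => *.
by rewrite !oct8E; ring.
Qed.

Lemma rot_norm_a2 : onorm rot_a2 =
  s * s * onorm a1 + 2 * (c * s) * ore (omul a1 a2) + c * c * onorm a2.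
Proof.
rewrite /rot_a2; case: (oct8P a1) => *; case: (oct8P a2) => *.
by rewrite !oct8E; ring.
Qed.

Lemma rot_a1a2 : omul rot_a1 rot_a2 =
  (c * c) *: omul a1 a2 - (s * s) *: ocj (omul a1 a2)
  + (c * s * (onorm a1 - onorm a2)) *: oone K.
Proof.
rewrite /rot_a1 /rot_a2; case: (oct8P a1) => *; case: (oct8P a2) => *.
by rewrite !oct8E; congr oct8; ring.
Qed.

Lemma rot_a2a3 : ocj (omul rot_a2 rot_a3) - rot_x1 *: rot_a1 =
  n *: (c *: (ocj (omul a2 a3) - x1 *: a1)
        - s *: ocj (ocj (omul a3 a1) - x2 *: a2)).
Proof.
rewrite /rot_a1 /rot_a2 /rot_a3 /rot_x1 /r /n.
case: (oct8P a1) => *; case: (oct8P a2) => *; case: (oct8P a3) => *.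
by rewrite !oct8E; congr oct8; ring.
Qed.

Lemma rot_a3a1 : ocj (omul rot_a3 rot_a1) - rot_x2 *: rot_a2 =
  n *: (c *: (ocj (omul a3 a1) - x2 *: a2)
        + s *: ocj (ocj (omul a2 a3) - x1 *: a1)).
Proof.
rewrite /rot_a1 /rot_a2 /rot_a3 /rot_x2 /r /n.
case: (oct8P a1) => *; case: (oct8P a2) => *; case: (oct8P a3) => *.
by rewrite !oct8E; congr oct8; ring.
Qed.
End Rotation.

Lemma rot_form3 c s x1 x2 y1 y2 a b :
  rot_x1 c s x1 x2 a * rot_x1 c s y1 y2 b + rot_x2 c s x1 x2 a * rot_x2 c s y1 y2 b
  + oform (rot_a3 c s x1 x2 a) (rot_a3 c s y1 y2 b) =
  (c * c + s * s) ^+ 2 * (x1 * y1 + x2 * y2 + oform a b).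
Proof.
rewrite /rot_a3 /rot_x1 /rot_x2.
by case: (oct8P a) => *; case: (oct8P b) => *; rewrite !oct8E; ring.
Qed.

Lemma rot_form12 c s a1 a2 b1 b2 :
  oform (rot_a1 c s a1 a2) (rot_a1 c s b1 b2)
  + oform (rot_a2 c s a1 a2) (rot_a2 c s b1 b2) =
  (c * c + s * s) * (oform a1 b1 + oform a2 b2).
Proof.
rewrite /rot_a1 /rot_a2; case: (oct8P a1) => *; case: (oct8P a2) => *.
by case: (oct8P b1) => *; case: (oct8P b2) => *; rewrite !oct8E; ring.
Qed.
End OctonionIdentities.

(** * Symmetry of the polarized cubic form *)

Section FreudenthalIdentities.
Variable K : comNzRingType.
Implicit Types (x y z : K) (a b d : oct K).

(** The trilinear form (u x v : w) in coordinates; its value on the diagonal is 6 det. *)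
Definition tri x1 x2 x3 a1 a2 a3 y1 y2 y3 b1 b2 b3 z1 z2 z3 d1 d2 d3 : K :=
  (x2 * y3 + y2 * x3 - oform a1 b1) * z1
  + (x3 * y1 + y3 * x1 - oform a2 b2) * z2
  + (x1 * y2 + y1 * x2 - oform a3 b3) * z3
  + (oform (ocj (omul a2 b3 + omul b2 a3) - x1 *: b1 - y1 *: a1) d1
  + oform (ocj (omul a3 b1 + omul b3 a1) - x2 *: b2 - y2 *: a2) d2
  + oform (ocj (omul a1 b2 + omul b1 a2) - x3 *: b3 - y3 *: a3) d3).

Lemma oformDl a b d : oform (a + b) d = oform a d + oform b d.
Proof. by rewrite -[a in LHS]scale1r oform_linearl mul1r. Qed.

Lemma oformZl x a d : oform (x *: a) d = x * oform a d.
Proof. by rewrite -[x *: a]addr0 oform_linearl oform0l addr0. Qed.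

Lemma oformNl a d : oform (- a) d = - oform a d.
Proof. by rewrite -scaleN1r oformZl mulN1r. Qed.

(** The octonion products are permuted by [oform_mul_cycle]; after that both sides are the same
    polynomial in values of [oform]. Together with the symmetry of the cross product this yields
    [bform_cross]. *)
Lemma tri_cycle x1 x2 x3 a1 a2 a3 y1 y2 y3 b1 b2 b3 z1 z2 z3 d1 d2 d3 :
  tri x1 x2 x3 a1 a2 a3 y1 y2 y3 b1 b2 b3 z1 z2 z3 d1 d2 d3 =
  tri y1 y2 y3 b1 b2 b3 z1 z2 z3 d1 d2 d3 x1 x2 x3 a1 a2 a3.
Proof.
rewrite /tri !ocjD !oformDl !oformNl !oformZl.
have E a b d := oform_mul_cycle a b d.
rewrite (E b2 d3) (E d2 b3) (E b3 d1) (E d3 b1) (E b1 d2) (E d1 b2).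
rewrite (E d3 a1) (E d1 a2) (E d2 a3).
rewrite !(oformC _ a1) !(oformC _ a2) !(oformC _ a3).
rewrite !(oformC _ b1) !(oformC _ b2) !(oformC _ b3).
ring.
Qed.

Lemma oct_sharpZ x y a b d :
  ocj (omul (x *: a) (x *: b)) - (x * y) *: (x *: d) =
  x ^+ 2 *: (ocj (omul a b) - y *: d).
Proof.
rewrite omulZl omulZr !ocjZ !scalerBr !scalerA.
by congr (_ *: _ - _ *: _); rewrite expr2 // mulrAC.
Qed.

Lemma oform_mull u a b : oform (omul u a) (omul u b) = onorm u * oform a b.
Proof. by rewrite !oformN -omulDr !onorm_mul !mulrBr. Qed.

Lemma oform_mulr u a b : oform (omul a u) (omul b u) = onorm u * oform a b.
Proof. by rewrite !oformN -omulDl !onorm_mul !(mulrC _ (onorm u)) !mulrBr. Qed.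

Lemma omulBl a b d : omul (a - b) d = omul a d - omul b d.
Proof. by rewrite omulDl -[- b]scaleN1r omulZl scaleN1r. Qed.

Lemma omulBr a b d : omul d (a - b) = omul d a - omul d b.
Proof. by rewrite omulDr -[- b]scaleN1r omulZr scaleN1r. Qed.
End FreudenthalIdentities.

(** * Adjugates of rotated elements *)

Section RotationAction.
Variable K : comNzRingType.
Implicit Types (c s t x y : K) (a b : oct K).

Lemma oct_flexible a b : omul a (omul b a) = omul (omul a b) a.
Proof. by case: (oct8P a) => *; case: (oct8P b) => *; rewrite !oct8E; congr oct8; ring. Qed.

Lemma rot_linear c s t x1 x2 y1 y2 a1 a2 a3 b1 b2 b3 :
  [/\ rot_x1 c s (t * x1 + y1) (t * x2 + y2) (t *: a3 + b3) =
        t * rot_x1 c s x1 x2 a3 + rot_x1 c s y1 y2 b3,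
      rot_x2 c s (t * x1 + y1) (t * x2 + y2) (t *: a3 + b3) =
        t * rot_x2 c s x1 x2 a3 + rot_x2 c s y1 y2 b3,
      rot_a1 c s (t *: a1 + b1) (t *: a2 + b2) =
        t *: rot_a1 c s a1 a2 + rot_a1 c s b1 b2,
      rot_a2 c s (t *: a1 + b1) (t *: a2 + b2) =
        t *: rot_a2 c s a1 a2 + rot_a2 c s b1 b2 &
      rot_a3 c s (t * x1 + y1) (t * x2 + y2) (t *: a3 + b3) =
        t *: rot_a3 c s x1 x2 a3 + rot_a3 c s y1 y2 b3].
Proof.
rewrite /rot_x1 /rot_x2 /rot_a1 /rot_a2 /rot_a3.
case: (oct8P a1) => *; case: (oct8P a2) => *; case: (oct8P a3) => *.
case: (oct8P b1) => *; case: (oct8P b2) => *; case: (oct8P b3) => *.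
by split; rewrite !oct8E; try congr oct8; ring.
Qed.

Lemma rot_adj1 c s x1 x2 x3 a1 a2 a3 :
  rot_x2 c s x1 x2 a3 * x3 - onorm (rot_a1 c s a1 a2) =
  rot_x1 c s (x2 * x3 - onorm a1) (x3 * x1 - onorm a2) (ocj (omul a1 a2) - x3 *: a3).
Proof.
rewrite rot_norm_a1 /rot_x1 /rot_x2.
by case: (oct8P a1) => *; case: (oct8P a2) => *; case: (oct8P a3) => *; rewrite !oct8E; ring.
Qed.

Lemma rot_adj2 c s x1 x2 x3 a1 a2 a3 :
  x3 * rot_x1 c s x1 x2 a3 - onorm (rot_a2 c s a1 a2) =
  rot_x2 c s (x2 * x3 - onorm a1) (x3 * x1 - onorm a2) (ocj (omul a1 a2) - x3 *: a3).
Proof.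
rewrite rot_norm_a2 /rot_x1 /rot_x2.
by case: (oct8P a1) => *; case: (oct8P a2) => *; case: (oct8P a3) => *; rewrite !oct8E; ring.
Qed.

Lemma rot_adj3 c s x1 x2 x3 a1 a2 a3 :
  ocj (omul (rot_a1 c s a1 a2) (rot_a2 c s a1 a2)) - x3 *: rot_a3 c s x1 x2 a3 =
  rot_a3 c s (x2 * x3 - onorm a1) (x3 * x1 - onorm a2) (ocj (omul a1 a2) - x3 *: a3).
Proof.
rewrite rot_a1a2 /rot_a3.
case: (oct8P a1) => *; case: (oct8P a2) => *; case: (oct8P a3) => *.
by rewrite !oct8E; congr oct8; ring.
Qed.
End RotationAction.

(** * Change of scalars, to be applied to complex conjugation *)

Section Conjugation.
Variables (K L : comNzRingType) (f : {rmorphism K -> L}).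
Implicit Types (a b : oct K).

Lemma map_oct8 (x0 x1 x2 x3 x4 x5 x6 x7 : K) :
  map_mx f (oct8 x0 x1 x2 x3 x4 x5 x6 x7) =
  oct8 (f x0) (f x1) (f x2) (f x3) (f x4) (f x5) (f x6) (f x7).
Proof.
rewrite /oct8 /mk_oct map_row_mx; congr row_mx.
  by rewrite (@map_scalar_mx _ _ f).
apply/rowP => k; rewrite !mxE.
by case: k => [[|[|[|[|[|[|[|//]]]]]]] k7].
Qed.

Lemma map_omul a b :
  map_mx f (omul a b) = omul (map_mx f a) (map_mx f b).
Proof.
case: (oct8P a) => *; case: (oct8P b) => *; rewrite !(map_oct8, oct8E).
by rewrite !(rmorphM, rmorphD, rmorphN).
Qed.

Lemma map_ocj a : map_mx f (ocj a) = ocj (map_mx f a).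
Proof. by case: (oct8P a) => *; rewrite !(map_oct8, oct8E) ?rmorphN. Qed.

Lemma map_onorm a : onorm (map_mx f a) = f (onorm a).
Proof. by case: (oct8P a) => *; rewrite !(map_oct8, oct8E) !(rmorphD, rmorphM, rmorphN). Qed.

Lemma map_oform a b :
  oform (map_mx f a) (map_mx f b) = f (oform a b).
Proof. by rewrite !oformN -(@map_mxD _ _ f) !map_onorm !rmorphB. Qed.

Lemma map_rot (c s x1 x2 : K) (a1 a2 a3 : oct K) :
  [/\ rot_x1 (f c) (f s) (f x1) (f x2) (map_mx f a3) = f (rot_x1 c s x1 x2 a3),
      rot_x2 (f c) (f s) (f x1) (f x2) (map_mx f a3) = f (rot_x2 c s x1 x2 a3),
      rot_a1 (f c) (f s) (map_mx f a1) (map_mx f a2) = map_mx f (rot_a1 c s a1 a2),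
      rot_a2 (f c) (f s) (map_mx f a1) (map_mx f a2) = map_mx f (rot_a2 c s a1 a2) &
      rot_a3 (f c) (f s) (f x1) (f x2) (map_mx f a3) = map_mx f (rot_a3 c s x1 x2 a3)].
Proof.
rewrite /rot_x1 /rot_x2 /rot_a1 /rot_a2 /rot_a3.
case: (oct8P a1) => *; case: (oct8P a2) => *; case: (oct8P a3) => *.
by split; rewrite !(map_oct8, oct8E); try congr oct8;
  rewrite ?(rmorphD, rmorphM, rmorphN, rmorph1, rmorph0) //=; ring.
Qed.
End Conjugation.

(** * Coordinates and the Hermitian form *)

HB.lock Definition adj (R : realType) (u : H3 R) : H3 R := sharp u.
HB.lock Definition cross (R : realType) (u v : H3 R) : H3 R := freudenthal u v.
HB.lock Definition bform (R : realType) (u v : H3 R) : R[i] := form u v.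
HB.lock Definition cj (R : realType) (u : H3 R) : H3 R := conjH u.
HB.lock Definition hm (R : realType) (u v : H3 R) : R[i] := herm u v.
HB.lock Definition tp (R : realType) (u v w : H3 R) : H3 R := triple u v w.
HB.lock Definition hdet (R : realType) (u : H3 R) : R[i] := detH u.
HB.lock Definition h3 (R : realType) (x1 x2 x3 : R[i]) (a1 a2 a3 : oct R[i]) : H3 R :=
  mk_H3 (fun i : 'I_3 => [:: x1; x2; x3]`_i) (fun i : 'I_3 => nth 0 [:: a1; a2; a3] i).

Section Coordinates.
Variable R : realType.
Local Notation C := R[i].
Local Notation bar := (map_mx conjc).
Implicit Types (c t x y z : C) (a b d : oct C) (e f u v w : H3 R).

Variant h3_spec : H3 R -> Prop :=
  H3Spec x1 x2 x3 a1 a2 a3 : h3_spec (h3 x1 x2 x3 a1 a2 a3).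

Lemma diag_h3 x1 x2 x3 a1 a2 a3 i :
  diag (h3 x1 x2 x3 a1 a2 a3) i = [:: x1; x2; x3]`_i.
Proof. by rewrite h3.unlock diag_mk. Qed.

Lemma off_h3 x1 x2 x3 a1 a2 a3 i :
  off (h3 x1 x2 x3 a1 a2 a3) i = nth 0 [:: a1; a2; a3] i.
Proof. by rewrite h3.unlock off_mk. Qed.

Lemma h3P u : h3_spec u.
Proof.
suff -> : u = h3 (diag u ord0) (diag u (inord 1)) (diag u (inord 2))
  (off u ord0) (off u (inord 1)) (off u (inord 2)) by [].
apply: H3_eqP => i; rewrite ?diag_h3 ?off_h3.
  case: i => [[|[|[|//]]] i3] /=; congr (diag u _); apply/val_inj;
  by rewrite /= ?inordK.
case: i => [[|[|[|//]]] i3] /=; congr (off u _); apply/val_inj;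
by rewrite /= ?inordK.
Qed.

Lemma h3_inj x1 x2 x3 a1 a2 a3 y1 y2 y3 b1 b2 b3 :
  h3 x1 x2 x3 a1 a2 a3 = h3 y1 y2 y3 b1 b2 b3 ->
  [/\ x1 = y1, x2 = y2 & x3 = y3] /\ [/\ a1 = b1, a2 = b2 & a3 = b3].
Proof.
move=> e; split; split.
- by have := congr1 (fun u => diag u (@Ordinal 3 0 isT)) e; rewrite /= !diag_h3.
- by have := congr1 (fun u => diag u (@Ordinal 3 1 isT)) e; rewrite /= !diag_h3.
- by have := congr1 (fun u => diag u (@Ordinal 3 2 isT)) e; rewrite /= !diag_h3.
- by have := congr1 (fun u => off u (@Ordinal 3 0 isT)) e; rewrite /= !off_h3.
- by have := congr1 (fun u => off u (@Ordinal 3 1 isT)) e; rewrite /= !off_h3.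
- by have := congr1 (fun u => off u (@Ordinal 3 2 isT)) e; rewrite /= !off_h3.
Qed.

Lemma h3_lin c x1 x2 x3 a1 a2 a3 y1 y2 y3 b1 b2 b3 :
  c *: h3 x1 x2 x3 a1 a2 a3 + h3 y1 y2 y3 b1 b2 b3 =
  h3 (c * x1 + y1) (c * x2 + y2) (c * x3 + y3)
     (c *: a1 + b1) (c *: a2 + b2) (c *: a3 + b3).
Proof.
by apply: H3_eqP => i; rewrite ?diagP ?offP ?diag_h3 ?off_h3;
  case: i => [[|[|[|//]]] i3].
Qed.

Lemma h3_zero : 0 = h3 0 0 0 0 0 0 :> H3 R.
Proof.
apply: H3_eqP => i; rewrite ?diag_h3 ?off_h3.
  by rewrite /diag mxE; case: i => [[|[|[|//]]] i3].
by rewrite /off linear0; case: i => [[|[|[|//]]] i3].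
Qed.

Lemma h3_add x1 x2 x3 a1 a2 a3 y1 y2 y3 b1 b2 b3 :
  h3 x1 x2 x3 a1 a2 a3 + h3 y1 y2 y3 b1 b2 b3 =
  h3 (x1 + y1) (x2 + y2) (x3 + y3) (a1 + b1) (a2 + b2) (a3 + b3).
Proof.
have /= := @h3_lin 1 x1 x2 x3 a1 a2 a3 y1 y2 y3 b1 b2 b3.
by rewrite !mul1r !scale1r.
Qed.

Lemma h3_scale c x1 x2 x3 a1 a2 a3 :
  c *: h3 x1 x2 x3 a1 a2 a3 =
  h3 (c * x1) (c * x2) (c * x3) (c *: a1) (c *: a2) (c *: a3).
Proof.
have := h3_lin c x1 x2 x3 a1 a2 a3 0 0 0 0 0 0.
by rewrite -h3_zero !addr0.
Qed.

Lemma h3_opp x1 x2 x3 a1 a2 a3 :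
  - h3 x1 x2 x3 a1 a2 a3 = h3 (- x1) (- x2) (- x3) (- a1) (- a2) (- a3).
Proof.
have := h3_scale (-1) x1 x2 x3 a1 a2 a3.
by rewrite !scaleN1r !mulN1r.
Qed.

Lemma adj_h3 x1 x2 x3 a1 a2 a3 : adj (h3 x1 x2 x3 a1 a2 a3) =
  h3 (x2 * x3 - onorm a1) (x3 * x1 - onorm a2) (x1 * x2 - onorm a3)
    (ocj (omul a2 a3) - x1 *: a1) (ocj (omul a3 a1) - x2 *: a2)
    (ocj (omul a1 a2) - x3 *: a3).
Proof.
rewrite adj.unlock.
by apply: H3_eqP => i; rewrite ?diag_sharp ?off_sharp !diag_h3 !off_h3;
  case: i => [[|[|[|//]]] i3]; rewrite /= ?onormE ?oform_octE ?(ocjD (omul _ _)) ?ocj_omulE -?oct_conjD.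
Qed.

Lemma cross_h3 x1 x2 x3 a1 a2 a3 y1 y2 y3 b1 b2 b3 :
  cross (h3 x1 x2 x3 a1 a2 a3) (h3 y1 y2 y3 b1 b2 b3) =
  h3 (x2 * y3 + y2 * x3 - oform a1 b1) (x3 * y1 + y3 * x1 - oform a2 b2)
    (x1 * y2 + y1 * x2 - oform a3 b3)
    (ocj (omul a2 b3 + omul b2 a3) - x1 *: b1 - y1 *: a1)
    (ocj (omul a3 b1 + omul b3 a1) - x2 *: b2 - y2 *: a2)
    (ocj (omul a1 b2 + omul b1 a2) - x3 *: b3 - y3 *: a3).
Proof.
rewrite cross.unlock.
by apply: H3_eqP => i; rewrite ?diag_freudenthal ?off_freudenthal !diag_h3 !off_h3;
  case: i => [[|[|[|//]]] i3]; rewrite /= ?onormE ?oform_octE ?(ocjD (omul _ _)) ?ocj_omulE -?oct_conjD.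
Qed.

Lemma bform_h3 x1 x2 x3 a1 a2 a3 y1 y2 y3 b1 b2 b3 :
  bform (h3 x1 x2 x3 a1 a2 a3) (h3 y1 y2 y3 b1 b2 b3) =
  x1 * y1 + x2 * y2 + x3 * y3
  + (oform a1 b1 + oform a2 b2 + oform a3 b3).
Proof.
rewrite bform.unlock !oform_octE /form !big_ord_recl !big_ord0 !diag_h3 !off_h3 /=.
by rewrite !addr0 !addrA.
Qed.

Lemma cj_h3 x1 x2 x3 a1 a2 a3 : cj (h3 x1 x2 x3 a1 a2 a3) =
  h3 (conjc x1) (conjc x2) (conjc x3) (bar a1) (bar a2) (bar a3).
Proof.
rewrite cj.unlock.
have dE (u : H3 R) i : diag (conjH u) i = conjc (diag u i) by rewrite /diag mxE.
have oE (u : H3 R) i : off (conjH u) i = bar (off u i) by rewrite /off map_row.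
by apply: H3_eqP => i; rewrite ?dE ?oE ?diag_h3 ?off_h3; case: i => [[|[|[|//]]] i3].
Qed.

Lemma bform_cross u v w : bform (cross u v) w = bform u (cross v w).
Proof.
case: (h3P u) => x1 x2 x3 a1 a2 a3; case: (h3P v) => y1 y2 y3 b1 b2 b3.
case: (h3P w) => z1 z2 z3 d1 d2 d3.
rewrite !cross_h3 !bform_h3.
have := tri_cycle x1 x2 x3 a1 a2 a3 y1 y2 y3 b1 b2 b3 z1 z2 z3 d1 d2 d3.
rewrite /tri => ->.
move: (_ - _) (_ - _) (_ - _) (_ - _) (_ - _) (_ - _) => p1 p2 p3 q1 q2 q3.
by rewrite !(oformC _ a1) !(oformC _ a2) !(oformC _ a3) !(mulrC _ x1)
  !(mulrC _ x2) !(mulrC _ x3).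
Qed.
End Coordinates.

Section HermitianForm.
Variable R : realType.
Local Notation C := R[i].
Local Notation bar := (map_mx conjc).
Implicit Types (c t x y z : C) (a b d : oct C) (e f u v w : H3 R).

Lemma conjcD x y : conjc (x + y) = conjc x + conjc y.
Proof. exact: rmorphD. Qed.

Lemma conjcB x y : conjc (x - y) = conjc x - conjc y.
Proof. exact: rmorphB. Qed.

Lemma conjcM x y : conjc (x * y) = conjc x * conjc y.
Proof. exact: rmorphM. Qed.

Lemma crossE u v : cross u v = adj (u + v) - adj u - adj v.
Proof. by rewrite cross.unlock adj.unlock. Qed.

Lemma hmE u v : hm u v = bform u (cj v).
Proof. by rewrite hm.unlock bform.unlock cj.unlock. Qed.

Lemma tpE u v w : tp u v w = hm u v *: w + hm w v *: u - cross (cross u w) (cj v).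
Proof. by rewrite tp.unlock hm.unlock cross.unlock cj.unlock. Qed.

Lemma hdetE u : hdet u = 3%:R^-1 * bform (adj u) u.
Proof. by rewrite hdet.unlock bform.unlock adj.unlock. Qed.

Lemma crossC u v : cross u v = cross v u.
Proof. by rewrite cross.unlock freudenthalC. Qed.

Lemma cross_linearr u c v w : cross u (c *: v + w) = c *: cross u v + cross u w.
Proof. by rewrite cross.unlock freudenthal_linearr. Qed.

Lemma hm_linearl c u v w : hm (c *: u + v) w = c * hm u w + hm v w.
Proof. by rewrite hm.unlock hermP. Qed.

Lemma tp_linear u v c w e : tp u v (c *: w + e) = c *: tp u v w + tp u v e.
Proof. by rewrite tp.unlock triple_linear. Qed.

Lemma cjK u : cj (cj u) = u.
Proof.
rewrite cj.unlock /conjH /=.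
case: u => u1 u2; rewrite /=; congr pair; apply/matrixP => i j;
by rewrite !mxE conjcK.
Qed.

Lemma cj_lin c u v : cj (c *: u + v) = conjc c *: cj u + cj v.
Proof.
rewrite cj.unlock /conjH /=.
case: u => u1 u2; case: v => v1 v2; rewrite /=; congr pair; apply/matrixP => i j;
by rewrite !mxE rmorphD rmorphM.
Qed.

Lemma cjD u v : cj (u + v) = cj u + cj v.
Proof. by have := cj_lin 1 u v; rewrite rmorph1 !scale1r. Qed.

Lemma cj0 : cj 0 = 0 :> H3 R.
Proof. by apply: (addrI (cj 0)); rewrite -cjD !addr0. Qed.

Lemma cjZ c u : cj (c *: u) = conjc c *: cj u.
Proof. by have := cj_lin c u 0; rewrite cj0 !addr0. Qed.

Lemma cjN u : cj (- u) = - cj u.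
Proof. by rewrite -[- u]scaleN1r -[RHS]scaleN1r cjZ rmorphN1. Qed.

Lemma cjB u v : cj (u - v) = cj u - cj v.
Proof. by rewrite cjD cjN. Qed.

Lemma adj_cj u : adj (cj u) = cj (adj u).
Proof.
case: (h3P u) => x1 x2 x3 a1 a2 a3; rewrite !(cj_h3, adj_h3).
have E1 x y a : conjc (x * y - onorm a) = conjc x * conjc y - onorm (bar a).
  by rewrite rmorphB rmorphM map_onorm.
have E2 x a b d : bar (ocj (omul a b) - x *: d)
    = ocj (omul (bar a) (bar b)) - conjc x *: bar d.
  by rewrite map_mxB map_mxZ map_ocj map_omul.
by congr (h3 _ _ _ _ _ _); apply/esym; (exact: E1) || exact: E2.
Qed.

Lemma cross_cj u v :
  cross (cj u) (cj v) = cj (cross u v).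
Proof. by rewrite !crossE !cjB !adj_cj -cjD adj_cj. Qed.

Lemma bform_cj u v : bform (cj u) (cj v) = conjc (bform u v).
Proof.
case: (h3P u) => x1 x2 x3 a1 a2 a3; case: (h3P v) => y1 y2 y3 b1 b2 b3.
by rewrite !(cj_h3, bform_h3) !(map_oform, rmorphD, rmorphM).
Qed.

Lemma bformC u v : bform u v = bform v u.
Proof.
case: (h3P u) => x1 x2 x3 a1 a2 a3; case: (h3P v) => y1 y2 y3 b1 b2 b3.
rewrite !bform_h3 (oformC a1) (oformC a2) (oformC a3).
by rewrite (mulrC x1) (mulrC x2) (mulrC x3).
Qed.

Lemma hm_conj u v : hm v u = conjc (hm u v).
Proof. by rewrite ?hmE -bform_cj cjK bformC. Qed.

Lemma bformE u v : bform u v = hm u (cj v).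
Proof. by rewrite ?hmE cjK. Qed.

Lemma hm_cj u v : hm (cj u) (cj v) = conjc (hm u v).
Proof. by rewrite ?hmE -bform_cj. Qed.

Lemma hmDl u v w : hm (u + v) w = hm u w + hm v w.
Proof. by have := hm_linearl 1 u v w; rewrite scale1r mul1r. Qed.

Lemma hm0l w : hm 0 w = 0.
Proof. by apply: (addrI (hm 0 w)); rewrite -hmDl !addr0. Qed.

Lemma hmZl c u w : hm (c *: u) w = c * hm u w.
Proof. by have := hm_linearl c u 0 w; rewrite hm0l !addr0. Qed.

Lemma hmNl u w : hm (- u) w = - hm u w.
Proof. by rewrite -scaleN1r hmZl mulN1r. Qed.

Lemma hmDr u v w : hm w (u + v) = hm w u + hm w v.
Proof. by rewrite !(hm_conj _ w) hmDl conjcD. Qed.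

Lemma hm0r w : hm w 0 = 0.
Proof. by rewrite hm_conj hm0l rmorph0. Qed.

Lemma hmZr c u w : hm w (c *: u) = conjc c * hm w u.
Proof. by rewrite !(hm_conj _ w) hmZl conjcM. Qed.

Lemma hm_h3 x1 x2 x3 a1 a2 a3 y1 y2 y3 b1 b2 b3 :
  hm (h3 x1 x2 x3 a1 a2 a3) (h3 y1 y2 y3 b1 b2 b3) =
  x1 * conjc y1 + x2 * conjc y2 + x3 * conjc y3
  + (oform a1 (bar b1) + oform a2 (bar b2) + oform a3 (bar b3)).
Proof. by rewrite ?hmE cj_h3 bform_h3. Qed.

Lemma oherm_ge0 a : 0 <= oform a (bar a).
Proof.
rewrite oformE; apply: sumr_ge0 => k _; rewrite -mulrA mxE.
by apply: mulr_ge0; [exact: ler0n | exact: mulcJ_ge0].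
Qed.

Lemma oherm_eq0 a : oform a (bar a) = 0 -> a = 0.
Proof.
move/eqP; rewrite oformE psumr_eq0; last first.
  by move=> k _; rewrite -mulrA mxE; apply: mulr_ge0; [exact: ler0n | exact: mulcJ_ge0].
move/allP => a0; apply/rowP => k; rewrite [RHS]mxE; apply/eqP.
have := a0 k (mem_index_enum k); rewrite /= mxE -mulrA mulf_eq0 pnatr_eq0 /=.
by rewrite mulf_eq0 conjc_eq0 orbb.
Qed.

Lemma hm_sum_ge0 x y z : 0 <= x * conjc x + y * conjc y + z * conjc z.
Proof. by apply: addr_ge0 (mulcJ_ge0 z); apply: addr_ge0; exact: mulcJ_ge0. Qed.

Lemma oherm_sum_ge0 a b d :
  0 <= oform a (bar a) + oform b (bar b) + oform d (bar d).
Proof. exact: addr_ge0 (addr_ge0 (oherm_ge0 a) (oherm_ge0 b)) (oherm_ge0 d). Qed.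

Lemma hm_ge0 u : 0 <= hm u u.
Proof.
case: (h3P u) => x1 x2 x3 a1 a2 a3; rewrite hm_h3.
exact: addr_ge0 (hm_sum_ge0 _ _ _) (oherm_sum_ge0 _ _ _).
Qed.

Lemma hm_eq0 u : hm u u = 0 -> u = 0.
Proof.
case: (h3P u) => x1 x2 x3 a1 a2 a3; rewrite hm_h3 => /eqP.
rewrite (paddr_eq0 (hm_sum_ge0 _ _ _) (oherm_sum_ge0 _ _ _)).
have := oherm_eq0 (a := a1); have := oherm_eq0 (a := a2).
have := oherm_eq0 (a := a3).
have := oherm_ge0 a1; have := oherm_ge0 a2; have := oherm_ge0 a3.
move: (oform a1 _) (oform a2 _) (oform a3 _) => n1 n2 n3.
move=> n3_ge0 n2_ge0 n1_ge0 n3_eq0 n2_eq0 n1_eq0.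
rewrite (paddr_eq0 (addr_ge0 n1_ge0 n2_ge0) n3_ge0) (paddr_eq0 n1_ge0 n2_ge0).
have x_ge0 := @mulcJ_ge0 R.
rewrite (paddr_eq0 (addr_ge0 (x_ge0 x1) (x_ge0 x2)) (x_ge0 x3)) (paddr_eq0 (x_ge0 x1) (x_ge0 x2)).
have E x : (x * conjc x == 0) = (x == 0) by rewrite mulf_eq0 conjc_eq0 orbb.
rewrite !E => /andP[/andP[/andP[/eqP -> /eqP ->] /eqP ->] /andP[/andP[]]].
move=> /eqP/n1_eq0 -> /eqP/n2_eq0 -> /eqP/n3_eq0 ->.
by rewrite -h3_zero.
Qed.

(** Identities between vectors are often proved by pairing both sides with an arbitrary w, which
    turns them into scalar identities for [ring]. *)
Lemma hm_inj u v : (forall w, hm u w = hm v w) -> u = v.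
Proof.
move=> uv; apply/eqP; rewrite -subr_eq0; apply/eqP/hm_eq0.
by rewrite hmDl hmNl uv subrr.
Qed.

Lemma adjZ c u : adj (c *: u) = c ^+ 2 *: adj u.
Proof.
case: (h3P u) => x1 x2 x3 a1 a2 a3; rewrite !(h3_scale, adj_h3).
have E1 x y a : c * x * (c * y) - onorm (c *: a) = c ^+ 2 * (x * y - onorm a).
  by rewrite onormZ mulrBr mulrACA expr2.
have E2 x a b d : ocj (omul (c *: a) (c *: b)) - (c * x) *: (c *: d)
    = c ^+ 2 *: (ocj (omul a b) - x *: d).
  exact: oct_sharpZ.
by congr (h3 _ _ _ _ _ _); (exact: E1) || exact: E2.
Qed.

Lemma crossDr u v w : cross w (u + v) = cross w u + cross w v.
Proof. by have := cross_linearr w 1 u v; rewrite !scale1r. Qed.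

Lemma cross0r w : cross w 0 = 0.
Proof. by apply: (addrI (cross w 0)); rewrite -crossDr !addr0. Qed.

Lemma crossZr c u w : cross w (c *: u) = c *: cross w u.
Proof. by have := cross_linearr w c u 0; rewrite cross0r !addr0. Qed.

Lemma crossDl u v w : cross (u + v) w = cross u w + cross v w.
Proof. by rewrite !(crossC _ w) crossDr. Qed.

Lemma crossZl c u w : cross (c *: u) w = c *: cross u w.
Proof. by rewrite !(crossC _ w) crossZr. Qed.

Lemma crossxx u : cross u u = 2%:R *: adj u.
Proof.
rewrite ?crossE -{1}[u]scale1r -{2}[u]scale1r -scalerDl adjZ -addrA -opprD.
rewrite -{2}[adj u]scale1r -{3}[adj u]scale1r -scalerDl -scalerBl.
by congr (_ *: _); ring.
Qed.

Lemma adjD u v : adj (u + v) = adj u + cross u v + adj v.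
Proof.
rewrite crossE; move: (adj (u + v)) (adj u) (adj v) => p q r.
by rewrite -addrA subrK addrC subrK.
Qed.

(** Associativity of the bilinear form turns the nested cross product into a Hermitian product of
    two cross products; the symmetries of the triple product are visible in this form. *)
Lemma tp_herm u v w e : hm (tp u v w) e =
  hm u v * hm w e + hm w v * hm u e
  - hm (cross u w) (cross v e).
Proof.
rewrite tpE hmDl hmDl hmNl !hmZl; congr (_ - _).
by rewrite !hmE bform_cross cross_cj.
Qed.

Lemma tpC u v w : tp u v w = tp w v u.
Proof. rewrite !tpE (crossC u w); congr (_ - _); exact: addrC. Qed.

Lemma hm_tp u v w e : hm (tp u v w) e = hm w (tp v u e).
Proof.
rewrite [RHS]hm_conj !tp_herm conjcB conjcD !conjcM.
rewrite -(hm_conj v u) -(hm_conj e w) -(hm_conj e u) -(hm_conj v w).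
rewrite -(hm_conj (cross v e)).
move: (hm _ _) (hm _ _) (hm _ _) (hm _ _) (hm _ _) => p q r t z.
by congr (_ + _ - _); apply: mulrC.
Qed.

(** By [hm_tp], D(f, e) is the Hermitian adjoint of D(e, f). *)
Lemma tp_eq0C e f : (forall w, tp e f w = 0) -> forall w, tp f e w = 0.
Proof.
move=> ef w; apply: hm_inj => v; rewrite hm_tp ef.
by rewrite hm0r hm0l.
Qed.

Lemma tpDl u v w e : tp (u + v) w e = tp u w e + tp v w e.
Proof.
have := tp_linear e w 1 u v; rewrite !scale1r !(tpC e) => <-.
by rewrite tpC.
Qed.

Lemma tpDr u v w e : tp w e (u + v) = tp w e u + tp w e v.
Proof. by rewrite !(tpC w) tpDl. Qed.

Lemma tpZr c u v w : tp u v (c *: w) = c *: tp u v w.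
Proof.
have := tp_linear u v c w 0; rewrite addr0 => ->.
suff -> : tp u v 0 = 0 by rewrite addr0.
by apply: (addrI (tp u v 0)); rewrite -tpDr !addr0.
Qed.

Lemma tpZl c u v w : tp (c *: u) v w = c *: tp u v w.
Proof. by rewrite !(tpC _ v w) tpZr. Qed.

Lemma tpDm u v w e : tp u (v + w) e = tp u v e + tp u w e.
Proof.
apply: hm_inj => z; rewrite hmDl !tp_herm !hmDr crossDl hmDr.
ring.
Qed.

Lemma tpZm c u v w : tp u (c *: v) w = conjc c *: tp u v w.
Proof.
apply: hm_inj => z; rewrite hmZl !tp_herm !hmZr crossZl hmZr.
ring.
Qed.
End HermitianForm.

(** * Automorphisms *)

Section Automorphisms.
Variable R : realType.
Local Notation C := R[i].
Local Notation bar := (map_mx conjc).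
Implicit Types (c t x y z : C) (a b d : oct C) (e f u v w : H3 R) (k : H3 R -> H3 R).

(* Equivariance of [adj] up to two conjugations: an isometry preserving the cubic form
   intertwines [adj] with the contragredient action. *)
Definition aut k : Prop :=
  [/\ forall c u v, k (c *: u + v) = c *: k u + k v,
      forall u v, hm (k u) (k v) = hm u v &
      forall u, adj (k u) = cj (k (cj (adj u)))].

Lemma aut_id : aut id.
Proof. by split=> // u; rewrite cjK. Qed.

Lemma aut_comp k k' : aut k -> aut k' -> aut (k \o k').
Proof.
move=> [l h s] [l' h' s']; split=> /= [c u v|u v|u]; first by rewrite l' l.
  by rewrite h h'.
by rewrite s s' cjK.
Qed.

Section Aut.
Variables (k : H3 R -> H3 R) (kA : aut k).

Lemma aut_linear c u v : k (c *: u + v) = c *: k u + k v.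
Proof. by case: kA. Qed.

Lemma aut_hm u v : hm (k u) (k v) = hm u v.
Proof. by case: kA. Qed.

Lemma aut_adj u : adj (k u) = cj (k (cj (adj u))).
Proof. by case: kA. Qed.

Lemma autD u v : k (u + v) = k u + k v.
Proof. by have := aut_linear 1 u v; rewrite !scale1r. Qed.

Lemma aut0 : k 0 = 0.
Proof. by apply: (addrI (k 0)); rewrite -autD !addr0. Qed.

Lemma autZ c u : k (c *: u) = c *: k u.
Proof. by have := aut_linear c u 0; rewrite aut0 !addr0. Qed.

Lemma autN u : k (- u) = - k u.
Proof. by rewrite -[- u]scaleN1r -[RHS]scaleN1r autZ. Qed.

Lemma autB u v : k (u - v) = k u - k v.
Proof. by rewrite autD autN. Qed.

Lemma aut_inj : injective k.
Proof.
move=> u v kuv; apply/eqP; rewrite -subr_eq0; apply/eqP/hm_eq0.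
by rewrite -aut_hm autB kuv subrr hm0l.
Qed.

Lemma aut_cross u v : cross (k u) (k v) = cj (k (cj (cross u v))).
Proof. by rewrite !crossE -autD !aut_adj !cjB !autB !cjB. Qed.

Lemma aut_tp u v w : tp (k u) (k v) (k w) = k (tp u v w).
Proof.
rewrite !tpE autB autD !autZ !aut_hm; congr (_ - _).
by rewrite aut_cross cross_cj aut_cross cjK -cross_cj cjK.
Qed.

Lemma aut_hdet u : hdet (k u) = hdet u.
Proof.
rewrite !hdetE; congr (_ * _); rewrite aut_adj bformC [RHS]bformC.
by rewrite !bformE cjK aut_hm.
Qed.

Lemma aut_hm_adj u : hm (adj (k u)) (adj (k u)) = hm (adj u) (adj u).
Proof. by rewrite !aut_adj hm_cj aut_hm hm_cj conjcK. Qed.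

Lemma aut_inverse : exists k', [/\ aut k', cancel k k' & cancel k' k].
Proof.
pose lin := GRing.isLinear.Build _ _ _ _ k aut_linear.
pose K : {linear H3 R -> H3 R} := HB.pack k lin.
have ker0 : lker (linfun K) == 0%VS.
  apply/lker0P => u v; rewrite !lfunE; exact: aut_inj.
have kK : cancel k (linfun K)^-1%VF.
  by move=> u; have := lker0_lfunK ker0 u; rewrite lfunE.
have Kk : cancel (linfun K)^-1%VF k.
  by move=> u; have := lker0_lfunVK ker0 u; rewrite lfunE.
exists (linfun K)^-1%VF; split=> //; split=> [c u v|u v|u].
- by rewrite linearP.
- by rewrite -aut_hm !Kk.
by rewrite -{2}(Kk u) aut_adj cjK kK cjK.
Qed.
End Aut.

Definition cyc u : H3 R :=
  h3 (diag u (inord 1)) (diag u (inord 2)) (diag u ord0)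
     (off u (inord 1)) (off u (inord 2)) (off u ord0).

Lemma cyc_h3 x1 x2 x3 a1 a2 a3 :
  cyc (h3 x1 x2 x3 a1 a2 a3) = h3 x2 x3 x1 a2 a3 a1.
Proof. by rewrite /cyc !diag_h3 !off_h3 /= !inordK. Qed.

Lemma aut_cyc : aut cyc.
Proof.
split=> [c u v|u v|u].
- case: (h3P u) => x1 x2 x3 a1 a2 a3; case: (h3P v) => y1 y2 y3 b1 b2 b3.
  by rewrite h3_lin !cyc_h3 h3_lin.
- case: (h3P u) => x1 x2 x3 a1 a2 a3; case: (h3P v) => y1 y2 y3 b1 b2 b3.
  rewrite !cyc_h3 !hm_h3.
  have E p q r : q + r + p = p + q + r :> C by rewrite addrC addrA.
  by congr (_ + _); exact: E.
- case: (h3P u) => x1 x2 x3 a1 a2 a3.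
  by rewrite cyc_h3 !adj_h3 cj_h3 cyc_h3 -cj_h3 cjK.
Qed.

(** This is u -> T u T with T the diagonal matrix of t1, t2, t3: when these are phases of product 1,
    the factor t2 t3 of the first off-diagonal entry is the conjugate of t1, and similarly for the
    others. *)
Definition torus t1 t2 t3 u : H3 R :=
  h3 (t1 ^+ 2 * diag u ord0) (t2 ^+ 2 * diag u (inord 1)) (t3 ^+ 2 * diag u (inord 2))
     (conjc t1 *: off u ord0) (conjc t2 *: off u (inord 1)) (conjc t3 *: off u (inord 2)).

Lemma torus_h3 t1 t2 t3 x1 x2 x3 a1 a2 a3 :
  torus t1 t2 t3 (h3 x1 x2 x3 a1 a2 a3) =
  h3 (t1 ^+ 2 * x1) (t2 ^+ 2 * x2) (t3 ^+ 2 * x3)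
     (conjc t1 *: a1) (conjc t2 *: a2) (conjc t3 *: a3).
Proof. by rewrite /torus !diag_h3 !off_h3 /= !inordK. Qed.

Lemma bar_scale c a : bar (c *: a) = conjc c *: bar a.
Proof. by apply/rowP => i; rewrite !mxE conjcM. Qed.

Lemma aut_torus t1 t2 t3 : t1 * t2 * t3 = 1 -> t1 * conjc t1 = 1 ->
  t2 * conjc t2 = 1 -> t3 * conjc t3 = 1 -> aut (torus t1 t2 t3).
Proof.
move=> t123 u1 u2 u3.
have E3 x y z : x * y * z = 1 -> z * conjc z = 1 -> x * y = conjc z.
  by move=> xyz zz; rewrite -[LHS]mulr1 -zz mulrA xyz mul1r.
have t12 := E3 _ _ _ t123 u3.
have t23 : t2 * t3 = conjc t1 by apply: E3 u1; rewrite -t123 mulrC mulrA.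
have t31 : t3 * t1 = conjc t2 by apply: E3 u2; rewrite -t123 mulrAC mulrC mulrA mulrAC.
have P x y t1' t2' t3' : t1' * t2' = conjc t3' ->
    t1' ^+ 2 * x * (t2' ^+ 2 * y) = conjc t3' ^+ 2 * (x * y).
  by move=> <-; ring.
have N t a : onorm (conjc t *: a) = conjc t ^+ 2 * onorm a.
  exact: onormZ.
have M t1' t2' t3' a b x d : t1' * t2' = conjc t3' -> t3' * conjc t3' = 1 ->
    ocj (omul (conjc t1' *: a) (conjc t2' *: b)) - (t3' ^+ 2 * x) *: (conjc t3' *: d)
    = t3' *: (ocj (omul a b) - x *: d).
  move=> e1 e3; rewrite omulZl omulZr !ocjZ scalerA -conjcM e1 conjcK.
  rewrite scalerBr !scalerA; congr (_ - _ *: _).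
  transitivity (t3' * (t3' * conjc t3') * x); first by ring.
  by rewrite e3 mulr1.
have Q t x y : t * conjc t = 1 -> t ^+ 2 * x * conjc (t ^+ 2 * y) = x * conjc y.
  move=> tt; rewrite conjcM expr2 conjcM.
  have -> : t * t * x * (conjc t * conjc t * conjc y)
     = (t * conjc t) * (t * conjc t) * (x * conjc y) by ring.
  by rewrite tt !mul1r.
have F t a b : t * conjc t = 1 ->
   oform (conjc t *: a) (bar (conjc t *: b)) = oform a (bar b).
  move=> tt; rewrite bar_scale conjcK oformZl oformC oformZl mulrA.
  by rewrite (mulrC (conjc t)) tt mul1r oformC.
split=> [c u v|u v|u].
- case: (h3P u) => x1 x2 x3 a1 a2 a3; case: (h3P v) => y1 y2 y3 b1 b2 b3.
  rewrite h3_lin !torus_h3 h3_lin.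
  by congr (h3 _ _ _ _ _ _); rewrite ?mulrDr 1?mulrCA // scalerDr !scalerA (mulrC c).
- case: (h3P u) => x1 x2 x3 a1 a2 a3; case: (h3P v) => y1 y2 y3 b1 b2 b3.
  by rewrite !torus_h3 !hm_h3 !Q // !F.
case: (h3P u) => x1 x2 x3 a1 a2 a3.
rewrite torus_h3 !adj_h3 cj_h3 torus_h3 cj_h3.
have D t x : conjc (t ^+ 2 * conjc x) = conjc t ^+ 2 * x.
  by rewrite conjcM conjcK expr2 conjcM.
have O t a : bar (conjc t *: bar a) = t *: a.
  by rewrite bar_scale conjcK; congr (_ *: _); apply/rowP => i; rewrite !mxE conjcK.
have E1 s1 s2 s3 x y a : s1 * s2 = conjc s3 ->
    s1 ^+ 2 * x * (s2 ^+ 2 * y) - onorm (conjc s3 *: a)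
    = conjc (s3 ^+ 2 * conjc (x * y - onorm a)).
  by move=> e; rewrite (P _ _ _ _ _ e) N -mulrBr D.
have E2 s1 s2 s3 a b x d : s1 * s2 = conjc s3 -> s3 * conjc s3 = 1 ->
    ocj (omul (conjc s1 *: a) (conjc s2 *: b)) - (s3 ^+ 2 * x) *: (conjc s3 *: d)
    = bar (conjc s3 *: bar (ocj (omul a b) - x *: d)).
  by move=> e e3; exact: etrans (M _ _ _ _ _ _ _ e e3) (esym (O _ _)).
congr (h3 _ _ _ _ _ _).
- exact: E1 t23.
- exact: E1 t31.
- exact: E1 t12.
- exact: E2 t23 u1.
- exact: E2 t31 u2.
- exact: E2 t12 u3.
Qed.

(* The action of a real unit octonion by left, right and two-sided
   multiplication on the three components, that is, triality for Spin(8). *)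
Definition spin (r : oct C) u : H3 R :=
  h3 (diag u ord0) (diag u (inord 1)) (diag u (inord 2))
     (omul (off u ord0) r)
     (omul (omul (ocj r) (off u (inord 1))) (ocj r))
     (omul r (off u (inord 2))).

Lemma spin_h3 (r : oct C) x1 x2 x3 a1 a2 a3 :
  spin r (h3 x1 x2 x3 a1 a2 a3) =
  h3 x1 x2 x3 (omul a1 r) (omul (omul (ocj r) a2) (ocj r))
    (omul r a3).
Proof. by rewrite /spin !diag_h3 !off_h3 /= !inordK. Qed.

Lemma aut_spin (r : oct C) : onorm r = 1 -> bar r = r -> aut (spin r).
Proof.
move=> r1 rr.
have rc1 : onorm (ocj r) = 1 by rewrite onorm_conj.
have rcr : bar (ocj r) = ocj r by rewrite map_ocj rr.
have barM := @map_omul C C conjc.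
have barK a : bar (bar a) = a by apply/rowP => i; rewrite !mxE conjcK.
split=> [c u v|u v|u].
- case: (h3P u) => x1 x2 x3 a1 a2 a3; case: (h3P v) => y1 y2 y3 b1 b2 b3.
  rewrite h3_lin !spin_h3 h3_lin.
  by congr (h3 _ _ _ _ _ _); rewrite !(omul_linearl, omul_linearr).
- case: (h3P u) => x1 x2 x3 a1 a2 a3; case: (h3P v) => y1 y2 y3 b1 b2 b3.
  rewrite !spin_h3 !hm_h3 !barM rr rcr.
  by rewrite !(oform_mull, oform_mulr) r1 rc1 !mul1r.
case: (h3P u) => x1 x2 x3 a1 a2 a3.
rewrite spin_h3 !adj_h3 cj_h3 spin_h3 cj_h3 !barM rr rcr !barK !conjcK.
rewrite !onorm_mul r1 rc1 !(mul1r, mulr1).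
rewrite (oct_moufang_left r a3 a2) (oct_moufang_middle r a3 a1) (oct_moufang_right r a1 a2).
rewrite r1 !scale1r !ocjM !ocjK.
congr (h3 _ _ _ _ _ _).
- by rewrite omulBl omulZl.
- by rewrite omulBr omulBl omulZr omulZl oct_flexible.
- by rewrite omulBr omulZr.
Qed.

Definition rot c x u : H3 R :=
  h3 (rot_x1 c x (diag u ord0) (diag u (inord 1)) (off u (inord 2)))
     (rot_x2 c x (diag u ord0) (diag u (inord 1)) (off u (inord 2)))
     (diag u (inord 2))
     (rot_a1 c x (off u ord0) (off u (inord 1)))
     (rot_a2 c x (off u ord0) (off u (inord 1)))
     (rot_a3 c x (diag u ord0) (diag u (inord 1)) (off u (inord 2))).

Lemma rot_h3 c x x1 x2 x3 a1 a2 a3 :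
  rot c x (h3 x1 x2 x3 a1 a2 a3) =
  h3 (rot_x1 c x x1 x2 a3) (rot_x2 c x x1 x2 a3) x3
     (rot_a1 c x a1 a2) (rot_a2 c x a1 a2) (rot_a3 c x x1 x2 a3).
Proof. by rewrite /rot !diag_h3 !off_h3 /= !inordK. Qed.

Lemma rot_lin (c s t x1 x2 y1 y2 : C) (a1 a2 a3 b1 b2 b3 : oct C) :
  [/\ rot_x1 c s (t * x1 + y1) (t * x2 + y2) (t *: a3 + b3) =
        t * rot_x1 c s x1 x2 a3 + rot_x1 c s y1 y2 b3,
      rot_x2 c s (t * x1 + y1) (t * x2 + y2) (t *: a3 + b3) =
        t * rot_x2 c s x1 x2 a3 + rot_x2 c s y1 y2 b3,
      rot_a1 c s (t *: a1 + b1) (t *: a2 + b2) =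
        t *: rot_a1 c s a1 a2 + rot_a1 c s b1 b2,
      rot_a2 c s (t *: a1 + b1) (t *: a2 + b2) =
        t *: rot_a2 c s a1 a2 + rot_a2 c s b1 b2 &
      rot_a3 c s (t * x1 + y1) (t * x2 + y2) (t *: a3 + b3) =
        t *: rot_a3 c s x1 x2 a3 + rot_a3 c s y1 y2 b3].
Proof. exact: rot_linear. Qed.

Lemma rot_bar (c s x1 x2 : C) (a1 a2 a3 : oct C) : conjc c = c -> conjc s = s ->
  [/\ rot_x1 c s (conjc x1) (conjc x2) (bar a3) = conjc (rot_x1 c s x1 x2 a3),
      rot_x2 c s (conjc x1) (conjc x2) (bar a3) = conjc (rot_x2 c s x1 x2 a3),
      rot_a1 c s (bar a1) (bar a2) = bar (rot_a1 c s a1 a2),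
      rot_a2 c s (bar a1) (bar a2) = bar (rot_a2 c s a1 a2) &
      rot_a3 c s (conjc x1) (conjc x2) (bar a3) = bar (rot_a3 c s x1 x2 a3)].
Proof. by move=> cr xr; have := @map_rot C C conjc c s x1 x2 a1 a2 a3; rewrite /= cr xr. Qed.

Lemma cj_rot c x u : conjc c = c -> conjc x = x -> cj (rot c x u) = rot c x (cj u).
Proof.
move=> cr xr; case: (h3P u) => x1 x2 x3 a1 a2 a3.
rewrite rot_h3 !cj_h3 rot_h3.
by have [-> -> -> -> ->] := rot_bar x1 x2 a1 a2 a3 cr xr.
Qed.

Lemma aut_rot c x : conjc c = c -> conjc x = x -> c * c + x * x = 1 -> aut (rot c x).
Proof.
move=> cr xr cx1.
have form_rot u v : bform (rot c x u) (rot c x v) = bform u v.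
  case: (h3P u) => x1 x2 x3 a1 a2 a3; case: (h3P v) => y1 y2 y3 b1 b2 b3.
  rewrite !rot_h3 !bform_h3.
  have := rot_form3 c x x1 x2 y1 y2 a3 b3; have := rot_form12 c x a1 a2 b1 b2.
  rewrite cx1 expr1n !mul1r.
  have G (p q z f1 f2 f3 w1 w2 : C) : p + q + f3 = w1 -> f1 + f2 = w2 ->
    p + q + z + (f1 + f2 + f3) = w1 + w2 + z by move=> <- <-; ring.
  by move=> e12 e3; rewrite (G _ _ _ _ _ _ _ _ e3 e12); apply/esym; exact: G.
split=> [t u v|u v|u].
- case: (h3P u) => x1 x2 x3 a1 a2 a3; case: (h3P v) => y1 y2 y3 b1 b2 b3.
  rewrite h3_lin !rot_h3 h3_lin.
  by have [-> -> -> -> ->] := rot_lin c x t x1 x2 y1 y2 a1 a2 a3 b1 b2 b3.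
- by rewrite !hmE cj_rot // form_rot.
(* A rotation with real parameters commutes with [cj], so the two conjugations in [aut] cancel and
   it remains to see that the rotation commutes with [adj]. *)
rewrite cj_rot // cjK; case: (h3P u) => x1 x2 x3 a1 a2 a3.
rewrite rot_h3 !adj_h3 rot_h3.
congr (h3 _ _ _ _ _ _).
- exact: rot_adj1.
- exact: rot_adj2.
- by rewrite (rot_det c x x1 x2 a3) cx1 !mul1r.
- by rewrite (rot_a2a3 c x x1 x2 a1 a2 a3) cx1 scale1r.
- by rewrite (rot_a3a1 c x x1 x2 a1 a2 a3) cx1 scale1r.
- exact: rot_adj3.
Qed.
End Automorphisms.

(** * Compactness and the diagonal form *)

Section RealCoordinates.
Variable R : realType.
Local Notation C := R[i].
Local Notation n := (\dim {:H3 R}).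
Local Notation RV := ('rV[R]_n * 'rV[R]_n)%type.

Definition hbasis (i : 'I_n) : H3 R := (vbasis {:H3 R})`_i.
Definition hcoord (i : 'I_n) (u : H3 R) : C := coord (vbasis {:H3 R}) i u.

Lemma hcoord_sum u : u = \sum_i hcoord i u *: hbasis i.
Proof. by rewrite -coord_vbasis ?memvf. Qed.

Lemma hcoord_lin i c u v : hcoord i (c *: u + v) = c * hcoord i u + hcoord i v.
Proof. by rewrite /hcoord linearP. Qed.

Lemma hcoord_comb m (f : 'I_m -> C) (v : 'I_m -> H3 R) i :
  hcoord i (\sum_j f j *: v j) = \sum_j f j * hcoord i (v j).
Proof. by rewrite /hcoord linear_sum; apply: eq_bigr => j _; rewrite linearZ. Qed.

Lemma hcoord_basis i j : hcoord i (hbasis j) = (i == j)%:R.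
Proof. by rewrite /hcoord /hbasis (coord_free _ _ (basis_free (vbasisP _))) eq_sym. Qed.

Definition unrealify (p : RV) : H3 R := \sum_i (p.1 0 i +i* p.2 0 i)%C *: hbasis i.

Lemma hcoord_unrealify i p : hcoord i (unrealify p) = (p.1 0 i +i* p.2 0 i)%C.
Proof.
rewrite hcoord_comb (bigD1 i) //= hcoord_basis eqxx mulr1 big1 ?addr0 // => j ji.
by rewrite hcoord_basis eq_sym (negbTE ji) mulr0.
Qed.

Lemma realifyK : cancel (@realify R (H3 R)) unrealify.
Proof.
move=> u; rewrite [RHS]hcoord_sum; apply: eq_bigr => i _; rewrite /realify /= !mxE.
by congr (_ *: _); rewrite -/(hcoord i u); case: (hcoord i u).
Qed.

Lemma unrealifyK : cancel unrealify (@realify R (H3 R)).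
Proof.
move=> p; have E i := hcoord_unrealify i p.
by case: p E => p1 p2 E; congr pair; apply/rowP => i; rewrite mxE -/(hcoord i _) E.
Qed.

End RealCoordinates.

Lemma scalar_comb (R : realType) (V : lmodType R[i]) (k : H3 R -> V) :
  (forall c u v, k (c *: u + v) = c *: k u + k v) ->
  forall m (a : 'I_m -> R[i]) (v : 'I_m -> H3 R),
  k (\sum_j a j *: v j) = \sum_j a j *: k (v j).
Proof.
move=> kP; have k0 : k 0 = 0.
  by have := kP (-1) 0 0; rewrite scaler0 addr0 scaleN1r addNr.
elim=> [|m IH] a v; first by rewrite !big_ord0.
by rewrite !big_ord_recl kP IH.
Qed.

(* Continuous, bounded and smooth functions are all instances of [fun_alg]. *)
Record fun_alg (R : realType) (X : Type) (P : (X -> R) -> Prop) : Prop := FunAlg {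
  fun_alg_cst : forall r, P (fun _ => r);
  fun_alg_add : forall f g, P f -> P g -> P (fun x => f x + g x);
  fun_alg_mul : forall f g, P f -> P g -> P (fun x => f x * g x)}.

Section FunctionAlgebra.
Variables (R : realType) (X : Type) (P : (X -> R) -> Prop) (PA : fun_alg P).
Local Notation C := R[i].
Implicit Types (f g : X -> C) (F G : X -> H3 R).

Definition cfun f : Prop :=
  P (fun x => complex.Re (f x)) /\ P (fun x => complex.Im (f x)).

Definition hfun F : Prop := forall i, cfun (fun x => hcoord i (F x)).

Lemma cfun_ext f g : f =1 g -> cfun f -> cfun g.
Proof. by move=> /funext ->. Qed.

Lemma hfun_ext F G : F =1 G -> hfun F -> hfun G.
Proof. by move=> /funext ->. Qed.

Lemma fun_alg_ext (f g : X -> R) : f =1 g -> P f -> P g.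
Proof. by move=> /funext ->. Qed.

Lemma fun_alg_opp (f : X -> R) : P f -> P (fun x => - f x).
Proof.
move=> fP; apply: fun_alg_ext (fun_alg_mul PA (fun_alg_cst PA (-1)) fP) => x.
by rewrite mulN1r.
Qed.

Lemma cfun_cst c : cfun (fun _ => c).
Proof. by split; exact: fun_alg_cst. Qed.

Lemma cfun_add f g : cfun f -> cfun g -> cfun (fun x => f x + g x).
Proof.
move=> [f1 f2] [g1 g2]; split.
  by apply: fun_alg_ext (fun_alg_add PA f1 g1) => x; case: (f x) (g x) => ? ? [].
by apply: fun_alg_ext (fun_alg_add PA f2 g2) => x; case: (f x) (g x) => ? ? [].
Qed.

Lemma cfun_mul f g : cfun f -> cfun g -> cfun (fun x => f x * g x).
Proof.
move=> [f1 f2] [g1 g2]; split.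
  apply: fun_alg_ext (fun_alg_add PA (fun_alg_mul PA f1 g1)
    (fun_alg_opp (fun_alg_mul PA f2 g2))) => x.
  by case: (f x) (g x) => ? ? [].
apply: fun_alg_ext (fun_alg_add PA (fun_alg_mul PA f1 g2) (fun_alg_mul PA f2 g1)) => x.
by case: (f x) (g x) => ? ? [].
Qed.

Lemma cfun_conj f : cfun f -> cfun (fun x => conjc (f x)).
Proof.
move=> [f1 f2]; split; first by apply: fun_alg_ext f1 => x; case: (f x).
by apply: fun_alg_ext (fun_alg_opp f2) => x; case: (f x).
Qed.

Lemma cfun_real (f : X -> R) : P f -> cfun (fun x => (f x)%:C%C).
Proof. by move=> fP; split => //=; exact: fun_alg_cst. Qed.

Lemma cfun_sum m (f : 'I_m -> X -> C) :
  (forall i, cfun (f i)) -> cfun (fun x => \sum_i f i x).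
Proof.
elim: m f => [|m IH] f fP.
  by apply: cfun_ext (cfun_cst 0) => x; rewrite big_ord0.
apply: cfun_ext (cfun_add (fP ord0) (IH _ (fun i => fP (lift ord0 i)))) => x.
by rewrite big_ord_recl.
Qed.

Lemma hfun_cst u : hfun (fun _ => u).
Proof. by move=> i; exact: cfun_cst. Qed.

Lemma hfun_scale f F : cfun f -> hfun F -> hfun (fun x => f x *: F x).
Proof.
move=> fP FP i; apply: cfun_ext (cfun_mul fP (FP i)) => x.
by rewrite /hcoord linearZ.
Qed.

Lemma hfun_add F G : hfun F -> hfun G -> hfun (fun x => F x + G x).
Proof.
move=> FP GP i; apply: cfun_ext (cfun_add (FP i) (GP i)) => x.
by rewrite /hcoord linearD.
Qed.

Lemma hfun_opp F : hfun F -> hfun (fun x => - F x).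
Proof.
move=> FP; apply: hfun_ext (hfun_scale (cfun_cst (-1)) FP) => x.
by rewrite scaleN1r.
Qed.

Lemma cfun_functional (l : H3 R -> C) F :
  (forall c u v, l (c *: u + v) = c * l u + l v) -> hfun F -> cfun (fun x => l (F x)).
Proof.
move=> lP FP.
apply: cfun_ext (cfun_sum (fun i => cfun_mul (FP i) (cfun_cst (l (hbasis i))))) => x.
by rewrite [in RHS](hcoord_sum (F x)) (@scalar_comb R C^o l lP).
Qed.

Lemma hfun_linear (k : H3 R -> H3 R) F :
  (forall c u v, k (c *: u + v) = c *: k u + k v) -> hfun F -> hfun (fun x => k (F x)).
Proof.
move=> kP FP i; apply: (cfun_functional (l := fun u => hcoord i (k u))) => // c u v.
by rewrite kP hcoord_lin.
Qed.

Lemma hfun_cj F : hfun F -> hfun (fun x => cj (F x)).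
Proof.
move=> FP i; apply: cfun_ext (cfun_conj (cfun_functional
  (l := fun u => conjc (hcoord i (cj u))) _ FP)) => [x|c u v].
  by rewrite conjcK.
by rewrite cj_lin hcoord_lin conjcD conjcM conjcK.
Qed.

Lemma hfun_bilinear (B : H3 R -> H3 R -> H3 R) F G :
  (forall c u v w, B (c *: u + v) w = c *: B u w + B v w) ->
  (forall c u v w, B w (c *: u + v) = c *: B w u + B w v) ->
  hfun F -> hfun G -> hfun (fun x => B (F x) (G x)).
Proof.
move=> Bl Br FP GP i.
apply: cfun_ext (cfun_sum (fun j => cfun_mul (FP j)
  (cfun_functional (l := fun u => hcoord i (B (hbasis j) u)) _ GP))) => [x|j c u v].
  rewrite [in RHS](hcoord_sum (F x)) (scalar_comb (fun c u v => Bl c u v (G x))).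
  by rewrite hcoord_comb.
by rewrite /= Br hcoord_lin.
Qed.

Lemma hfun_cross F G : hfun F -> hfun G -> hfun (fun x => cross (F x) (G x)).
Proof.
apply: hfun_bilinear => c u v w; first by rewrite crossDl crossZl.
exact: cross_linearr.
Qed.

(** The quadratic map [adj] is half of [cross u u], so the bilinear case suffices. *)
Lemma hfun_adj F : hfun F -> hfun (fun x => adj (F x)).
Proof.
move=> FP; apply: hfun_ext (hfun_scale (cfun_cst 2%:R^-1) (hfun_cross FP FP)) => x.
by rewrite crossxx scalerA mulVf ?scale1r // pnatr_eq0.
Qed.

Lemma cfun_hm F G : hfun F -> hfun G -> cfun (fun x => hm (F x) (G x)).
Proof.
move=> FP GP.
apply: cfun_ext (cfun_sum (fun j => cfun_mul (FP j) (cfun_conj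
  (cfun_functional (l := fun u => hm u (hbasis j)) _ GP)))) => [x|j c u v]; last first.
  exact: hm_linearl.
rewrite [in RHS](hcoord_sum (F x)).
rewrite (@scalar_comb R C^o (fun u => hm u (G x)) (fun c u v => hm_linearl c u v (G x))).
by apply: eq_bigr => j _; rewrite -hm_conj.
Qed.

Lemma cfun_bform F G : hfun F -> hfun G -> cfun (fun x => bform (F x) (G x)).
Proof.
move=> FP GP; apply: cfun_ext (cfun_hm FP (hfun_cj GP)) => x.
by rewrite bformE.
Qed.

Lemma hfun_tp F G H : hfun F -> hfun G -> hfun H ->
  hfun (fun x => tp (F x) (G x) (H x)).
Proof.
move=> FP GP HP.
apply: hfun_ext (hfun_add (hfun_add (hfun_scale (cfun_hm FP GP) HP)
  (hfun_scale (cfun_hm HP GP) FP))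
  (hfun_opp (hfun_cross (hfun_cross FP HP) (hfun_cj GP)))) => x.
by rewrite tpE.
Qed.

Lemma cfun_hdet F : hfun F -> cfun (fun x => hdet (F x)).
Proof.
move=> FP; apply: cfun_ext (cfun_mul (cfun_cst 3%:R^-1) (cfun_bform (hfun_adj FP) FP)) => x.
by rewrite hdetE.
Qed.

Lemma cfun_diag F i : hfun F -> cfun (fun x => diag (F x) i).
Proof. by apply: (cfun_functional (l := fun u => diag u i)) => c u v; rewrite diagP. Qed.

Lemma cfun_off F i j : hfun F -> cfun (fun x => off (F x) i 0 j).
Proof. by apply: (cfun_functional (l := fun u => off u i 0 j)) => c u v; rewrite offP !mxE. Qed.

(** [hcoord] refers to the abstract basis [vbasis], not to the matrix entries. Expanding in
    elementary matrices, which are constant, passes from the entries to these coordinates. *)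
Lemma hfun_mk_H3 (f : 'I_3 -> X -> C) (g : 'I_3 -> X -> oct C) :
  (forall i, cfun (f i)) -> (forall i j, cfun (fun x => g i x 0 j)) ->
  hfun (fun x => mk_H3 (f ^~ x) (g ^~ x)).
Proof.
move=> fP gP.
have S m (F : 'I_m -> X -> H3 R) : (forall i, hfun (F i)) -> hfun (fun x => \sum_i F i x).
  elim: m F => [|m IH] F FP; first by apply: hfun_ext (hfun_cst 0) => x; rewrite big_ord0.
  apply: hfun_ext (hfun_add (FP ord0) (IH _ (fun i => FP (lift ord0 i)))) => x.
  by rewrite big_ord_recl.
have A := S _ _ (fun i => hfun_scale (fP i) (hfun_cst ((delta_mx 0 i, 0) : H3 R))).
have B := S _ _ (fun i => S _ _ (fun j => hfun_scale (gP i j)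
  (hfun_cst ((0, delta_mx i j) : H3 R)))).
apply: hfun_ext (hfun_add A B) => x.
have fstS (m : nat) (G : 'I_m -> H3 R) : (\sum_i G i).1 = \sum_i (G i).1.
  exact: (big_morph (fun u : H3 R => u.1)).
have sndS (m : nat) (G : 'I_m -> H3 R) : (\sum_i G i).2 = \sum_i (G i).2.
  exact: (big_morph (fun u : H3 R => u.2)).
rewrite [LHS]surjective_pairing /mk_H3; congr pair.
  rewrite /= !fstS [X in _ + X]big1 ?addr0 => [|i _]; last first.
    by rewrite fstS big1 // => j _ /=; rewrite scaler0.
  rewrite [RHS]row_sum_delta; apply: eq_bigr => i _.
  by rewrite /= mxE.
rewrite /= !sndS [X in X + _]big1 ?add0r => [|i _]; last by rewrite /= scaler0.
rewrite [RHS]matrix_sum_delta; apply: eq_bigr => i _; rewrite sndS.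
by apply: eq_bigr => j _ /=; rewrite !mxE.
Qed.

Lemma hfun_h3 (f1 f2 f3 : X -> C) (g1 g2 g3 : X -> oct C) :
  cfun f1 -> cfun f2 -> cfun f3 -> (forall j, cfun (fun x => g1 x 0 j)) ->
  (forall j, cfun (fun x => g2 x 0 j)) -> (forall j, cfun (fun x => g3 x 0 j)) ->
  hfun (fun x => h3 (f1 x) (f2 x) (f3 x) (g1 x) (g2 x) (g3 x)).
Proof.
move=> f1P f2P f3P g1P g2P g3P.
have H := @hfun_mk_H3 (fun i x => [:: f1 x; f2 x; f3 x]`_i)
  (fun i x => nth 0 [:: g1 x; g2 x; g3 x] i).
rewrite h3.unlock; apply: H; last first.
  by move=> i j; case: i => [[|[|[|//]]] ?].
by move=> i; case: i => [[|[|[|//]]] ?].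
Qed.
End FunctionAlgebra.

(** * Compactness of the automorphism group *)

Section Compactness.
Variable R : realType.
Local Notation C := R[i].
Local Notation n := (\dim {:H3 R}).
Local Notation RV := ('rV[R]_n * 'rV[R]_n)%type.
Local Notation X := (prod_topology (fun _ : H3 R => RV)).

Lemma continuous_fun_alg (T : topologicalType) :
  fun_alg (fun f : T -> R => continuous f).
Proof.
split=> [r|f g fc gc|f g fc gc] x; first exact: cst_continuous.
  by apply: cvgD; [exact: fc | exact: gc].
by apply: cvgM; [exact: fc | exact: gc].
Qed.

Lemma hm_sum (u v : H3 R) : hm u v = \sum_i diag u i * conjc (diag v i)
  + \sum_i \sum_k 2%:R * (off u i 0 k * conjc (off v i 0 k)).
Proof.
rewrite hm.unlock /hm.body /herm /form; congr (_ + _); apply: eq_bigr => i _.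
  by rewrite /diag mxE.
rewrite oct_formE; apply: eq_bigr => k _.
by rewrite -mulrA /off !mxE.
Qed.

Lemma diag_le_hm (u : H3 R) i : diag u i * conjc (diag u i) <= hm u u.
Proof.
rewrite hm_sum (bigD1 i) //= -addrA lerDl addr_ge0 ?sumr_ge0 // => [j _|j _].
  exact: mulcJ_ge0.
by apply: sumr_ge0 => k _; rewrite mulr_ge0 ?mulcJ_ge0.
Qed.

Lemma off_le_hm (u : H3 R) i k : off u i 0 k * conjc (off u i 0 k) <= hm u u.
Proof.
rewrite hm_sum (bigD1 i (P := xpredT) (F := fun i => \sum_k _)) //= (bigD1 k) //=.
have ge0 j l : 0 <= off u j 0 l * conjc (off u j 0 l) by exact: mulcJ_ge0.
have d0 : 0 <= \sum_i diag u i * conjc (diag u i).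
  by apply: sumr_ge0 => j _; exact: mulcJ_ge0.
have o1 : 0 <= \sum_(l | l != k) 2%:R * (off u i 0 l * conjc (off u i 0 l)).
  by apply: sumr_ge0 => l _; rewrite mulr_ge0.
have o2 : 0 <= \sum_(j | j != i) \sum_l 2%:R * (off u j 0 l * conjc (off u j 0 l)).
  by apply: sumr_ge0 => j _; apply: sumr_ge0 => l _; rewrite mulr_ge0.
apply: le_trans (_ : 2%:R * (off u i 0 k * conjc (off u i 0 k)) <= _).
  by rewrite mulr_natl mulr2n lerDl.
by rewrite addrCA -[leLHS]addr0 -addrA lerD2l addr_ge0 // addr_ge0.
Qed.

Definition bounded_on_sphere (r : C) (f : H3 R -> R) : Prop :=
  exists M, forall u, hm u u = r -> `|f u| <= M.

Lemma bounded_fun_alg r : fun_alg (bounded_on_sphere r).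
Proof.
split=> [c|f g [M fM] [N gN]|f g [M fM] [N gN]]; first by exists `|c|.
  by exists (M + N) => u ur; apply: le_trans (ler_normD _ _) (lerD (fM u ur) (gN u ur)).
by exists (M * N) => u ur; rewrite normrM; apply: ler_pM => //; [exact: fM|exact: gN].
Qed.

(** The bound w + 1 avoids a square root: x^2 <= w gives |x| <= 1 + x^2 <= w + 1. *)
Lemma re_im_bound (z w : C) : z * conjc z <= w ->
  `|complex.Re z| <= complex.Re w + 1 /\ `|complex.Im z| <= complex.Re w + 1.
Proof.
case: z w => x y [w v]; rewrite lecE => /andP[_ /= le_w].
have {}le_w : x ^+ 2 + y ^+ 2 <= w by move: le_w; rewrite mulrN opprK -!expr2.
by split; rewrite ler_norml; apply/andP; split; nra.
Qed.

(** The Hermitian form bounds the matrix entries by [diag_le_hm] and [off_le_hm]. Functions bounded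
    on a sphere form a [fun_alg], so [hfun_mk_H3] carries the bounds over to the coordinates in the
    abstract basis. *)
Lemma hcoord_bounded (r : C) (i : 'I_n) :
  exists M : R, forall u : H3 R, hm u u = r ->
    `|complex.Re (hcoord i u)| <= M /\ `|complex.Im (hcoord i u)| <= M.
Proof.
have hb : hfun (bounded_on_sphere r) (fun u => u).
  apply: hfun_ext (hfun_mk_H3 (bounded_fun_alg r) _ _) => [u|j|j k].
  - exact: mk_H3K.
  - by split; exists (complex.Re r + 1) => u <-; have [] := re_im_bound (diag_le_hm u j).
  - by split; exists (complex.Re r + 1) => u <-; have [] := re_im_bound (off_le_hm u j k).
have [[M fM] [N gN]] := hb i; exists (Num.max M N) => u ur.
by rewrite !le_max fM // gN // orbT.
Qed.

Lemma hfun_eval (u : H3 R) :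
  hfun (fun f : X -> R => continuous f) (fun f : X => unrealify (f u)).
Proof.
have pc : continuous (fun f : X => f u) by exact: (@proj_continuous _ (fun _ => RV) u).
move=> i; split.
  apply: (@fun_alg_ext _ _ (fun f : X -> R => continuous f)
    (fun f : X => (f u).1 0 i)) => [f|f]; first by rewrite hcoord_unrealify.
  apply: (@continuous_comp _ _ _ (fun f : X => (f u).1) (fun v : 'rV[R]_n => v 0 i)).
    by apply: (@continuous_comp _ _ _ (fun f : X => f u) fst); [exact: pc|exact: cvg_fst].
  exact: coord_continuous.
apply: (@fun_alg_ext _ _ (fun f : X -> R => continuous f)
  (fun f : X => (f u).2 0 i)) => [f|f]; first by rewrite hcoord_unrealify.
apply: (@continuous_comp _ _ _ (fun f : X => (f u).2) (fun v : 'rV[R]_n => v 0 i)).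
  by apply: (@continuous_comp _ _ _ (fun f : X => f u) snd); [exact: pc|exact: cvg_snd].
exact: coord_continuous.
Qed.

(* Linear maps as functions, so that compactness is Tychonoff's theorem. *)
Definition autX : set X := [set f | aut (fun u => unrealify (f u))].

(** At fixed arguments each condition of [aut] is the vanishing of a continuous function of f, since
    it involves f through finitely many evaluations. Such conditions pass to the closure in the
    product topology. *)
Lemma closed_autX : closed autX.
Proof.
move=> f fcl; have contA := continuous_fun_alg X.
have zero (g : X -> R) : continuous g -> (forall k, autX k -> g k = 0) -> g f = 0.
  move=> gc g0; move: fcl; rewrite closureE => /(_ [set k | g k = 0]); apply; split=> //.
  apply: (@preimage_closed _ _ g [set x | x = 0]) => [x _|]; first exact: gc.
  exact: closed_eq.
have zeroC (g : X -> C) : cfun (fun f : X -> R => continuous f) g ->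
    (forall k, autX k -> g k = 0) -> g f = 0.
  move=> [gr gi] g0.
  have r0 := zero _ gr (fun k kA => congr1 _ (g0 k kA)).
  have i0 := zero _ gi (fun k kA => congr1 _ (g0 k kA)).
  by case: (g f) r0 i0 => a b /= -> ->.
have zeroH (g : X -> H3 R) : hfun (fun f : X -> R => continuous f) g ->
    (forall k, autX k -> g k = 0) -> g f = 0.
  move=> gc g0; rewrite [LHS]hcoord_sum big1 // => i _.
  rewrite (zeroC (fun f => hcoord i (g f)) (gc i)) ?scale0r // => k /g0 ->.
  by rewrite /hcoord linear0.
split=> [c u v|u v|u]; apply/eqP; rewrite -subr_eq0; apply/eqP.
- apply: (zeroH (fun f => unrealify (f (c *: u + v))
    - (c *: unrealify (f u) + unrealify (f v)))) => [|k [kL _ _]]; last by rewrite kL subrr.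
  apply: (hfun_add contA (hfun_eval _) (hfun_opp contA (hfun_add contA _ (hfun_eval _)))).
  exact: hfun_scale (cfun_cst contA _) (hfun_eval _).
- apply: (zeroC (fun f => hm (unrealify (f u)) (unrealify (f v)) - hm u v))
    => [|k [_ kH _]]; last by rewrite kH subrr.
  exact: cfun_add (cfun_hm contA (hfun_eval _) (hfun_eval _)) (cfun_cst contA _).
- apply: (zeroH (fun f => adj (unrealify (f u)) - cj (unrealify (f (cj (adj u))))))
    => [|k [_ _ kS]]; last by rewrite kS subrr.
  exact: hfun_add (hfun_adj contA (hfun_eval _))
    (hfun_opp contA (hfun_cj contA (hfun_eval _))).
Qed.

(** An isometry keeps f u on the sphere of u, whose coordinates are bounded. Hence [autX] is a
    closed subset of a product of compact boxes. *)
Lemma compact_autX : compact autX.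
Proof.
pose M u i := sval (cid (hcoord_bounded (hm u u) i)).
have HM u i := svalP (cid (hcoord_bounded (hm u u) i)).
pose B (u : H3 R) : set 'rV[R]_n := [set v | forall i, `[- M u i, M u i]%classic (v ord0 i)].
pose A (u : H3 R) : set RV := B u `*` B u.
have cA u : compact (A u).
  by apply: compact_setX; apply: (@rV_compact R n
    (fun i => `[- M u i, M u i]%classic)) => i; exact: segment_compact.
have cT : compact ([set f | forall u, A u (f u)] : set X).
  exact: (@tychonoff (H3 R) (fun _ => RV) A cA).
apply: (subclosed_compact closed_autX cT) => f [_ kH _] u.
have b i := HM u i (unrealify (f u)) (kH u u).
by split=> i; have [] := b i; rewrite hcoord_unrealify /= in_itv /= -!ler_norml.
Qed.

Lemma aut_max (z : H3 R) (g : H3 R -> C) :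
  (forall c u v, g (c *: u + v) = c * g u + g v) ->
  exists k, aut k /\ forall k', aut k' -> complex.Re (g (k' z)) <= complex.Re (g (k z)).
Proof.
move=> gL; have contA := continuous_fun_alg X.
have rA k : aut k -> autX (fun u => realify (k u)).
  by move=> kA; rewrite /autX /=; under eq_fun do rewrite realifyK.
have ne : autX !=set0 by exists (fun u => realify u); exact: (rA id (aut_id R)).
have [gc _] := cfun_functional contA gL (hfun_eval z).
have [f fA fmax] := compact_EVT_max ne compact_autX (continuous_subspaceT gc).
exists (fun u => unrealify (f u)); split; first exact: set_mem fA.
by move=> k' /rA k'A; have := fmax _ (mem_set k'A); rewrite realifyK.
Qed.
End Compactness.

(** * Diagonalization by maximizing a weight *)

Section Diagonalization.
Variable R : realType.
Local Notation C := R[i].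
Local Notation bar := (map_mx conjc).
Implicit Types (c t x y z : C) (a b d : oct C) (e f u v w : H3 R) (k : H3 R -> H3 R).

Definition weight (p1 p2 p3 : C) u : C :=
  p1 * diag u ord0 + p2 * diag u (inord 1) + p3 * diag u (inord 2).

Lemma weight_h3 (p1 p2 p3 : C) x1 x2 x3 a1 a2 a3 :
  weight p1 p2 p3 (h3 x1 x2 x3 a1 a2 a3) = p1 * x1 + p2 * x2 + p3 * x3.
Proof. by rewrite /weight !diag_h3 /= !inordK. Qed.

Lemma weight_linear (p1 p2 p3 : C) c u v :
  weight p1 p2 p3 (c *: u + v) = c * weight p1 p2 p3 u + weight p1 p2 p3 v.
Proof. by rewrite /weight !diagP; ring. Qed.

Definition weight_max (p1 p2 p3 : C) u : Prop :=
  forall k, aut k -> complex.Re (weight p1 p2 p3 (k u)) <= complex.Re (weight p1 p2 p3 u).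

(** The orbits of u and of k u coincide, and the weight q pulled back by k is the weight p. Complex
    weights are allowed because phases turn real weights into complex ones. *)
Lemma weight_max_aut (p1 p2 p3 q1 q2 q3 : C) k u : aut k ->
  (forall v, weight q1 q2 q3 (k v) = weight p1 p2 p3 v) ->
  weight_max p1 p2 p3 u -> weight_max q1 q2 q3 (k u).
Proof.
move=> kA kw um k' k'A; have [l [lA kl lk]] := aut_inverse kA.
have := um _ (aut_comp lA (aut_comp k'A kA)) => /=.
by rewrite -!kw lk.
Qed.

(* First order condition at c = 1, s = 0, by the rational parametrization of the
   circle. *)
Lemma circle_derivative (A B : R) :
  (forall c s : R, c * c + s * s = 1 -> s * s * A + 2 * (c * s) * B <= 0) -> B = 0.
Proof.
move=> cs; have H (t : R) : t * t * A + t * (1 - t * t) * B <= 0.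
  have t0 : 1 + t * t != 0 by apply: lt0r_neq0; nra.
  have := cs ((1 - t * t) / (1 + t * t)) (2 * t / (1 + t * t)).
  have -> : (1 - t * t) / (1 + t * t) * ((1 - t * t) / (1 + t * t)) +
    2 * t / (1 + t * t) * (2 * t / (1 + t * t)) = 1 by field.
  move=> /(_ erefl); set r := _ + _ => r0.
  have {}r0 : r * ((1 + t * t) * (1 + t * t)) <= 0 by apply: mulr_le0_ge0 => //; nra.
  suff E : r * ((1 + t * t) * (1 + t * t)) = 4 * (t * t * A + t * (1 - t * t) * B).
    by rewrite E in r0; lra.
  by rewrite /r; field.
have A0 := normr_ge0 A; have B0 := normr_ge0 B.
have K (b : R) : 0 <= b -> (forall t : R, 0 < t -> t * (1 - t * t) * b <= t * t * `|A|) -> b = 0.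
  move=> b0 Hb; apply/eqP; rewrite eq_le b0 andbT leNgt; apply/negP => b_gt0.
  (* If b > 0, take t = b / 2m. Then t <= 1/2 and t |A| <= b/2, whereas the hypothesis divided by t
     says (1 - t^2) b <= t |A|, with left side at least 3b/4. *)
  pose m := `|A| + b; have m0 : 0 < m by rewrite /m; lra.
  set t := b / (2 * m); have tm : t * (2 * m) = b.
    by rewrite /t divfK // mulf_neq0 // ?pnatr_eq0 // lt0r_neq0.
  have t0 : 0 < t by rewrite /t divr_gt0 // mulr_gt0.
  have tb : t <= 1 / 2.
    by rewrite /t ler_pdivrMr ?mulr_gt0 // /m; lra.
  clearbody t.
  have := Hb t t0; rewrite -!mulrA ler_pM2l // => Hc.
  have tb0 : 0 <= t * b by rewrite mulr_ge0 // ltW.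
  have tA : t * `|A| <= b / 2 by move: tm; rewrite /m; lra.
  have tt : t * t * b <= b / 4.
    by rewrite -(mulrC b) ler_wpM2l //; nra.
  by move: Hc; lra.
apply/eqP; rewrite -normr_eq0; apply/eqP/K => // t t0.
have H1 := H t; have H2 := H (- t).
have A1 := ler_norm A; have A2 := ler_norm (- A); rewrite normrN in A2.
have [B1|B1] := ger0P B; nra.
Qed.

Lemma Re_real (r : R) (z : C) : complex.Re (r%:C%C * z) = r * complex.Re z.
Proof. by case: z => x y /=; rewrite mul0r subr0. Qed.

(** A rotation of the first two indices changes the weight by s^2 (p1 - p2) (x2 - x1) + 2 c s (p1 -
    p2) [ore a3]. Its real part is never positive, and [circle_derivative] applies. *)
Lemma weight_max_re (p1 p2 p3 : C) x1 x2 x3 a1 a2 a3 :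
  weight_max p1 p2 p3 (h3 x1 x2 x3 a1 a2 a3) -> complex.Re ((p1 - p2) * ore a3) = 0.
Proof.
move=> um; apply: (circle_derivative (A := complex.Re ((p1 - p2) * (x2 - x1)))) => c s cs.
have csC : c%:C%C * c%:C%C + s%:C%C * s%:C%C = 1 by rewrite -!rmorphM -rmorphD cs.
have := um _ (aut_rot (conjc_real c) (conjc_real s) csC).
rewrite rot_h3 !weight_h3 /rot_x1 /rot_x2; move: (ore a3) => r.
rewrite -subr_le0 -raddfB /=.
suff -> : p1 * (c%:C%C * c%:C%C * x1 + 2 * (c%:C%C * s%:C%C) * r + s%:C%C * s%:C%C * x2)
    + p2 * (s%:C%C * s%:C%C * x1 - 2 * (c%:C%C * s%:C%C) * r + c%:C%C * c%:C%C * x2)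
    + p3 * x3 - (p1 * x1 + p2 * x2 + p3 * x3)
  = (s * s)%:C%C * ((p1 - p2) * (x2 - x1)) + (2 * (c * s))%:C%C * ((p1 - p2) * r).
  by rewrite raddfD /= !Re_real.
rewrite !rmorphM rmorph_nat.
have -> : c%:C%C * c%:C%C = 1 - s%:C%C * s%:C%C by rewrite -csC addrK.
by ring.
Qed.

(** [weight_max_re] only sees the real part of the complex number [ore a3]. A phase gives access to
    its imaginary part, and the action of [spin] brings every other octonion coordinate of a3 into
    the place of [ore]. *)
Lemma weight_max_off3 (p1 p2 p3 : R) x1 x2 x3 a1 a2 a3 : p1 != p2 -> p1 + p2 != 0 ->
  weight_max p1%:C%C p2%:C%C p3%:C%C (h3 x1 x2 x3 a1 a2 a3) -> a3 = 0.
Proof.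
move=> p12 p12' um.
have ore0 y1 y2 y3 b1 b2 b3 :
    weight_max p1%:C%C p2%:C%C p3%:C%C (h3 y1 y2 y3 b1 b2 b3) -> ore b3 = 0.
  move=> vm; have re0 := weight_max_re vm.
  (* A rational phase with w^2 = (-7 + 24 i) / 25. The torus element (w, conj w, 1) fixes the third
     off-diagonal entry but changes the weights to p1 conj w^2 and p2 w^2; for a purely imaginary
     entry i y the condition becomes (24/25) (p1 + p2) y = 0. *)
  pose w : C := Complex (3 / 5) (4 / 5).
  have ww : w * conjc w = 1.
    by rewrite /w; apply/eqP; rewrite eq_complex /=; apply/andP; split; apply/eqP; field.
  have ww' : conjc w * conjc (conjc w) = 1 by rewrite conjcK mulrC.
  have w1 : w * conjc w * 1 = 1 by rewrite ww mul1r.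
  have one1 : 1 * conjc 1 = 1 :> C by rewrite mul1r; exact: rmorph1.
  have := weight_max_aut (q1 := p1%:C%C * conjc w ^+ 2) (q2 := p2%:C%C * w ^+ 2)
    (q3 := p3%:C%C) (aut_torus w1 ww ww' one1) _ vm.
  rewrite torus_h3 => H; have {H} := weight_max_re (H _).
  have -> : conjc 1 = 1 :> C by exact: rmorph1.
  rewrite scale1r => im0.
  have {}im0 : complex.Re ((p1%:C%C * conjc w ^+ 2 - p2%:C%C * w ^+ 2) * ore b3) = 0.
    apply: im0 => v; case: (h3P v) => z1 z2 z3 d1 d2 d3.
    rewrite torus_h3 !weight_h3.
    have -> : p1%:C%C * conjc w ^+ 2 * (w ^+ 2 * z1) = p1%:C%C * (w * conjc w) ^+ 2 * z1.
      by ring.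
    have -> : p2%:C%C * w ^+ 2 * (conjc w ^+ 2 * z2) = p2%:C%C * (w * conjc w) ^+ 2 * z2.
      by ring.
    by rewrite ww !expr1n !mulr1 mul1r.
  move: re0 im0; case: (ore b3) => x y.
  rewrite /w !expr2 /= => re0 im0.
  have x0 : x = 0.
    have : (p1 - p2) * x = 0 by rewrite -re0; ring.
    by move/eqP; rewrite mulf_eq0 subr_eq0 (negbTE p12) => /eqP.
  rewrite x0 in im0 *.
  have : (p1 + p2) * y = 0.
    apply/(mulfI (x := 24 / 25)); first by apply: lt0r_neq0; lra.
    by rewrite mulr0 -[RHS]im0; field.
  by move/eqP; rewrite mulf_eq0 (negbTE p12') /= => /eqP y0; rewrite y0.
have spin0 (r : oct C) : onorm r = 1 -> bar r = r -> ore (omul r a3) = 0.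
  move=> r1 rr; have := weight_max_aut (q1 := p1%:C%C) (q2 := p2%:C%C) (q3 := p3%:C%C)
    (aut_spin r1 rr) _ um.
  rewrite spin_h3 => H; apply: ore0 (H _) => v.
  by case: (h3P v) => *; rewrite spin_h3 !weight_h3.
have c0 : conjc 0 = 0 :> C by exact: rmorph0.
have c1 : conjc 1 = 1 :> C by exact: rmorph1.
move: spin0; case: (oct8P a3) => y0 y1 y2 y3 y4 y5 y6 y7 H.
(* With a single coefficient equal to 1, r is one of the eight basis units and the real part of r a3
   is a coordinate of a3 up to sign. *)
have S (r0 r1 r2 r3 r4 r5 r6 r7 : bool) :
    r0%:R * r0%:R + r1%:R * r1%:R + r2%:R * r2%:R + r3%:R * r3%:R + r4%:R * r4%:R
    + r5%:R * r5%:R + r6%:R * r6%:R + r7%:R * r7%:R = 1 :> C ->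
    r0%:R * y0 - (r1%:R * y1 + r2%:R * y2 + r3%:R * y3 + r4%:R * y4 + r5%:R * y5
      + r6%:R * y6 + r7%:R * y7) = 0 :> C.
  move=> r1'; pose r : oct C := oct8 r0%:R r1%:R r2%:R r3%:R r4%:R r5%:R r6%:R r7%:R.
  have rr : bar r = r by rewrite (@map_oct8 C C conjc) /= !conjc_nat.
  have := H r _ rr; rewrite oct8_norm => /(_ r1').
  by rewrite oct8_mul oct8_re.
have H0 := S true false false false false false false false.
have H1 := S false true false false false false false false.
have H2 := S false false true false false false false false.
have H3 := S false false false true false false false false.
have H4 := S false false false false true false false false.
have H5 := S false false false false false true false false.
have H6 := S false false false false false false true false.
have H7 := S false false false false false false false true.
move: H0 H1 H2 H3 H4 H5 H6 H7; rewrite /= !(mulr1, mul0r, mul1r, mulr0, addr0, add0r, sub0r, subr0).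
move=> /(_ erefl) -> /(_ erefl) /eqP + /(_ erefl) /eqP + /(_ erefl) /eqP + /(_ erefl) /eqP +
  /(_ erefl) /eqP + /(_ erefl) /eqP + /(_ erefl) /eqP; rewrite !oppr_eq0.
do ![move/eqP => ->].
by rewrite -oct8_zero.
Qed.

Theorem diagonalize u : exists k, aut k /\
  exists x1 x2 x3, k u = h3 x1 x2 x3 0 0 0.
Proof.
(* Distinct positive weights satisfy both conditions of [weight_max_off3] for every pair of indices;
   [cyc] brings each pair to the first two places. *)
have [k [kA kmax]] := aut_max u (weight_linear 3%:R%:C%C 2%:R%:C%C 1%:R%:C%C).
exists k; split=> //.
have m1 : weight_max 3%:R%:C%C 2%:R%:C%C 1%:R%:C%C (k u).
  by move=> k' k'A; exact: kmax (aut_comp k'A kA).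
have rotate (p1 p2 p3 : C) v : weight_max p1 p2 p3 v -> weight_max p2 p3 p1 (cyc v).
  apply: weight_max_aut (aut_cyc R) _ => w; case: (h3P w) => *.
  by rewrite cyc_h3 !weight_h3 addrC addrA.
have m2 := rotate _ _ _ _ m1; have m3 := rotate _ _ _ _ m2.
move: m1 m2 m3; case: (h3P (k u)) => x1 x2 x3 a1 a2 a3; rewrite !cyc_h3 => m1 m2 m3.
have a30 : a3 = 0 by apply: weight_max_off3 m1; apply/eqP; lra.
have a10 : a1 = 0 by apply: weight_max_off3 m2; apply/eqP; lra.
have a20 : a2 = 0 by apply: weight_max_off3 m3; apply/eqP; lra.
by exists x1, x2, x3; rewrite a10 a20 a30.
Qed.
End Diagonalization.

(** * Tripotents and their Peirce spaces *)

Section Tripotents.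
Variable R : realType.
Local Notation C := R[i].
Local Notation bar := (map_mx conjc).
Implicit Types (c t x y z : C) (a b d : oct C) (e f g u v w : H3 R) (k : H3 R -> H3 R).

Definition dg x y z : H3 R := h3 x y z 0 0 0.

Lemma tripotentE e : tripotent e <-> tp e e e = 2%:R *: e.
Proof. by rewrite tp.unlock. Qed.

Lemma orthogonalE e f : orthogonal e f <-> forall u, tp e f u = 0.
Proof. by rewrite tp.unlock. Qed.

Lemma bar0 : bar 0 = 0 :> oct C.
Proof. by apply/rowP => i; rewrite !mxE; exact: rmorph0. Qed.

Lemma dg_scale c x y z : c *: dg x y z = dg (c * x) (c * y) (c * z).
Proof. by rewrite /dg h3_scale !scaler0. Qed.

Lemma dg_add x1 x2 x3 y1 y2 y3 :
  dg x1 x2 x3 + dg y1 y2 y3 = dg (x1 + y1) (x2 + y2) (x3 + y3).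
Proof. by rewrite /dg h3_add !addr0. Qed.

Lemma dg_inj x1 x2 x3 y1 y2 y3 : dg x1 x2 x3 = dg y1 y2 y3 ->
  [/\ x1 = y1, x2 = y2 & x3 = y3].
Proof. by case/h3_inj. Qed.

Lemma dg0 : dg 0 0 0 = 0.
Proof. by rewrite /dg -h3_zero. Qed.

Lemma adj_dg x1 x2 x3 : adj (dg x1 x2 x3) = dg (x2 * x3) (x3 * x1) (x1 * x2).
Proof.
rewrite /dg adj_h3 !omulr0 !ocj0 !onorm0 !subr0 !scaler0.
by rewrite subr0.
Qed.

Lemma hm_dg x1 x2 x3 y1 y2 y3 : hm (dg x1 x2 x3) (dg y1 y2 y3) =
  x1 * conjc y1 + x2 * conjc y2 + x3 * conjc y3.
Proof. by rewrite /dg hm_h3 !oform0l !addr0. Qed.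

Lemma hdet_dg x1 x2 x3 : hdet (dg x1 x2 x3) = x1 * x2 * x3.
Proof.
rewrite hdetE adj_dg /dg bform_h3 !oform0l !addr0.
by field.
Qed.

Lemma tp_dg2 x1 x2 x3 y1 y2 y3 z1 z2 z3 a1 a2 a3 :
  tp (dg x1 x2 x3) (dg y1 y2 y3) (h3 z1 z2 z3 a1 a2 a3) =
  h3 (2 * (x1 * conjc y1) * z1) (2 * (x2 * conjc y2) * z2) (2 * (x3 * conjc y3) * z3)
    ((x2 * conjc y2 + x3 * conjc y3) *: a1) ((x3 * conjc y3 + x1 * conjc y1) *: a2)
    ((x1 * conjc y1 + x2 * conjc y2) *: a3).
Proof.
rewrite /dg tpE !hm_h3 cj_h3 !cross_h3 bar0 !(omulr0, omul0r, addr0, add0r, ocj0, oform0r,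
  oform0l, scaler0, subr0, sub0r, oppr0).
rewrite !h3_scale !scaler0 !h3_add h3_opp h3_add !addr0.
congr (h3 _ _ _ _ _ _); try ring.
all: by rewrite ?scalerN ?opprK ?scalerA -?scalerBl -?scalerDl; congr (_ *: _); ring.
Qed.

Lemma tp_dg x1 x2 x3 y1 y2 y3 b1 b2 b3 :
  tp (dg x1 x2 x3) (h3 y1 y2 y3 b1 b2 b3) (dg x1 x2 x3) =
  2%:R *: h3 (x1 * x1 * conjc y1) (x2 * x2 * conjc y2) (x3 * x3 * conjc y3)
    ((x2 * x3) *: bar b1) ((x3 * x1) *: bar b2) ((x1 * x2) *: bar b3).
Proof.
rewrite tpE crossxx adj_dg crossZl /dg hm_h3 cj_h3 cross_h3 !(omulr0, omul0r, addr0, add0r,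
  ocj0, oform0r, oform0l, scaler0, subr0, sub0r, oppr0).
rewrite !h3_scale !scaler0 !h3_add h3_opp h3_add !addr0 !add0r.
congr (h3 _ _ _ _ _ _); try ring.
all: by rewrite ?scalerN ?opprK.
Qed.
End Tripotents.

(** * Classification of tripotents up to automorphism *)

Section Classification.
Variable R : realType.
Local Notation C := R[i].
Local Notation bar := (map_mx conjc).
Implicit Types (c t x y z : C) (a b d : oct C) (e f g u v w : H3 R) (k : H3 R -> H3 R).

Lemma aut_tripotent k e : aut k -> (tripotent (k e) <-> tripotent e).
Proof.
move=> kA; rewrite !tripotentE (aut_tp kA) -(autZ kA).
by split=> [/(aut_inj kA)|->].
Qed.

Lemma aut_orthogonal k e f : aut k -> (orthogonal (k e) (k f) <-> orthogonal e f).
Proof.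
move=> kA; have [l [_ kl lk]] := aut_inverse kA; rewrite !orthogonalE.
split=> ef u; first by apply: (aut_inj kA); rewrite -(aut_tp kA) ef (aut0 kA).
by rewrite -(lk u) (aut_tp kA) ef (aut0 kA).
Qed.

Lemma tripotent_dg x1 x2 x3 : tripotent (dg x1 x2 x3) <->
  [/\ x1 * x1 * conjc x1 = x1, x2 * x2 * conjc x2 = x2 & x3 * x3 * conjc x3 = x3].
Proof.
rewrite tripotentE {2}/dg tp_dg bar0 !scaler0 -!/(dg _ _ _).
have two : 2%:R != 0 :> C by rewrite pnatr_eq0.
split=> [e|[-> -> ->] //]; apply: dg_inj.
by rewrite -[LHS](scalerK two) e (scalerK two).
Qed.

Lemma orthogonal_dg x1 x2 x3 y1 y2 y3 : x1 * y1 = 0 -> x2 * y2 = 0 -> x3 * y3 = 0 ->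
  orthogonal (dg x1 x2 x3) (dg y1 y2 y3).
Proof.
have E x y : x * y = 0 -> x * conjc y = 0.
  by move/eqP; rewrite mulf_eq0 => /orP[] /eqP ->; rewrite ?mul0r // (rmorph0 conjc) mulr0.
move=> /E e1 /E e2 /E e3; apply/orthogonalE => u; case: (h3P u) => z1 z2 z3 a1 a2 a3.
by rewrite tp_dg2 e1 e2 e3 !mulr0 !mul0r addr0 !scale0r -h3_zero.
Qed.

(** [torus] multiplies the diagonal entries by squares, so prescribing phases there requires square
    roots that are again phases. *)
Lemma unit_sqrt x : x * conjc x = 1 -> exists2 w, w ^+ 2 = x & w * conjc w = 1.
Proof.
move=> xx; exists (sqrtc x); first exact: sqr_sqrtc.
have w0 : 0 <= sqrtc x * conjc (sqrtc x) by exact: mulcJ_ge0.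
have : (sqrtc x * conjc (sqrtc x)) ^+ 2 = 1 ^+ 2.
  by rewrite exprMn -(rmorphXn conjc) sqr_sqrtc xx expr1n.
by move/eqP; rewrite eqrXn2 ?ler01 // => /eqP.
Qed.

Lemma aut_phase y1 y2 y3 : y1 * conjc y1 = 1 -> y2 * conjc y2 = 1 -> y1 * y2 * y3 = 1 ->
  exists k, aut k /\ forall x1 x2 x3, k (dg x1 x2 x3) = dg (y1 * x1) (y2 * x2) (y3 * x3).
Proof.
move=> /unit_sqrt[t1 <- u1] /unit_sqrt[t2 <- u2] y123.
pose t3 := conjc (t1 * t2).
have u12 : t1 * t2 * conjc (t1 * t2) = 1.
  rewrite conjcM; transitivity ((t1 * conjc t1) * (t2 * conjc t2)); first by ring.
  by rewrite u1 u2 mulr1.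
have u3 : t3 * conjc t3 = 1 by rewrite /t3 conjcK mulrC.
have -> : y3 = t3 ^+ 2.
  have : (t1 * t2 * conjc (t1 * t2)) ^+ 2 = 1 by rewrite u12 expr1n.
  rewrite -y123 -/t3 => h; apply: (mulfI (x := t1 ^+ 2 * t2 ^+ 2)).
    by apply/eqP => h0; move: y123; rewrite h0 mul0r => /eqP; rewrite eq_sym oner_eq0.
  by rewrite -h; ring.
exists (torus t1 t2 t3); split=> [|x1 x2 x3]; first exact: aut_torus.
by rewrite /dg torus_h3 !scaler0.
Qed.

Lemma aut_cyc_dg x1 x2 x3 : cyc (dg x1 x2 x3) = dg x2 x3 x1.
Proof. by rewrite /dg cyc_h3. Qed.

Definition conjugate u v : Prop := exists k, aut k /\ k u = v.

Lemma conjugate_trans u v w : conjugate u v -> conjugate v w -> conjugate u w.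
Proof.
by move=> [k [kA <-]] [l [lA <-]]; exists (l \o k); split=> //; exact: aut_comp.
Qed.

Lemma conjugate_sym u v : conjugate u v -> conjugate v u.
Proof. by move=> [k [/aut_inverse[l [lA kl _]] <-]]; exists l. Qed.

Lemma conjugate_cyc x1 x2 x3 : conjugate (dg x1 x2 x3) (dg x2 x3 x1).
Proof. by exists (@cyc R); rewrite aut_cyc_dg; split=> //; exact: aut_cyc. Qed.

Lemma conjugate_phase y1 y2 y3 x1 x2 x3 : y1 * conjc y1 = 1 -> y2 * conjc y2 = 1 ->
  y1 * y2 * y3 = 1 -> conjugate (dg x1 x2 x3) (dg (y1 * x1) (y2 * x2) (y3 * x3)).
Proof. by move=> h1 h2 h3; have [k [kA kE]] := aut_phase h1 h2 h3; exists k. Qed.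

Lemma conjugate_dg1 x : x * conjc x = 1 -> conjugate (dg x 0 0) (dg 1 0 0).
Proof.
move=> xx; have := @conjugate_phase (conjc x) x 1 x 0 0.
by rewrite conjcK !mulr0 mulr1 (mulrC _ x) xx; apply.
Qed.

Lemma unit_conj2 x y : x * conjc x = 1 -> y * conjc y = 1 ->
  conjc x * conjc y * (x * y) = 1.
Proof.
move=> xx yy; transitivity ((x * conjc x) * (y * conjc y)); first by ring.
by rewrite xx yy mulr1.
Qed.

Lemma conjugate_dg2 x y : x * conjc x = 1 -> y * conjc y = 1 ->
  conjugate (dg 0 x y) (dg 0 1 1).
Proof.
move=> xx yy.
apply: conjugate_trans (conjugate_cyc _ _ _) _.
apply: conjugate_trans (_ : conjugate _ (dg 1 1 0)) _; last first.
  by do 2!apply: conjugate_trans (conjugate_cyc _ _ _) _; exists id; split=> //; exact: aut_id.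
have := @conjugate_phase (conjc x) (conjc y) (x * y) x y 0.
by rewrite !conjcK mulr0 (mulrC (conjc x) x) (mulrC (conjc y) y) xx yy; apply=> //; exact: unit_conj2.
Qed.

(** Since [hdet] is invariant, the phases can only be gathered in one entry. When an entry is 0, as
    in [conjugate_dg1] and [conjugate_dg2], the compensating phase acts on it and disappears. *)
Lemma conjugate_dg3 x y z : x * conjc x = 1 -> y * conjc y = 1 ->
  conjugate (dg x y z) (dg 1 1 (x * y * z)).
Proof.
move=> xx yy; have := @conjugate_phase (conjc x) (conjc y) (x * y) x y z.
by rewrite !conjcK (mulrC (conjc x) x) (mulrC (conjc y) y) xx yy; apply=> //; exact: unit_conj2.
Qed.

Lemma unit_mul x y : x * conjc x = 1 -> y * conjc y = 1 -> x * y * conjc (x * y) = 1.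
Proof.
move=> xx yy; rewrite conjcM; transitivity ((x * conjc x) * (y * conjc y)); first by ring.
by rewrite xx yy mulr1.
Qed.

(** After diagonalization each entry satisfies x |x|^2 = x, hence is 0 or a phase. The eight cases
    reduce to four by cyclic shifts. *)
Lemma tripotent_normal e : tripotent e ->
  [\/ e = 0, conjugate e (dg 1 0 0), conjugate e (dg 0 1 1) |
     exists z, z * conjc z = 1 /\ conjugate e (dg 1 1 z)].
Proof.
move=> eT; have [k [kA [x1 [x2 [x3]]]]] := diagonalize e.
rewrite -/(dg _ _ _) => ke.
have {eT} : tripotent (dg x1 x2 x3) by rewrite -ke; apply/(aut_tripotent e kA).
have ex : conjugate e (dg x1 x2 x3) by exists k.
have U x : x * x * conjc x = x -> x = 0 \/ x * conjc x = 1.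
  have [->|x0] := eqVneq x 0; first by left.
  by rewrite -mulrA -[RHS]mulr1 => /(mulfI x0); right.
have C1 x : x * conjc x = 1 -> conjugate (dg x 0 0) (dg 1 0 0) by exact: conjugate_dg1.
have cy := conjugate_cyc.
move=> /tripotent_dg[/U[z1|u1] /U[z2|u2] /U[z3|u3]];
  rewrite ?z1 ?z2 ?z3 in ex.
- constructor 1; move: ex => [l [lA le]].
  by apply: (aut_inj lA); rewrite le dg0 (aut0 lA).
- constructor 2; apply: conjugate_trans ex _; apply: conjugate_trans (cy _ _ _) _.
  exact: conjugate_trans (cy _ _ _) (C1 _ u3).
- constructor 2; apply: conjugate_trans ex _.
  exact: conjugate_trans (cy _ _ _) (C1 _ u2).
- constructor 3; apply: conjugate_trans ex _; exact: conjugate_dg2.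
- constructor 2; apply: conjugate_trans ex _; exact: C1.
- constructor 3; apply: conjugate_trans ex _.
  apply: conjugate_trans (cy _ _ _) _; exact: conjugate_dg2.
- constructor 3; apply: conjugate_trans ex _; apply: conjugate_trans (cy _ _ _) _.
  apply: conjugate_trans (cy _ _ _) _; exact: conjugate_dg2.
- constructor 4; exists (x1 * x2 * x3); split; first exact: unit_mul (unit_mul u1 u2) u3.
  apply: conjugate_trans ex _; exact: conjugate_dg3.
Qed.

Lemma conjugate_hm u v : conjugate u v -> hm u u = hm v v.
Proof. by move=> [k [kA <-]]; rewrite (aut_hm kA). Qed.

Lemma hm_dg1 : hm (dg 1 0 0) (dg 1 0 0) = 1 :> C.
Proof. by rewrite hm_dg (rmorph1 conjc) !mul0r mulr1 !addr0. Qed.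

Lemma hm_dg011 : hm (dg 0 1 1) (dg 0 1 1) = 2%:R :> C.
Proof. by rewrite hm_dg (rmorph1 conjc) !mul0r mulr1 !add0r. Qed.

Lemma hm_dg11 z : z * conjc z = 1 -> hm (dg 1 1 z) (dg 1 1 z) = 3%:R.
Proof. by move=> zz; rewrite hm_dg zz (rmorph1 conjc) mulr1; ring. Qed.

Lemma tripotent_hm_ge1 e : tripotent e -> e <> 0 -> 1 <= hm e e.
Proof.
move=> /tripotent_normal[//|||[z [zz]]] /conjugate_hm -> _.
- by rewrite hm_dg1.
- by rewrite hm_dg011 ler1n.
- by rewrite hm_dg11 // ler1n.
Qed.

Lemma tripotent_hm1 e : tripotent e -> hm e e = 1 -> conjugate e (dg 1 0 0).
Proof.
move=> /tripotent_normal[-> | // | ec | [z [zz ec]]].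
- by rewrite hm0l => /eqP; rewrite eq_sym oner_eq0.
- by rewrite (conjugate_hm ec) hm_dg011 => /eqP; rewrite pnatr_eq1.
- by rewrite (conjugate_hm ec) hm_dg11 // => /eqP; rewrite pnatr_eq1.
Qed.

Lemma tripotent_hm2 e : tripotent e -> hm e e = 2%:R -> conjugate e (dg 0 1 1).
Proof.
move=> /tripotent_normal[-> | ec | // | [z [zz ec]]].
- by rewrite hm0l => /eqP; rewrite eq_sym pnatr_eq0.
- by rewrite (conjugate_hm ec) hm_dg1 => /eqP; rewrite eq_sym pnatr_eq1.
- by rewrite (conjugate_hm ec) hm_dg11 // => /eqP; rewrite eqr_nat.
Qed.

Lemma tripotent_hm3 e : tripotent e -> hm e e = 3%:R ->
  exists z, z * conjc z = 1 /\ conjugate e (dg 1 1 z).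
Proof.
move=> /tripotent_normal[-> | ec | ec | //].
- by rewrite hm0l => /eqP; rewrite eq_sym pnatr_eq0.
- by rewrite (conjugate_hm ec) hm_dg1 => /eqP; rewrite eq_sym pnatr_eq1.
- by rewrite (conjugate_hm ec) hm_dg011 => /eqP; rewrite eqr_nat.
Qed.

Lemma tripotent_dg01 (b1 b2 b3 : bool) : tripotent (dg b1%:R b2%:R b3%:R : H3 R).
Proof.
apply/tripotent_dg; have E (b : bool) : b%:R * b%:R * conjc b%:R = b%:R :> C.
  by rewrite conjc_nat; case: b; rewrite ?mulr1 ?mulr0.
by split; exact: E.
Qed.

(** For diagonal f, the equation {f, g, f} = 0 reads x_i^2 conj y_i = 0 on the diagonal, so each
    product x_i conj y_i vanishes. *)
Lemma orthogonal_hm f g : tripotent f -> orthogonal f g -> hm f g = 0.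
Proof.
move=> _ fg; have [k [kA [x1 [x2 [x3]]]]] := diagonalize f; rewrite -/(dg _ _ _) => kf.
have {fg} := (aut_orthogonal f g kA).2 fg; rewrite -(aut_hm kA) kf.
case: (h3P (k g)) => y1 y2 y3 b1 b2 b3 /orthogonalE /(_ (dg x1 x2 x3)).
rewrite tp_dg h3_scale h3_zero => /h3_inj[[e1 e2 e3] _].
have E x y : 2%:R * (x * x * conjc y) = 0 -> x * conjc y = 0.
  move/eqP; rewrite !mulf_eq0 pnatr_eq0 /= orbb.
  by case/orP => /eqP ->; rewrite ?mul0r ?mulr0.
by rewrite /dg hm_h3 !oform0l !addr0 (E _ _ e1) (E _ _ e2) (E _ _ e3) !addr0.
Qed.

Lemma orthogonalC f g : orthogonal f g -> orthogonal g f.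
Proof. by move/orthogonalE/tp_eq0C/orthogonalE. Qed.

Lemma tripotentD f g : tripotent f -> tripotent g -> orthogonal f g -> tripotent (f + g).
Proof.
move=> /tripotentE fT /tripotentE gT fg; have /orthogonalE gf := orthogonalC fg.
move/orthogonalE: fg => fg; apply/tripotentE.
rewrite !(tpDl, tpDm, tpDr) (tpC f f g) (tpC g g f) fT gT !fg !gf.
by rewrite !(addr0, add0r) scalerDr.
Qed.

Lemma hm_orthogonalD f g : tripotent f -> orthogonal f g ->
  hm (f + g) (f + g) = hm f f + hm g g.
Proof.
move=> fT fg; have f0 := orthogonal_hm fT fg.
by rewrite !(hmDl, hmDr) (hm_conj f g) f0 (rmorph0 conjc) addr0 add0r.
Qed.

(** The squared norm is additive on orthogonal sums and at least 1 on nonzero tripotents, so norm 1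
    excludes a decomposition. The normal forms of norm 2 and 3 decompose explicitly. *)
Lemma minimal_tripotentP e : minimal_tripotent e <-> tripotent e /\ hm e e = 1.
Proof.
have O x y z : orthogonal (dg x 0 0) (dg 0 y z).
  by apply: orthogonal_dg; rewrite ?mulr0 ?mul0r.
have S f g e' : conjugate e' (f + g) -> tripotent f -> tripotent g -> orthogonal f g ->
    f <> 0 -> g <> 0 -> ~ minimal_tripotent e'.
  move=> /conjugate_sym[k [kA <-]] fT gT fg f0 g0 [_ _]; apply.
  have nz h : h <> 0 -> k h <> 0 by move=> h0; rewrite -(aut0 kA) => /(aut_inj kA).
  exists (k f), (k g); split.
  - by split; [exact/(aut_tripotent _ kA) | exact: nz].
  - by split; [exact/(aut_tripotent _ kA) | exact: nz].
  - exact/(aut_orthogonal _ _ kA).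
  - exact: autD.
have one0 : (1 : C) <> 0 by apply/eqP; exact: oner_neq0.
split=> [eM|[eT e1]].
  have [eT e0 _] := eM; split=> //.
  have [//|ec|ec|[z [zz ec]]] := tripotent_normal eT.
  - by rewrite (conjugate_hm ec) hm_dg1.
  - case: (@S (dg 0 1 0) (dg 0 0 1) e) => //.
    + by rewrite dg_add !addr0 add0r.
    + exact: (tripotent_dg01 false true false).
    + exact: (tripotent_dg01 false false true).
    + by apply: orthogonal_dg; rewrite ?mulr0 ?mul0r.
    + by rewrite -dg0 => /dg_inj[_ /one0].
    + by rewrite -dg0 => /dg_inj[_ _ /one0].
  - case: (@S (dg 1 0 0) (dg 0 1 z) e) => //.
    + by rewrite dg_add !addr0 !add0r.
    + exact: (tripotent_dg01 true false false).
    + by apply/tripotent_dg; rewrite -!mulrA zz (rmorph1 conjc) !mulr1 !mul0r.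
    + by rewrite -dg0 => /dg_inj[/one0].
    + by rewrite -dg0 => /dg_inj[_ /one0].
split=> // [e0|[f [g [[fT f0] [gT g0] fg ef]]]].
  by move: e1; rewrite e0 hm0l => /esym.
have := lerD (tripotent_hm_ge1 fT f0) (tripotent_hm_ge1 gT g0).
by rewrite -hm_orthogonalD // -ef e1 gerDl ler10.
Qed.

Lemma rank2_tripotentP e : has_rank 2 e <-> tripotent e /\ hm e e = 2%:R.
Proof.
split=> [[c [cM cO ->]]|[eT e2]].
  rewrite !big_ord_recl big_ord0 addr0.
  have /minimal_tripotentP[c0T c01] := cM ord0.
  have /minimal_tripotentP[c1T c11] := cM (lift ord0 ord0).
  have c01O : orthogonal (c ord0) (c (lift ord0 ord0)) by exact: cO.
  by split; [exact: tripotentD | rewrite hm_orthogonalD // c01 c11].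
have /conjugate_sym[k [kA <-]] := tripotent_hm2 eT e2.
exists (fun i : 'I_2 => k (if i == ord0 then dg 0 1 0 else dg 0 0 1)); split=> [i|i j ij|].
- have -> : (if i == ord0 then dg 0 1 0 else dg 0 0 1) =
      dg false%:R (i == ord0)%:R (i != ord0)%:R :> H3 R by case: eqP.
  apply/minimal_tripotentP; split; first exact/(aut_tripotent _ kA)/tripotent_dg01.
  by rewrite (aut_hm kA) hm_dg !conjc_nat; case: eqP => _;
    rewrite !(mul0r, mulr0, mulr1, add0r, addr0).
- apply/(aut_orthogonal _ _ kA).
  have [i0|i0] := eqVneq i ord0; have [j0|j0] := eqVneq j ord0;
    try by apply: orthogonal_dg; rewrite ?mulr0 ?mul0r.
    by rewrite i0 j0 eqxx in ij.
  by case: i j i0 j0 ij => [[|[|//]] ?] [[|[|//]] ?].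
- by rewrite !big_ord_recl big_ord0 /= addr0 -(autD kA) dg_add !addr0 !add0r.
Qed.

(** A normal form with a zero entry is, up to a cyclic shift, orthogonal to [dg 0 1 0]. If instead
    all three entries are phases, f -> {e, f, e} is injective, so nothing nonzero is orthogonal to
    e. *)
Lemma maximal_tripotentP e : maximal_tripotent e <-> tripotent e /\ hm e e = 3%:R.
Proof.
have one0 : (1 : C) <> 0 by apply/eqP; exact: oner_neq0.
have S f e' : conjugate e' f -> orthogonal f (dg 0 1 0) -> ~ maximal_tripotent e'.
  move=> /conjugate_sym[k [kA <-]] fO [_ /(_ (k (dg 0 1 0)))]; apply.
  - exact/(aut_tripotent _ kA)/(tripotent_dg01 false true false).
  - by rewrite -(aut0 kA) -dg0 => /(aut_inj kA)/dg_inj[_ /one0].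
  - exact/(aut_orthogonal _ _ kA).
split=> [eM|[eT e3]].
  have [eT _] := eM; split=> //.
  have [e0|ec|ec|[z [zz ec]]] := tripotent_normal eT.
  - case: (@S (dg 0 0 0) e) => //; last by apply: orthogonal_dg; rewrite mul0r.
    by exists id; split; [exact: aut_id | rewrite dg0].
  - case: (@S (dg 1 0 0) e) => //.
    by apply: orthogonal_dg; rewrite ?mul0r ?mulr0.
  - case: (@S (dg 1 0 1) e) => //; last by apply: orthogonal_dg; rewrite ?mul0r ?mulr0.
    by apply: conjugate_trans ec _; do 2!apply: conjugate_trans (conjugate_cyc _ _ _) _;
      exists id; split=> //; exact: aut_id.
  - by rewrite (conjugate_hm ec) hm_dg11.
split=> // f fT f0; have [z [zz [k [kA ke]]]] := tripotent_hm3 eT e3.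
move=> /(aut_orthogonal e f kA).2; rewrite ke => /orthogonalE h.
have {}h := h (dg 1 1 z).
apply: f0; apply: (aut_inj kA); rewrite (aut0 kA).
move: h; case: (h3P (k f)) => y1 y2 y3 b1 b2 b3; rewrite tp_dg !mul1r mulr1.
have two : 2%:R != 0 :> C by rewrite pnatr_eq0.
have z0 : z != 0 by apply/eqP => z0; move: zz; rewrite z0 mul0r => /esym.
move/eqP; rewrite scaler_eq0 (negbTE two) /= => /eqP; rewrite !scale1r h3_zero.
case/h3_inj => [[e1 e2 e4] [f1 f2 f3]].
have Y x y : x != 0 -> x * conjc y = 0 -> y = 0.
  by move=> x0 /eqP; rewrite mulf_eq0 (negbTE x0) /= => /eqP h; rewrite -(conjcK y) h; exact: rmorph0.
have B b : bar b = 0 -> b = 0.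
  move=> h; have <- : bar (bar b) = b by apply/rowP => i; rewrite !mxE conjcK.
  by rewrite h bar0.
have Z a : z *: a = 0 -> a = 0.
  by move=> h; rewrite -[a](scalerK z0) h scaler0.
have e1' : y1 = 0 by apply: (Y 1); rewrite ?oner_neq0 ?mul1r.
have e2' : y2 = 0 by apply: (Y 1); rewrite ?oner_neq0 ?mul1r.
have e3' : y3 = 0 by apply: (Y (z * z)); rewrite ?mulf_neq0.
rewrite e1' e2' e3' (B _ (Z _ f1)) (B _ (Z _ f2)) (B _ f3).
by [].
Qed.
End Classification.

(** * Characterization by determinant and adjugate *)

Section Invariants.
Variable R : realType.
Local Notation C := R[i].
Implicit Types (c t x y z : C) (a b d : oct C) (e f g u v w : H3 R) (k : H3 R -> H3 R).

Lemma conjugate_tripotent e f : conjugate e f -> tripotent f -> tripotent e.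
Proof. by move=> [k [kA <-]] /(aut_tripotent _ kA). Qed.

Lemma conjugate_adj_eq0 u v : conjugate u v -> (adj u = 0 <-> adj v = 0).
Proof.
move=> [k [kA <-]]; rewrite (aut_adj kA); split=> [-> | h].
  by rewrite !(cj0, aut0 kA).
have {}h : cj (adj u) = 0 by apply: (aut_inj kA); rewrite -[LHS]cjK h cj0 (aut0 kA).
by rewrite -[LHS]cjK h cj0.
Qed.

Lemma conjugate_hdet u v : conjugate u v -> hdet u = hdet v.
Proof. by move=> [k [kA <-]]; rewrite (aut_hdet kA). Qed.

Lemma conjugate_hm_adj u v : conjugate u v -> hm (adj u) (adj u) = hm (adj v) (adj v).
Proof. by move=> [k [kA <-]]; rewrite (aut_hm_adj kA). Qed.

Lemma hm_adj_dg x1 x2 x3 : hm (adj (dg x1 x2 x3)) (adj (dg x1 x2 x3)) =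
  (x2 * conjc x2) * (x3 * conjc x3) + (x3 * conjc x3) * (x1 * conjc x1)
  + (x1 * conjc x1) * (x2 * conjc x2).
Proof. by rewrite adj_dg hm_dg !conjcM; ring. Qed.

Lemma diagonalize_dg u : exists x1 x2 x3, conjugate u (dg x1 x2 x3).
Proof.
by have [k [kA [x1 [x2 [x3 ku]]]]] := diagonalize u; exists x1, x2, x3, k.
Qed.

Lemma tripotent_dg_sqr x1 x2 x3 :
  (forall x, x \in [:: x1; x2; x3] -> x * conjc x = 0 \/ x * conjc x = 1) ->
  tripotent (dg x1 x2 x3).
Proof.
move=> h; apply/tripotent_dg.
have E x : x \in [:: x1; x2; x3] -> x * x * conjc x = x.
  by move=> /h; rewrite -mulrA => -[/eqP|->]; rewrite ?mulr1 //
    mulf_eq0 conjc_eq0 orbb => /eqP ->; rewrite mul0r.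
by split; apply: E; rewrite !inE eqxx ?orbT.
Qed.

(** On a diagonal element the equation [adj e = 0] says that at most one entry is nonzero; the norm
    condition makes it a phase. *)
Lemma minimal_adjP e : minimal_tripotent e <-> adj e = 0 /\ hm e e = 1.
Proof.
rewrite minimal_tripotentP; split=> [[eT e1]|[ea e1]].
  have ec := tripotent_hm1 eT e1; split=> //; apply/(conjugate_adj_eq0 ec).
  by rewrite adj_dg !mulr0 !mul0r dg0.
split=> //; have [x1 [x2 [x3 ec]]] := diagonalize_dg e.
apply: (conjugate_tripotent ec); move: ea e1.
move/(conjugate_adj_eq0 ec); rewrite (conjugate_hm ec) adj_dg hm_dg -dg0.
move=> /dg_inj[x23 x31 x12] n1; apply: tripotent_dg_sqr => x.
have [z1|n10] := eqVneq x1 0; last first.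
  have z3 : x3 = 0 by move/eqP: x31; rewrite mulf_eq0 (negbTE n10) orbF => /eqP.
  have z2 : x2 = 0 by move/eqP: x12; rewrite mulf_eq0 (negbTE n10) => /eqP.
  move: n1; rewrite z2 z3 !mul0r !addr0 !inE => n1.
  by case/or3P => /eqP ->; rewrite ?mul0r; [right|left|left].
move: n1; rewrite z1 mul0r add0r; move/eqP: x23; rewrite mulf_eq0.
by case/orP => /eqP ->; rewrite mul0r ?addr0 ?add0r !inE => n1 /or3P[] /eqP ->;
  rewrite ?mul0r; by [left|right].
Qed.

(** On the diagonal, a vanishing determinant removes one entry; the squared moduli of the other two
    have sum 2 and product 1, so both equal 1. *)
Lemma rank2_detP e : has_rank 2 e <->
  [/\ hdet e = 0, hm (adj e) (adj e) = 1 & hm e e = 2%:R].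
Proof.
rewrite rank2_tripotentP; split=> [[eT e2]|[ed ea e2]].
  have ec := tripotent_hm2 eT e2; split=> //.
    by rewrite (conjugate_hdet ec) hdet_dg !mul0r.
  by rewrite (conjugate_hm_adj ec) hm_adj_dg (rmorph1 conjc) !mul0r !mulr0 !addr0 !mulr1.
split=> //; have [x1 [x2 [x3 ec]]] := diagonalize_dg e.
apply: (conjugate_tripotent ec); move: ed ea e2.
rewrite (conjugate_hdet ec) (conjugate_hm ec) (conjugate_hm_adj ec) hdet_dg hm_dg hm_adj_dg.
have E x y z : x + y = 2%:R -> x * y = 1 -> x = 1 /\ y = 1 :> C.
  move=> xy xy1; suff x1' : x = 1 by split=> //; move: xy1; rewrite x1' mul1r.
  have : (x - 1) ^+ 2 = 0.
    transitivity (x * (x + y) - x * y - 2%:R * x + 1); first by ring.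
    by rewrite xy xy1; ring.
  by move/eqP; rewrite expf_eq0 subr_eq0 => /eqP.
move=> /eqP; rewrite !mulf_eq0 -orbA => /or3P[] /eqP ->;
  rewrite !(mul0r, mulr0, addr0, add0r) => m1 m2.
- have [h1 h2] := E _ _ 0 m2 m1; apply: tripotent_dg_sqr => x.
  by rewrite !inE => /or3P[] /eqP ->; rewrite ?mul0r; by [left|right].
- rewrite addrC in m2; have [h1 h2] := E _ _ 0 m2 m1; apply: tripotent_dg_sqr => x.
  by rewrite !inE => /or3P[] /eqP ->; rewrite ?mul0r; by [left|right].
- have [h1 h2] := E _ _ 0 m2 m1; apply: tripotent_dg_sqr => x.
  by rewrite !inE => /or3P[] /eqP ->; rewrite ?mul0r; by [left|right].
Qed.

(** The three conditions give the elementary symmetric functions 3, 3, 1 of the squared moduli of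
    the diagonal entries, which are therefore roots of (T - 1)^3. *)
Lemma maximal_detP e : maximal_tripotent e <->
  [/\ `|hdet e| ^+ 2 = 1, hm (adj e) (adj e) = 3%:R & hm e e = 3%:R].
Proof.
rewrite maximal_tripotentP sqr_normc; split=> [[eT e3]|[ed ea e3]].
  have [z [zz ec]] := tripotent_hm3 eT e3; split=> //.
    by rewrite (conjugate_hdet ec) hdet_dg !mul1r.
  by rewrite (conjugate_hm_adj ec) hm_adj_dg (rmorph1 conjc) zz !mulr1; ring.
split=> //; have [x1 [x2 [x3 ec]]] := diagonalize_dg e.
apply: (conjugate_tripotent ec); move: ed ea e3.
rewrite (conjugate_hdet ec) (conjugate_hm ec) (conjugate_hm_adj ec) hdet_dg hm_dg hm_adj_dg.
have -> : x1 * x2 * x3 * conjc (x1 * x2 * x3) =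
    (x1 * conjc x1) * (x2 * conjc x2) * (x3 * conjc x3) by rewrite !conjcM; ring.
have E (p q r : C) : p * q * r = 1 -> q * r + r * p + p * q = 3%:R -> p + q + r = 3%:R ->
    p = 1.
  move=> h1 h2 h3; have : (p - 1) ^+ 3 = 0.
    transitivity (p ^+ 2 * (p + q + r) - p * (q * r + r * p + p * q) + p * q * r
      - 3%:R * p ^+ 2 + 3%:R * p - 1); first by ring.
    by rewrite h1 h2 h3; ring.
  by move/eqP; rewrite expf_eq0 subr_eq0 => /eqP.
move=> m1 m2 m3; apply: tripotent_dg_sqr => x.
rewrite !inE => /or3P[] /eqP ->; right.
- exact: (E _ _ _ m1 m2 m3).
- by apply: (E _ (x3 * conjc x3) (x1 * conjc x1)); [rewrite -m1|rewrite -m2|rewrite -m3]; ring.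
- by apply: (E _ (x1 * conjc x1) (x2 * conjc x2)); [rewrite -m1|rewrite -m2|rewrite -m3]; ring.
Qed.
End Invariants.

(** * Dimensions of the Peirce spaces *)

Section PeirceDimensions.
Variable R : realType.
Local Notation C := R[i].
Implicit Types (c t x y z : C) (a b d : oct C) (e f g u v w : H3 R) (k : H3 R -> H3 R).

Lemma peirceE j e u : u \in peirce j e <-> tp e e u = j%:R *: u.
Proof. by rewrite peirceP tp.unlock. Qed.

Lemma aut_peirce k j e u : aut k -> (k u \in peirce j (k e)) = (u \in peirce j e).
Proof.
move=> kA; apply/idP/idP => /peirceE h; apply/peirceE.
  by apply: (aut_inj kA); rewrite -(aut_tp kA) h (autZ kA).
by rewrite (aut_tp kA) h (autZ kA).
Qed.

Lemma dim_peirce_conjugate j e f : conjugate e f -> \dim (peirce j e) = \dim (peirce j f).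
Proof.
have le k u : aut k -> (\dim (peirce j u) <= \dim (peirce j (k u)))%N.
  move=> kA.
  pose lin := GRing.isLinear.Build _ _ _ _ k (aut_linear kA).
  pose K : {linear H3 R -> H3 R} := HB.pack k lin.
  have ker0 : lker (linfun K) == 0%VS.
    by apply/lker0P => v w; rewrite !lfunE; exact: aut_inj.
  have D : \dim (linfun K @: peirce j u) = \dim (peirce j u).
    by apply: limg_dim_eq; rewrite (eqP ker0) capv0.
  apply: leq_trans (eq_leq (esym D)) _.
  apply/dimvS/subvP => v /memv_imgP[w wj ->]; rewrite lfunE /=.
  by rewrite aut_peirce.
move=> [k [kA <-]]; apply/anti_leq/andP; split; first exact: le.
have [l [lA kl _]] := aut_inverse kA.
by have := le l (k e) lA; rewrite kl.
Qed.

Lemma dim_param (W : vectType C) (U : {vspace H3 R}) (k : W -> H3 R) :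
  (forall c (p q : W), k (c *: p + q) = c *: k p + k q) -> injective k ->
  (forall u, u \in U <-> exists p, u = k p) -> \dim U = \dim {: W}.
Proof.
move=> kL kI kU.
pose lin := GRing.isLinear.Build _ _ _ _ k kL.
pose K : {linear W -> H3 R} := HB.pack k lin.
have ker0 : lker (linfun K) == 0%VS by apply/lker0P => v w; rewrite !lfunE; exact: kI.
have D : \dim (linfun K @: fullv) = \dim {: W}.
  by apply: limg_dim_eq; rewrite (eqP ker0) capv0.
apply: etrans D; congr (\dim _); apply/vspaceP => u; apply/idP/idP => [/kU[p ->]|/memv_imgP[p _ ->]].
  by apply/memv_imgP; exists p; rewrite ?memvf ?lfunE.
by rewrite lfunE; apply/kU; exists p.
Qed.

Lemma scale_nat_eq (V : lmodType C) (m n : nat) (v : V) : m != n ->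
  m%:R *: v = n%:R *: v -> v = 0.
Proof.
move=> mn /eqP; rewrite -subr_eq0 -scalerBl scaler_eq0 subr_eq0 eqr_nat (negbTE mn) /=.
by move/eqP.
Qed.

(** D(e, e) is diagonal here, with natural eigenvalues b_i + b_j. Viewing the scalar entries in
    [C^o] lets [peirce_dg01] treat all six entries by one statement. *)
Lemma tp_dg01 (b1 b2 b3 : bool) z1 z2 z3 a1 a2 a3 :
  tp (dg b1%:R b2%:R b3%:R) (dg b1%:R b2%:R b3%:R) (h3 z1 z2 z3 a1 a2 a3) =
  h3 ((b1 + b1)%:R *: (z1 : C^o)) ((b2 + b2)%:R *: (z2 : C^o)) ((b3 + b3)%:R *: (z3 : C^o))
    ((b2 + b3)%:R *: a1) ((b3 + b1)%:R *: a2) ((b1 + b2)%:R *: a3).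
Proof.
have E (b : bool) : b%:R * conjc b%:R = b%:R :> C.
  by rewrite conjc_nat; case: b; rewrite ?mulr1 ?mulr0.
have D (b : bool) : 2 * b%:R = (b + b)%:R :> C by rewrite natrD; ring.
by rewrite tp_dg2 !E !D !natrD.
Qed.

Lemma peirce_dg01 (b1 b2 b3 : bool) j z1 z2 z3 a1 a2 a3 :
  h3 z1 z2 z3 a1 a2 a3 \in peirce j (dg b1%:R b2%:R b3%:R) <->
  [/\ (b1 + b1 == j)%N || (z1 == 0), (b2 + b2 == j)%N || (z2 == 0) &
      (b3 + b3 == j)%N || (z3 == 0)] /\
  [/\ (b2 + b3 == j)%N || (a1 == 0), (b3 + b1 == j)%N || (a2 == 0) &
      (b1 + b2 == j)%N || (a3 == 0)].
Proof.
have S (V : lmodType C) (m : nat) (v : V) : (m == j)%N || (v == 0) <-> m%:R *: v = j%:R *: v.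
  split; first by case/orP => /eqP ->; rewrite ?scaler0.
  by have [//|mj /scale_nat_eq ->] := eqVneq m j; rewrite ?eqxx.
rewrite peirceE tp_dg01 h3_scale; split.
  move=> /h3_inj[[h1 h2 h3'] [h4 h5 h6]].
  by split; split; apply/S.
by move=> [[/S h1 /S h2 /S h3'] [/S h4 /S h5 /S h6]]; congr (h3 _ _ _ _ _ _).
Qed.

Lemma peirce2_minimal e : minimal_tripotent e -> peirce 2 e = <[e]>%VS.
Proof.
move=> /minimal_tripotentP[eT e1]; have [k [kA ke]] := tripotent_hm1 eT e1.
apply/vspaceP => u; rewrite -(aut_peirce 2 e u kA) ke.
have H z1 z2 z3 a1 a2 a3 := peirce_dg01 true false false 2 z1 z2 z3 a1 a2 a3.
apply/idP/vlineP => [|[c ->]]; last first.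
  by rewrite (autZ kA) ke dg_scale !mulr0; apply/H; rewrite !eqxx.
move ku : (k u) => v; case: (h3P v) ku => z1 z2 z3 a1 a2 a3 ku /H /=.
move=> -[[_ /eqP h2 /eqP h3'] [/eqP h4 /eqP h5 /eqP h6]].
exists z1; apply: (aut_inj kA); rewrite ku (autZ kA) ke dg_scale mulr1 !mulr0.
by rewrite h2 h3' h4 h5 h6.
Qed.

(** The hypotheses select [dg 1 0 0] and [dg 0 1 1]. These have the same V_1, made of the second and
    third off-diagonal octonions, of dimension 8 + 8. *)
Lemma dim_peirce1_dg (b1 b2 b3 : bool) : b2 = b3 -> b1 = ~~ b2 ->
  \dim (peirce 1 (dg b1%:R b2%:R b3%:R : H3 R)) = 16%N.
Proof.
move=> b23 b12.
have H z1 z2 z3 a1 a2 a3 := peirce_dg01 b1 b2 b3 1 z1 z2 z3 a1 a2 a3.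
pose k (p : ('rV[C]_(1 + 7) * 'rV[C]_(1 + 7))%type) : H3 R := h3 0 0 0 0 p.1 p.2.
rewrite (@dim_param ('rV[C]_(1 + 7) * 'rV[C]_(1 + 7))%type _ k) ?dimvf //.
- move=> c [u1 u2] [v1 v2]; by rewrite /k /= h3_lin !mulr0 !addr0 scaler0.
- by move=> [u1 u2] [v1 v2] /h3_inj[_ [_ /= -> ->]].
move=> u; split=> [|[p ->]]; last first.
  by apply/H; rewrite !eqxx !orbT; move: b23 b12 => <- ->; case: (b2).
case: (h3P u) => z1 z2 z3 a1 a2 a3 /H; move: b23 b12 => <- ->.
case: (b2) => /= -[[/eqP h1 /eqP h2 /eqP h3'] [/eqP h4 _ _]];
  by exists (a2, a3); rewrite /k h1 h2 h3' h4.
Qed.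

Lemma dim_peirce1_minimal e : minimal_tripotent e -> \dim (peirce 1 e) = 16%N.
Proof.
move=> /minimal_tripotentP[eT e1].
rewrite (dim_peirce_conjugate 1 (tripotent_hm1 eT e1)).
exact: (@dim_peirce1_dg true false false).
Qed.

Lemma dim_peirce1_rank2 e : has_rank 2 e -> \dim (peirce 1 e) = 16%N.
Proof.
move=> /rank2_tripotentP[eT e1].
rewrite (dim_peirce_conjugate 1 (tripotent_hm2 eT e1)).
exact: (@dim_peirce1_dg false true true).
Qed.

Lemma dim_peirce2_rank2 e : has_rank 2 e -> \dim (peirce 2 e) = 10%N.
Proof.
move=> /rank2_tripotentP[eT e1].
rewrite (dim_peirce_conjugate 2 (tripotent_hm2 eT e1)).
have H z1 z2 z3 a1 a2 a3 := peirce_dg01 false true true 2 z1 z2 z3 a1 a2 a3.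
pose k (p : ('rV[C]_2 * 'rV[C]_(1 + 7))%type) : H3 R :=
  h3 0 (p.1 0 0) (p.1 0 1) p.2 0 0.
rewrite (@dim_param ('rV[C]_2 * 'rV[C]_(1 + 7))%type _ k) ?dimvf //.
- move=> c [u1 u2] [v1 v2]; by rewrite /k /= h3_lin !mxE !mulr0 !addr0 !scaler0.
- move=> [u1 u2] [v1 v2] /h3_inj[[_ /= h2 h3'] [-> _ _]]; congr pair.
  apply/rowP => i; case: i => [[|[|//]] i2].
    by rewrite (_ : Ordinal i2 = 0) //; exact/val_inj.
  by rewrite (_ : Ordinal i2 = 1) //; exact/val_inj.
move=> u; split=> [|[p ->]]; last by apply/H; rewrite !eqxx.
case: (h3P u) => z1 z2 z3 a1 a2 a3 /H /= -[[/eqP h1 _ _] [_ /eqP h5 /eqP h6]].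
exists (\row_i [:: z2; z3]`_i, a1); rewrite /k h1 h5 h6 !mxE.
by [].
Qed.

(** In normal form all three entries are phases, so D(e, e) is twice the identity. *)
Lemma peirce1_maximal e u : maximal_tripotent e -> tp e e u = u -> u = 0.
Proof.
move=> /maximal_tripotentP[eT e1]; have [z [zz [k [kA ke]]]] := tripotent_hm3 eT e1.
move=> h; apply: (aut_inj kA); move/(congr1 k): h; rewrite -(aut_tp kA) ke (aut0 kA).
case: (h3P (k u)) => z1 z2 z3 a1 a2 a3; rewrite tp_dg2 zz (rmorph1 conjc) !mulr1.
have E : 1 + 1 = 2%:R :> C by [].
have S (V : lmodType C) (v : V) : 2%:R *: v = v -> v = 0.
  by rewrite -[RHS]scale1r; exact: (@scale_nat_eq V 2 1 v).
rewrite E h3_zero => /h3_inj[[h1 h2 h3'] [h4 h5 h6]].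
by rewrite (S C^o _ h1) (S C^o _ h2) (S C^o _ h3') (S _ _ h4) (S _ _ h5) (S _ _ h6).
Qed.
End PeirceDimensions.

(** * Smooth functions and charts *)

Section SmoothFunctions.
Variable R : realType.
Implicit Types (V W : normedModType R).

Lemma near_eq_differentiable V W (f g : V -> W) (a : V) :
  (\near a, f a = g a) -> differentiable f a -> differentiable g a.
Proof.
move=> fg df; have fga : f a = g a := nbhs_singleton fg.
have fg0 : \forall h \near (0 : V), (f \o shift a) h = (g \o shift a) h.
  by rewrite (near_shift a); apply: filterS fg => x /=; rewrite sub0r addrNK.
have E : g \o shift a = cst (g a) + 'd f a +o_ 0 id.
  apply/eqaddoP => e e0; have /eqaddoP/(_ e e0) := diff_locally df.
  apply: filterS2 fg0 => h; rewrite !fctE /= => fgh.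
  by rewrite fga fgh.
have D := diff_unique (diff_continuous df) E.
by apply/diff_locallyP; rewrite D; split=> //; exact: diff_continuous.
Qed.

(** The differentiation rules used below give formulas valid on U only, whereas [Ck_on] iterates the
    global function ['D_v f]; openness of U allows the replacement. *)
Lemma Ck_on_ext V W k (U : set V) (f g : V -> W) : open U ->
  {in U, f =1 g} -> Ck_on k U f -> Ck_on k U g.
Proof.
move=> Uo; elim: k f g => [|k IH] f g fg /=.
  move=> fC x Ux; have nfg : \near x, f x = g x.
    by apply: filterS (open_nbhs_nbhs (conj Uo Ux)) => y Uy; apply/fg/mem_set.
  have : f y @[y --> x] --> f x by exact: fC.
  rewrite (nbhs_singleton nfg); apply: cvg_trans; apply: near_eq_cvg.
  by apply: filterS nfg.
have nfg x : U x -> \near x, f x = g x.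
  by move=> Ux; apply: filterS (open_nbhs_nbhs (conj Uo Ux)) => y Uy; apply/fg/mem_set.
move=> [fD fC]; split=> [x Ux|v].
  exact: near_eq_differentiable (nfg x Ux) (fD x Ux).
apply: IH (fC v) => x /set_mem Ux; exact: near_eq_derive (nfg x Ux).
Qed.

Lemma Ck_on_le V W k (U : set V) (f : V -> W) : Ck_on k.+1 U f -> Ck_on k U f.
Proof.
elim: k f => [|k IH] f [fD fC].
  by move=> x Ux; exact: differentiable_continuous (fD x Ux).
by split=> // v; exact: IH (fC v).
Qed.

Lemma Ck_on_cst V W k (U : set V) (a : W) : Ck_on k U (fun _ : V => a).
Proof.
elim: k a => [|k IH] a /=; first by move=> x _; exact: cst_continuous.
split=> [x _|v]; first exact: differentiable_cst.
have -> : 'D_v (fun _ : V => a) = (fun _ : V => 0 : W).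
  by apply/funext => x; exact: derive_cst.
exact: IH.
Qed.

Lemma Ck_on_add V W k (U : set V) (f g : V -> W) : open U ->
  Ck_on k U f -> Ck_on k U g -> Ck_on k U (f + g).
Proof.
move=> Uo; elim: k f g => [|k IH] f g /=.
  by move=> fC gC x Ux; apply: cvgD; [exact: fC|exact: gC].
move=> [fD fC] [gD gC]; split=> [x Ux|v].
  by apply: differentiableD; [exact: fD|exact: gD].
apply: Ck_on_ext (IH _ _ (fC v) (gC v)) => // x /set_mem Ux.
by rewrite deriveD //; apply: diff_derivable; [exact: fD|exact: gD].
Qed.

Lemma Ck_on_linear V W W' k (U : set V) (f : V -> W) (L : {linear W -> W'}) : open U ->
  continuous L -> Ck_on k U f -> Ck_on k U (L \o f).
Proof.
move=> Uo Lc; elim: k f => [|k IH] f /=.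
  by move=> fC x Ux; apply: continuous_comp; [exact: fC|exact: Lc].
move=> [fD fC]; split=> [x Ux|v].
  by apply: differentiable_comp; [exact: fD|exact: linear_differentiable].
apply: Ck_on_ext (IH _ (fC v)) => // x /set_mem Ux /=.
rewrite [RHS]deriveE; last first.
  by apply: differentiable_comp; [exact: fD|exact: linear_differentiable].
rewrite diff_comp; [|exact: fD|exact: linear_differentiable].
by rewrite /= diff_lin // deriveE //; exact: fD.
Qed.

Lemma Ck_on_mul V k (U : set V) (f g : V -> R) : open U ->
  Ck_on k U f -> Ck_on k U g -> Ck_on k U (f * g).
Proof.
move=> Uo; elim: k f g => [|k IH] f g.
  by move=> fC gC x Ux; apply: cvgM; [exact: fC|exact: gC].
move=> fk gk; have f0 := Ck_on_le fk; have g0 := Ck_on_le gk.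
move: fk gk => [fD fC] [gD gC]; split=> [x Ux|v].
  by apply: differentiableM; [exact: fD|exact: gD].
apply: Ck_on_ext (Ck_on_add Uo (IH _ _ f0 (gC v)) (IH _ _ g0 (fC v))) => // x /set_mem Ux.
by rewrite deriveM //; apply: diff_derivable; [exact: fD|exact: gD].
Qed.

Lemma smooth_fun_alg V (U : set V) : open U -> fun_alg (fun f : V -> R => smooth_on U f).
Proof.
move=> Uo; split=> [r|f g fS gS|f g fS gS] k; first exact: Ck_on_cst.
  exact: Ck_on_add.
exact: Ck_on_mul.
Qed.

(** The derivative of 1/f is -(1/f)^2 f', of class C^k as soon as 1/f is. *)
Lemma smooth_inv V (U : set V) (f : V -> R) : open U -> smooth_on U f ->
  (forall x, U x -> f x != 0) -> smooth_on U (fun x => (f x)^-1).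
Proof.
move=> Uo fS f0; elim=> [|k IH].
  by move=> x Ux; apply: cvgV; [exact: f0|exact: (fS 0%N)].
have [fD fC] := fS k.+1; split=> [x Ux|v].
  by apply: differentiableV; [exact: fD|exact: f0].
have := Ck_on_mul Uo (Ck_on_mul Uo (Ck_on_cst k U (-1 : R)) (Ck_on_mul Uo IH IH)) (fC v).
apply: Ck_on_ext => // x /set_mem Ux.
rewrite deriveV; [|exact: f0|by apply: diff_derivable; exact: fD].
by rewrite !fctE mulN1r -invfM -expr2.
Qed.

Lemma diff_sqrt (y v : R) : 0 < y -> 'd (@Num.sqrt R) y v = v * (2 * Num.sqrt y)^-1.
Proof.
move=> y0; have [dS eS] := is_derive1_sqrt y0.
have dS' : differentiable (@Num.sqrt R) y by apply/derivable1_diffP.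
by rewrite -{1}[v]mulr1 -[v * 1]/(v *: 1) linearZ /= -eS (deriveE _ dS').
Qed.

Lemma smooth_sqrt V (U : set V) (f : V -> R) : open U -> smooth_on U f ->
  (forall x, U x -> 0 < f x) -> smooth_on U (fun x => Num.sqrt (f x)).
Proof.
move=> Uo fS f0.
have dS x : U x -> differentiable (@Num.sqrt R) (f x).
  by move=> Ux; apply/derivable1_diffP; have [] := is_derive1_sqrt (f0 _ Ux).
elim=> [|k IH].
  move=> x Ux; apply: (continuous_comp (g := @Num.sqrt R)); first exact: (fS 0%N).
  exact: sqrt_continuous.
have [fD fC] := fS k.+1; split=> [x Ux|v].
  by apply: (differentiable_comp (g := @Num.sqrt R)); [exact: fD|exact: dS].
(* The derivative of the root of f is f' times this function. As [smooth_inv] asks for all orders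
   while the root is only known to order k here, an inner induction on k is made. *)
have SI : Ck_on k U (fun x => (2 * Num.sqrt (f x))^-1).
  elim: k IH {fC fD} => [|k IHk] IH.
    move=> x Ux; apply: cvgV; first by rewrite mulf_neq0 ?pnatr_eq0 // gt_eqF ?sqrtr_gt0 ?f0.
    by apply: cvgM; [exact: cvg_cst|exact: IH].
  have IH' := IHk (Ck_on_le IH); case: IH => [sD sC].
  have sD2 x : U x -> differentiable (fun x => 2 * Num.sqrt (f x) : R) x.
    by move=> Ux; apply: (@differentiableM _ _ (cst 2) (fun x => Num.sqrt (f x)));
      [exact: differentiable_cst|exact: sD].
  have s0 x : U x -> 2 * Num.sqrt (f x) != 0.
    by move=> Ux; rewrite mulf_neq0 ?pnatr_eq0 // gt_eqF ?sqrtr_gt0 ?f0.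
  split=> [x Ux|v']; first by apply: differentiableV; [exact: sD2|exact: s0].
  have := Ck_on_mul Uo (Ck_on_mul Uo (Ck_on_cst k U (-2 : R)) (Ck_on_mul Uo IH' IH')) (sC v').
  apply: Ck_on_ext => // x /set_mem Ux.
  rewrite deriveV; [|exact: s0|by apply: diff_derivable; exact: sD2].
  have -> : 'D_v' (fun x => 2 * Num.sqrt (f x)) x = 2 * 'D_v' (fun x => Num.sqrt (f x)) x.
    have := @deriveM _ _ (cst 2) (fun x => Num.sqrt (f x)) x v' _ _.
    rewrite derive_cst scaler0 addr0; apply; apply: diff_derivable.
      exact: differentiable_cst.
    exact: sD.
  rewrite !fctE -[RHS]/(_ * _) -invfM -expr2.
  by move: ((2 * Num.sqrt (f x)) ^+ 2)^-1 => r; ring.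
have := Ck_on_mul Uo (fC v) SI; apply: Ck_on_ext => // x /set_mem Ux.
rewrite [RHS]deriveE; last by apply: (differentiable_comp (g := @Num.sqrt R)); [exact: fD|exact: dS].
rewrite (diff_comp (g := @Num.sqrt R)); [|exact: fD|exact: dS].
by rewrite /= diff_sqrt ?f0 // -(deriveE _ (fD x Ux)).
Qed.
End SmoothFunctions.

(** * Smooth maps with values in vector spaces *)

Section VectorValued.
Variable R : realType.
Implicit Types (V W : normedModType R).

Lemma Ck_on_sum V W k (U : set V) m (f : 'I_m -> V -> W) : open U ->
  (forall j, Ck_on k U (f j)) -> Ck_on k U (\sum_j f j).
Proof.
move=> Uo fC; apply: (big_ind (Ck_on k U)) => //; first exact: Ck_on_cst.
by move=> g h; exact: Ck_on_add.
Qed.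

Lemma smooth_on_linear V W W' (U : set V) (f : V -> W) (l : W -> W') : open U ->
  (forall c u v, l (c *: u + v) = c *: l u + l v) -> continuous l ->
  smooth_on U f -> smooth_on U (fun x => l (f x)).
Proof.
move=> Uo lP lc fS k.
pose lin := GRing.isLinear.Build _ _ _ _ l lP.
pose L : {linear W -> W'} := HB.pack l lin.
exact: (Ck_on_linear (L := L)).
Qed.

Lemma smooth_scalel V W (U : set V) (f : V -> R) (w : W) : open U ->
  smooth_on U f -> smooth_on U (fun x => f x *: w).
Proof.
move=> Uo fS; apply: (@smooth_on_linear V R W U f (fun r => r *: w)) => // [c u v|].
  by rewrite scalerDl scalerA.
exact: scalel_continuous.
Qed.

Lemma smooth_row V m (U : set V) (f : V -> 'rV[R]_m) : open U ->
  (forall j, smooth_on U (fun x => f x 0 j)) -> smooth_on U f.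
Proof.
move=> Uo fS k.
have -> : f = \sum_j (fun x => f x 0 j *: (delta_mx 0 j : 'rV[R]_m)).
  by apply/funext => x; rewrite fct_sumE [LHS]row_sum_delta.
by apply: Ck_on_sum => // j; exact: smooth_scalel.
Qed.

Lemma smooth_coord V m (U : set V) (f : V -> 'rV[R]_m) j : open U ->
  smooth_on U f -> smooth_on U (fun x => f x 0 j).
Proof.
move=> Uo; apply: (smooth_on_linear (l := fun u : 'rV[R]_m => u 0 j)) => // [c u v|].
  by rewrite !mxE.
exact: coord_continuous.
Qed.

Lemma smooth_pair V W W' (U : set V) (f : V -> W) (g : V -> W') : open U ->
  smooth_on U f -> smooth_on U g -> smooth_on U (fun x => (f x, g x)).
Proof.
move=> Uo fS gS k.
have -> : (fun x => (f x, g x)) = (fun x => (f x, 0)) + (fun x => (0, g x)).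
  by apply/funext => x; rewrite -[RHS]/(_ + _, _ + _) addr0 add0r.
apply: Ck_on_add => //; move: k.
  apply: (smooth_on_linear (l := fun u : W => (u, 0 : W'))) => // [c u v|u].
    by rewrite -[RHS]/(_ + _, _ + _) /= scaler0 addr0.
  by apply: cvg_pair; [exact: cvg_id|exact: cvg_cst].
apply: (smooth_on_linear (l := fun u : W' => (0 : W, u))) => // [c u v|u].
  by rewrite -[RHS]/(_ + _, _ + _) /= scaler0 addr0.
by apply: cvg_pair; [exact: cvg_cst|exact: cvg_id].
Qed.

Lemma smooth_fst V W W' (U : set V) (f : V -> (W * W')%type) : open U ->
  smooth_on U f -> smooth_on U (fun x => (f x).1).
Proof.
move=> Uo; apply: (smooth_on_linear (l := fst)) => //.
by move=> u; exact: cvg_fst.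
Qed.

Lemma smooth_snd V W W' (U : set V) (f : V -> (W * W')%type) : open U ->
  smooth_on U f -> smooth_on U (fun x => (f x).2).
Proof.
move=> Uo; apply: (smooth_on_linear (l := snd)) => //.
by move=> u; exact: cvg_snd.
Qed.

Lemma smooth_id V (U : set V) : smooth_on U (fun x : V => x).
Proof.
case=> [|k]; first by move=> x _; exact: cvg_id.
split=> [x _|v]; first by have [] := is_diff_id x.
have -> : 'D_v (fun x : V => x) = (fun _ : V => v).
  by apply/funext => x; exact: derive_id.
exact: Ck_on_cst.
Qed.
End VectorValued.

(** * Charts on subsets of the triple system *)

Section Charts.
Variable R : realType.
Local Notation n := (\dim {:H3 R}).
Local Notation RV := ('rV[R]_n * 'rV[R]_n)%type.
Implicit Types (M : set (H3 R)) (p : H3 R).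

Lemma realify_smooth (V : normedModType R) (U : set V) (F : V -> H3 R) : open U ->
  hfun (smooth_on U) F -> smooth_on U (fun x => realify (F x)).
Proof.
move=> Uo FS; apply: smooth_pair => //; apply: smooth_row => // j.
  by apply: fun_alg_ext (FS j).1 => x; rewrite mxE.
by apply: fun_alg_ext (FS j).2 => x; rewrite mxE.
Qed.

Lemma smooth_unrealify (V : normedModType R) (U : set V) (c : V -> RV) : open U ->
  smooth_on U c -> hfun (smooth_on U) (fun x => unrealify (c x)).
Proof.
move=> Uo cS i; split.
  apply: (@fun_alg_ext _ _ (smooth_on U) (fun x => (c x).1 0 i)) => [x|].
    by rewrite hcoord_unrealify.
  exact: smooth_coord (smooth_fst _ cS).
apply: (@fun_alg_ext _ _ (smooth_on U) (fun x => (c x).2 0 i)) => [x|].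
  by rewrite hcoord_unrealify.
exact: smooth_coord (smooth_snd _ cS).
Qed.

(** Polynomials in the real coordinates enjoy this property; it provides continuity and smoothness
    at the same time, and it is visibly stable under linear substitutions. *)
Definition polynomial_fun (phi : H3 R -> R) : Prop :=
  forall (X : Type) (P : (X -> R) -> Prop), fun_alg P ->
    forall F, hfun P F -> P (fun x => phi (F x)).

(** [smooth_on] is about normed spaces over R; on the complex space [H3 R] smoothness is tested by
    composition with smooth maps. *)
Definition smooth_fun (W : set (H3 R)) (h : H3 R -> R) : Prop :=
  forall (V : normedModType R) (U : set V) (F : V -> H3 R), open U ->
    hfun (smooth_on U) F -> (forall x, U x -> W (F x)) -> smooth_on U (fun x => h (F x)).

Lemma continuous_unrealify : hfun (fun f : RV -> R => continuous f) (@unrealify R).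
Proof.
have S := smooth_unrealify openT (@smooth_id R RV setT).
move=> i; split=> p; [exact: ((S i).1 0%N p I) | exact: ((S i).2 0%N p I)].
Qed.

(* Charts near [p], with inverse [h] defined where three polynomial functions are
   positive; such domains and their smooth functions are stable under linear
   changes of variables. *)
Definition chart (d : nat) M p : Prop :=
  exists (f1 f2 f3 : H3 R -> R) (U : set 'rV[R]_d) (g : 'rV[R]_d -> H3 R)
         (h : H3 R -> 'rV[R]_d),
    let W := [set x | [/\ 0 < f1 x, 0 < f2 x & 0 < f3 x]] in
    [/\ [/\ polynomial_fun f1, polynomial_fun f2 & polynomial_fun f3], W p,
        open U /\ hfun (smooth_on U) g,
        forall j, smooth_fun W (fun x => h x 0 j) &
        (forall u, U u -> [/\ M (g u), W (g u) & h (g u) = u]) /\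
        (forall x, M x -> W x -> U (h x) /\ g (h x) = x)].

Lemma chart_linear d M p (k l : H3 R -> H3 R) :
  (forall c u v, k (c *: u + v) = c *: k u + k v) ->
  (forall c u v, l (c *: u + v) = c *: l u + l v) ->
  cancel k l -> cancel l k -> (forall x, M x -> M (k x)) -> (forall x, M x -> M (l x)) ->
  chart d M p -> chart d M (k p).
Proof.
move=> kP lP kl lk Mk Ml [f1 [f2 [f3 [U [g [h [[f1P f2P f3P] Wp [Uo gS] hS [gU hM]]]]]]]].
exists (f1 \o l), (f2 \o l), (f3 \o l), U, (k \o g), (h \o l).
split=> /=.
- by split=> X P PA F FP; [apply: f1P|apply: f2P|apply: f3P] => //; exact: hfun_linear FP.
- by rewrite !kl.
- by split=> //; exact: (hfun_linear (smooth_fun_alg Uo) kP gS).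
- move=> j V U' F U'o FS FW; apply: (hS j V U' (l \o F) U'o) => //.
  exact: (hfun_linear (smooth_fun_alg U'o) lP FS).
- split=> [u /gU[Mg Wg hg]|x Mx Wx]; first by rewrite !kl; split=> //; exact: Mk.
  by have [Uh gh] := hM _ (Ml _ Mx) Wx; rewrite gh lk.
Qed.

Lemma chart_aut d M p k : aut k -> (forall k x, aut k -> M x -> M (k x)) ->
  chart d M p -> chart d M (k p).
Proof.
move=> kA Mk; have [l [lA kl lk]] := aut_inverse kA.
apply: (@chart_linear d M p k l) => //.
- exact: aut_linear.
- exact: aut_linear.
- by move=> x; exact: Mk.
- by move=> x; exact: Mk.
Qed.

Lemma chart_submanifold d M : M !=set0 -> (forall p, M p -> chart d M p) ->
  real_submanifold d M.
Proof.
move=> [p0 Mp0] Mc; split=> [|_ [p Mp <-]]; first by exists (realify p0), p0.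
have [f1 [f2 [f3 [U [g [h [[f1P f2P f3P] Wp [Uo gS] hS [gU hM]]]]]]]] := Mc p Mp.
pose W := [set x : RV | [/\ 0 < f1 (unrealify x), 0 < f2 (unrealify x)
  & 0 < f3 (unrealify x)]].
have Wo : open W.
  have -> : W = [set x | 0 < f1 (unrealify x)] `&` [set x | 0 < f2 (unrealify x)]
      `&` [set x | 0 < f3 (unrealify x)].
    by apply/seteqP; split=> x [] => [//|[]].
  have pos (f : H3 R -> R) : polynomial_fun f -> open [set x | 0 < f (unrealify x)].
    move=> /(_ _ _ (@continuous_fun_alg R RV) _ continuous_unrealify) fc.
    apply: (@open_comp _ _ (fun x => f (unrealify x)) [set r | 0 < r]); last exact: open_gt.
    by move=> x _; exact: fc.
  by do 2?apply: openI; exact: pos.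
exists W, U, (fun u => realify (g u)), (fun x => h (unrealify x)); split=> //.
- by split=> //; rewrite /W /= realifyK.
- exact: realify_smooth.
- apply: smooth_row => // j; apply: (hS j) => //.
  exact: smooth_unrealify (@smooth_id R RV W).
split=> [|u /gU[_ _ hg]]; last by rewrite realifyK.
apply/seteqP; split=> [_ [u /gU[Mg Wg hg] <-]|_ [[x Mx <-] Wx]].
  by split; [exists (g u) | rewrite /W /= realifyK].
move: Wx; rewrite /W /= realifyK => Wx; have [Uh gh] := hM x Mx Wx.
by exists (h x); rewrite ?gh.
Qed.
End Charts.

(** * Minimal tripotents *)

Section RankOneChart.
Variable R : realType.
Local Notation C := R[i].
Local Notation rV8 := 'rV[R]_(1 + 7).
Implicit Types (a b c : oct C) (e u v : H3 R).

Lemma smooth_cinv (V : normedModType R) (U : set V) (f : V -> C) : open U ->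
  cfun (smooth_on U) f -> (forall x, U x -> f x != 0) ->
  cfun (smooth_on U) (fun x => (f x)^-1).
Proof.
move=> Uo [f1 f2] f0; have PA := smooth_fun_alg Uo.
have NS := fun_alg_add PA (fun_alg_mul PA f1 f1) (fun_alg_mul PA f2 f2).
have N0 x : U x -> complex.Re (f x) * complex.Re (f x)
    + complex.Im (f x) * complex.Im (f x) != 0.
  move=> /f0; case: (f x) => r s /=; apply: contraNN => rs0.
  have [r0 s0] : r = 0 /\ s = 0 by move/eqP: rs0; split; nra.
  by rewrite r0 s0.
have NI := smooth_inv Uo NS N0.
split; [have := fun_alg_mul PA f1 NI|have := fun_alg_mul PA (fun_alg_opp PA f2) NI];
  apply: fun_alg_ext => x; case: (f x) => r s /=; rewrite -!expr2 //.
by rewrite mulNr.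
Qed.

Definition cplx (r s : rV8) : oct C := \row_j (r 0 j +i* s 0 j)%C.

Lemma cplxK a : cplx (map_mx (@complex.Re R) a) (map_mx (@complex.Im R) a) = a.
Proof. by apply/rowP => j; rewrite !mxE; case: (a 0 j). Qed.

Lemma Re_cplx r s : map_mx (@complex.Re R) (cplx r s) = r.
Proof. by apply/rowP => j; rewrite !mxE. Qed.

Lemma Im_cplx r s : map_mx (@complex.Im R) (cplx r s) = s.
Proof. by apply/rowP => j; rewrite !mxE. Qed.

Definition rank1 b c : H3 R := h3 1 (onorm c) (onorm b) (ocj (omul b c)) b c.

Lemma adj_rank1 b c : adj (rank1 b c) = 0.
Proof.
rewrite /rank1 adj_h3 onorm_conj onorm_mul !mulr1 !mul1r !scale1r (mulrC (onorm c)) !subrr.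
rewrite !ocjM !ocjK (omulK_conj b c) (ocj_mulK b c) !subrr.
by rewrite -h3_zero.
Qed.

(** Among the equations [adj u = 0] are x1 x2 = n(a3), x3 x1 = n(a2) and (a2 a3)~ = x1 a1. When x1
    is invertible they determine u from x1, a2 and a3. *)
Lemma rank1_eq u : adj u = 0 -> diag u ord0 != 0 ->
  u = diag u ord0 *: rank1 ((diag u ord0)^-1 *: off u (inord 1))
                           ((diag u ord0)^-1 *: off u (inord 2)).
Proof.
case: (h3P u) => x1 x2 x3 a1 a2 a3; rewrite !diag_h3 !off_h3 /= !inordK //= adj_h3 h3_zero.
move=> /h3_inj[[_ e2 e3] [e1 _ _]] x0.
rewrite /rank1 h3_scale; congr (h3 _ _ _ _ _ _).
- by rewrite mulr1.
- rewrite onormZ; move/eqP: e3; rewrite subr_eq0 => /eqP <-.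
  by field.
- rewrite onormZ; move/eqP: e2; rewrite subr_eq0 => /eqP <-.
  by field.
- move/eqP: e1; rewrite subr_eq0 omulZl omulZr !ocjZ => /eqP ->.
  by rewrite !scalerA mulrCA mulfV // mulr1 mulVf // scale1r.
- by rewrite scalerA mulfV // scale1r.
- by rewrite scalerA mulfV // scale1r.
Qed.

Lemma hm_rank1_gt0 b c : 0 < complex.Re (hm (rank1 b c) (rank1 b c)).
Proof.
have d1 : diag (rank1 b c) ord0 = 1 by rewrite /rank1 diag_h3.
have := diag_le_hm (rank1 b c) ord0; rewrite d1 mul1r (rmorph1 conjc) lecE => /andP[_].
exact: lt_le_trans ltr01.
Qed.

(** The 33 real coordinates: one for the phase, and 16 for each of the complex octonions b and c. *)
Definition rank1_row (t : R) b c : 'rV[R]_(1 + ((1 + 7 + (1 + 7)) + (1 + 7 + (1 + 7)))) :=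
  row_mx t%:M (row_mx
    (row_mx (map_mx (@complex.Re R) b) (map_mx (@complex.Im R) b))
    (row_mx (map_mx (@complex.Re R) c) (map_mx (@complex.Im R) c))).

Definition rank1_coord u :=
  rank1_row (complex.Im (diag u ord0) / complex.Re (diag u ord0))
    ((diag u ord0)^-1 *: off u (inord 1)) ((diag u ord0)^-1 *: off u (inord 2)).

Section Param.
Variable p : 'rV[R]_(1 + ((1 + 7 + (1 + 7)) + (1 + 7 + (1 + 7)))).
Definition rank1_t : R := lsubmx p 0 0.
Definition rank1_b : oct C := cplx (lsubmx (lsubmx (rsubmx p))) (rsubmx (lsubmx (rsubmx p))).
Definition rank1_c : oct C := cplx (lsubmx (rsubmx (rsubmx p))) (rsubmx (rsubmx (rsubmx p))).
(** The phase is (1 + i t) / sqrt (1 + t^2), where t is the tangent of the argument of the first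
    diagonal entry. The chart thus covers the points where that entry has positive real part, and
    this real part equals [rank1_scale]. *)
Definition rank1_scale : R := (Num.sqrt ((1 + rank1_t * rank1_t)
  * complex.Re (hm (rank1 rank1_b rank1_c) (rank1 rank1_b rank1_c))))^-1.
Definition rank1_param : H3 R :=
  (rank1_scale%:C%C * (1 +i* rank1_t)%C) *: rank1 rank1_b rank1_c.

Lemma rank1_rowK : rank1_row rank1_t rank1_b rank1_c = p.
Proof.
by rewrite /rank1_row !Re_cplx !Im_cplx !hsubmxK /rank1_t -mx11_scalar hsubmxK.
Qed.

Lemma rank1_scale_gt0 : 0 < rank1_scale.
Proof.
rewrite invr_gt0 sqrtr_gt0 mulr_gt0 ?hm_rank1_gt0 //.
by have := sqr_ge0 rank1_t; rewrite expr2; lra.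
Qed.

Lemma diag_rank1_param :
  diag rank1_param ord0 = rank1_scale%:C%C * (1 +i* rank1_t)%C.
Proof. by rewrite /rank1_param /rank1 h3_scale diag_h3 /= mulr1. Qed.

Lemma Re_diag_rank1_param : complex.Re (diag rank1_param ord0) = rank1_scale.
Proof. by rewrite diag_rank1_param /= mul0r subr0 mulr1. Qed.

Lemma minimal_rank1_param : minimal_tripotent rank1_param.
Proof.
apply/minimal_adjP; rewrite adjZ adj_rank1 scaler0; split=> //.
rewrite hmZl hmZr mulrA -(RRe_real (ger0_real (hm_ge0 (rank1 rank1_b rank1_c)))).
have s0 := rank1_scale_gt0.
have N0 := hm_rank1_gt0 rank1_b rank1_c.
have : rank1_scale * rank1_scale * ((1 + rank1_t * rank1_t)
    * complex.Re (hm (rank1 rank1_b rank1_c) (rank1 rank1_b rank1_c))) = 1.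
  have T0 : 0 <= (1 + rank1_t * rank1_t)
    * complex.Re (hm (rank1 rank1_b rank1_c) (rank1 rank1_b rank1_c)).
    by rewrite mulr_ge0 ?(ltW N0) //; have := sqr_ge0 rank1_t; rewrite expr2; lra.
  rewrite -{1}(sqr_sqrtr T0) /rank1_scale expr2 mulrACA mulVf ?mulr1 //.
  by have := rank1_scale_gt0; rewrite invr_gt0 => /lt0r_neq0.
move: rank1_scale s0 (complex.Re _) N0 => s s0 N N0 E.
have {}E : (s * s * ((1 + rank1_t * rank1_t) * N))%:C%C = 1%:C%C by rewrite E.
rewrite -[RHS]E; apply/eqP; rewrite eq_complex /=; apply/andP; split; apply/eqP; ring.
Qed.

Lemma rank1_paramK : rank1_coord rank1_param = p.
Proof.
have d0 : diag rank1_param ord0 != 0.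
  apply/eqP => d0; have := rank1_scale_gt0; rewrite -Re_diag_rank1_param d0.
  by rewrite ltxx.
rewrite /rank1_coord Re_diag_rank1_param -[RHS]rank1_rowK.
have -> : off rank1_param (inord 1) = diag rank1_param ord0 *: rank1_b.
  by rewrite diag_rank1_param /rank1_param /rank1 h3_scale off_h3 /= inordK.
have -> : off rank1_param (inord 2) = diag rank1_param ord0 *: rank1_c.
  by rewrite diag_rank1_param /rank1_param /rank1 h3_scale off_h3 /= inordK.
rewrite !scalerA mulVf // !scale1r; congr rank1_row.
rewrite diag_rank1_param /= mulr1 addr0 mulrAC mulfV ?mul1r //.
by rewrite gt_eqF ?rank1_scale_gt0.
Qed.
End Param.

Lemma rank1_t_row t b c : rank1_t (rank1_row t b c) = t.
Proof. by rewrite /rank1_t row_mxKl mxE eqxx. Qed.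

Lemma rank1_b_row t b c : rank1_b (rank1_row t b c) = b.
Proof. by rewrite /rank1_b !(row_mxKl, row_mxKr) cplxK. Qed.

Lemma rank1_c_row t b c : rank1_c (rank1_row t b c) = c.
Proof. by rewrite /rank1_c !(row_mxKl, row_mxKr) cplxK. Qed.

Lemma rank1_coordK u : minimal_tripotent u -> 0 < complex.Re (diag u ord0) ->
  rank1_param (rank1_coord u) = u.
Proof.
move=> /minimal_adjP[u0 u1] d0.
have d1 : diag u ord0 != 0 by apply/eqP => h; move: d0; rewrite h ltxx.
have uE := rank1_eq u0 d1.
rewrite /rank1_param /rank1_scale /rank1_coord rank1_t_row rank1_b_row rank1_c_row.
move: uE u1; set b := _^-1 *: _; set c := _^-1 *: _; move: (rank1 b c) => w uE u1.
rewrite [RHS]uE; congr (_ *: _).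
have hN := RRe_real (ger0_real (hm_ge0 w)).
have E : complex.Re (diag u ord0 * conjc (diag u ord0) * hm w w) = 1.
  have <- : hm u u = diag u ord0 * conjc (diag u ord0) * hm w w.
    by rewrite {1 2}uE hmZl hmZr mulrA.
  by rewrite u1.
move: (complex.Re (hm w w)) hN E => N <- E.
move: d0 E {d1 uE u1 b c}; case: (diag u ord0) => r s /= r0 E.
have {}E : (r * r + s * s) * N = 1 by rewrite -E; ring.
have r1 : r != 0 by rewrite gt_eqF.
(* Since |r + i s|^2 N = 1, the radicand of [rank1_scale] is r^-2; as r > 0, the scale is r
   itself. *)
have -> : (1 + s / r * (s / r)) * N = (r^-1) ^+ 2.
  transitivity ((r * r + s * s) * N * (r^-1) ^+ 2); last by rewrite E mul1r.
  by field.
rewrite sqrtr_sqr ger0_norm ?invr_ge0 ?(ltW r0) // invrK.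
by apply/eqP; rewrite eq_complex /=; apply/andP; split; apply/eqP; field.
Qed.

Section RowCoordinates.
Variables (X : Type) (P : (X -> R) -> Prop) (PA : fun_alg P).

Lemma row_mx_fun m n (f : X -> 'rV[R]_m) (g : X -> 'rV[R]_n) :
  (forall j, P (fun x => f x 0 j)) -> (forall j, P (fun x => g x 0 j)) ->
  forall j, P (fun x => row_mx (f x) (g x) 0 j).
Proof.
move=> fP gP j; case: (splitP j) => k jk.
  by apply: fun_alg_ext (fP k) => x; rewrite -(row_mxEl _ (g x)); congr (_ _ _); exact/val_inj.
by apply: fun_alg_ext (gP k) => x; rewrite -(row_mxEr (f x)); congr (_ _ _); exact/val_inj.
Qed.

Lemma rank1_row_fun (t : X -> R) (b c : X -> oct C) : P t ->
  (forall j, cfun P (fun x => b x 0 j)) -> (forall j, cfun P (fun x => c x 0 j)) ->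
  forall j, P (fun x => rank1_row (t x) (b x) (c x) 0 j).
Proof.
move=> tP bP cP; apply: row_mx_fun => [j|].
  by apply: fun_alg_ext tP => x; rewrite [j]ord1 mxE eqxx.
by apply: row_mx_fun; apply: row_mx_fun => j;
  [apply: fun_alg_ext (bP j).1|apply: fun_alg_ext (bP j).2
  |apply: fun_alg_ext (cP j).1|apply: fun_alg_ext (cP j).2] => x; rewrite mxE.
Qed.

Lemma oct_norm_fun (b : X -> oct C) :
  (forall j, cfun P (fun x => b x 0 j)) -> cfun P (fun x => onorm (b x)).
Proof.
move=> bP.
apply: cfun_ext (cfun_sum PA (fun j => cfun_mul PA (bP j) (bP j))) => x.
by rewrite onormE /oct_norm; apply: eq_bigr => j _; rewrite expr2.
Qed.

(* The product of b and c is, up to sign, the first octonion of the adjugate of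
   the element with off-diagonal entries 0, b and c. *)
Lemma oct_mul_fun (b c : X -> oct C) j :
  (forall j, cfun P (fun x => b x 0 j)) -> (forall j, cfun P (fun x => c x 0 j)) ->
  cfun P (fun x => ocj (omul (b x) (c x)) 0 j).
Proof.
move=> bP cP; have z0 := cfun_cst PA 0.
have H : hfun P (fun x => h3 0 0 0 0 (b x) (c x)).
  apply: hfun_h3 => // k.
  by apply: cfun_ext z0 => x; rewrite mxE.
apply: cfun_ext (cfun_off PA (inord 0) j (hfun_adj PA H)) => x.
by rewrite adj_h3 off_h3 inordK //= scaler0 subr0.
Qed.

Lemma rank1_fun (b c : X -> oct C) :
  (forall j, cfun P (fun x => b x 0 j)) -> (forall j, cfun P (fun x => c x 0 j)) ->
  hfun P (fun x => rank1 (b x) (c x)).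
Proof.
move=> bP cP; apply: hfun_h3 => //.
- exact: cfun_cst.
- exact: oct_norm_fun.
- exact: oct_norm_fun.
- by move=> j; exact: oct_mul_fun.
Qed.
End RowCoordinates.

Lemma rank1_param_smooth (V : normedModType R) (U : set V) p : open U ->
  smooth_on U p -> hfun (smooth_on U) (fun x => rank1_param (p x)).
Proof.
move=> Uo pS; have PA := smooth_fun_alg Uo; have pj j := smooth_coord j Uo pS.
have tS : smooth_on U (fun x => rank1_t (p x)).
  by apply: fun_alg_ext (pj (lshift _ 0)) => x; rewrite /rank1_t mxE.
have bS j : cfun (smooth_on U) (fun x => rank1_b (p x) 0 j).
  split.
    apply: fun_alg_ext (pj (rshift _ (lshift _ (lshift _ j)))) => x.
    by rewrite /rank1_b /cplx !mxE.
  apply: fun_alg_ext (pj (rshift _ (lshift _ (rshift _ j)))) => x.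
  by rewrite /rank1_b /cplx !mxE.
have cS j : cfun (smooth_on U) (fun x => rank1_c (p x) 0 j).
  split.
    apply: fun_alg_ext (pj (rshift _ (rshift _ (lshift _ j)))) => x.
    by rewrite /rank1_c /cplx !mxE.
  apply: fun_alg_ext (pj (rshift _ (rshift _ (rshift _ j)))) => x.
  by rewrite /rank1_c /cplx !mxE.
have wS := rank1_fun PA bS cS.
have t2 := fun_alg_add PA (fun_alg_cst PA 1) (fun_alg_mul PA tS tS).
have qS := fun_alg_mul PA t2 (cfun_hm PA wS wS).1.
have sS : smooth_on U (fun x => rank1_scale (p x)).
  apply: (smooth_inv Uo (smooth_sqrt Uo qS _)) => x _ /=;
    have := rank1_scale_gt0 (p x); rewrite invr_gt0.
    by rewrite sqrtr_gt0.
  by move/lt0r_neq0.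
apply: (hfun_scale PA _ wS); apply: (cfun_mul PA (cfun_real PA sS)).
by split=> //=; exact: fun_alg_cst.
Qed.

Lemma rank1_coord_smooth (V : normedModType R) (U : set V) (F : V -> H3 R) j : open U ->
  hfun (smooth_on U) F -> (forall x, U x -> 0 < complex.Re (diag (F x) ord0)) ->
  smooth_on U (fun x => rank1_coord (F x) 0 j).
Proof.
move=> Uo FS F0; have PA := smooth_fun_alg Uo.
have dS := cfun_diag PA ord0 FS.
have dI : cfun (smooth_on U) (fun x => (diag (F x) ord0)^-1).
  apply: smooth_cinv => // x Ux; apply/eqP => h; have := F0 _ Ux.
  by rewrite h ltxx.
apply: rank1_row_fun => // [|k|k].
- apply: (fun_alg_mul PA dS.2); apply: smooth_inv => // [|x Ux]; first exact: dS.1.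
  by rewrite gt_eqF ?F0.
- by apply: cfun_ext (cfun_mul PA dI (cfun_off PA (inord 1) k FS)) => x; rewrite !mxE.
- by apply: cfun_ext (cfun_mul PA dI (cfun_off PA (inord 2) k FS)) => x; rewrite !mxE.
Qed.

Lemma polynomial_cst (r : R) : polynomial_fun (fun _ => r).
Proof. by move=> X P PA F FP; exact: fun_alg_cst. Qed.

Lemma polynomial_diag i : polynomial_fun (fun u : H3 R => complex.Re (diag u i)).
Proof. by move=> X P PA F FP; exact: (cfun_diag PA i FP).1. Qed.

Definition minimal_set : set (H3 R) := [set e | minimal_tripotent e].

Lemma aut_minimal k e : aut k -> minimal_set e -> minimal_set (k e).
Proof.
move=> kA /minimal_tripotentP[eT e1]; apply/minimal_tripotentP.
by rewrite (aut_hm kA); split=> //; exact/(aut_tripotent _ kA).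
Qed.

Lemma minimal_dg1 : minimal_set (dg 1 0 0).
Proof.
apply/minimal_tripotentP; split; first exact: (tripotent_dg01 R true false false).
exact: hm_dg1.
Qed.

Lemma minimal_chart0 : chart 33 minimal_set (dg 1 0 0).
Proof.
exists (fun u => complex.Re (diag u ord0)), (fun _ => 1), (fun _ => 1), setT,
  rank1_param, rank1_coord => W; split.
- by split; [exact: polynomial_diag|exact: polynomial_cst|exact: polynomial_cst].
- by rewrite /W /= /dg diag_h3; split.
- split; first exact: openT.
  by apply: (rank1_param_smooth openT); exact: smooth_id.
- by move=> j V U F Uo FS FW; apply: rank1_coord_smooth => // x /FW[].
split=> [u _|x Mx [x0 _ _]]; last by split=> //; exact: rank1_coordK.
split; [exact: minimal_rank1_param| |exact: rank1_paramK].
by rewrite /W /= Re_diag_rank1_param rank1_scale_gt0.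
Qed.

Lemma minimal_submanifold : real_submanifold 33 minimal_set.
Proof.
apply: chart_submanifold => [|e /minimal_tripotentP[eT e1]].
  by exists (dg 1 0 0); exact: minimal_dg1.
have /conjugate_sym[k [kA <-]] := tripotent_hm1 eT e1.
by apply: chart_aut minimal_chart0 => // l x lA; exact: aut_minimal.
Qed.
End RankOneChart.

(** * Maximal tripotents *)

Section Inverse.
Variable R : realType.
Local Notation C := R[i].
Implicit Types (c s t x y z : C) (e u v w : H3 R).

Definition one : H3 R := dg 1 1 1.
Definition trace u : C := bform u one.

Lemma bformDl u v w : bform (u + v) w = bform u w + bform v w.
Proof. by rewrite !bformE hmDl. Qed.

Lemma bformZl c u w : bform (c *: u) w = c * bform u w.
Proof. by rewrite !bformE hmZl. Qed.

Lemma bformDr u v w : bform w (u + v) = bform w u + bform w v.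
Proof. by rewrite !(bformC w) bformDl. Qed.

Lemma bformZr c u w : bform w (c *: u) = c * bform w u.
Proof. by rewrite !(bformC w) bformZl. Qed.

Lemma traceZ c u : trace (c *: u) = c * trace u.
Proof. exact: bformZl. Qed.

Lemma cj_one : cj one = one.
Proof. by rewrite /one /dg cj_h3 bar0 (rmorph1 conjc). Qed.

Lemma trace_cj u : trace (cj u) = conjc (trace u).
Proof. by rewrite /trace -{1}cj_one bform_cj. Qed.

Lemma adj_one : adj one = one.
Proof. by rewrite /one adj_dg mulr1. Qed.

Lemma hdet_one : hdet one = 1.
Proof. by rewrite /one hdet_dg !mulr1. Qed.

Lemma cross_one u : cross u one = trace u *: one - u.
Proof.
case: (h3P u) => x1 x2 x3 a1 a2 a3.
rewrite /trace /one /dg cross_h3 bform_h3 h3_scale h3_opp h3_add.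
rewrite !(omulr0, omul0r, addr0, add0r, ocj0, oform0r, scaler0, subr0, sub0r, scale1r, mul1r, mulr1).
by rewrite !oppr0 !add0r; congr (h3 _ _ _ _ _ _); ring.
Qed.

Lemma bform_adjxx u : bform (adj u) u = 3%:R * hdet u.
Proof. by rewrite hdetE mulrA mulfV ?mul1r // pnatr_eq0. Qed.

Lemma hdetD u v :
  hdet (u + v) = hdet u + bform (adj u) v + bform u (adj v) + hdet v.
Proof.
apply: (mulfI (x := 3%:R)); first by rewrite pnatr_eq0.
rewrite -bform_adjxx adjD !(bformDl, bformDr) !bform_adjxx.
rewrite [bform (cross u v) u]bformC -bform_cross crossxx bformZl.
rewrite [bform (cross u v) v]bform_cross crossxx bformZr (bformC (adj v)).
by move: (bform _ _) (bform _ _) => p q; ring.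
Qed.

Lemma hdetZ c u : hdet (c *: u) = c ^+ 3 * hdet u.
Proof. by rewrite !hdetE adjZ bformZl bformZr; ring. Qed.

Lemma hdet_cj u : hdet (cj u) = conjc (hdet u).
Proof.
have c3 : conjc 3%:R^-1 = 3%:R^-1 :> C by rewrite conjc_inv conjc_nat.
by rewrite !hdetE adj_cj bform_cj conjcM c3.
Qed.

Lemma adj_one_add s u : adj (s *: one + u) =
  (s ^+ 2 + s * trace u) *: one - s *: u + adj u.
Proof.
rewrite adjD adjZ adj_one crossZl crossC cross_one scalerBr scalerA.
by rewrite scalerDl addrA.
Qed.

Lemma hdet_one_add s u : hdet (s *: one + u) =
  s ^+ 3 + s ^+ 2 * trace u + s * trace (adj u) + hdet u.
Proof.
rewrite hdetD hdetZ hdet_one mulr1 adjZ adj_one !bformZl.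
by rewrite /trace (bformC one u) (bformC one (adj u)).
Qed.

(** Two applications of [adj] commute with automorphisms, because the conjugations cancel, and
    [hdet] is invariant. The identity is therefore a computation on diagonal elements. *)
Lemma adj_adj u : adj (adj u) = hdet u *: u.
Proof.
have [k [kA [x1 [x2 [x3]]]]] := diagonalize u; rewrite -/(dg _ _ _) => ku.
apply: (aut_inj kA); rewrite (autZ kA).
have <- : adj (adj (k u)) = k (adj (adj u)).
  by rewrite (aut_adj kA) adj_cj (aut_adj kA) adj_cj !cjK.
rewrite -(aut_hdet kA) ku !adj_dg hdet_dg dg_scale; congr (dg _ _ _); ring.
Qed.

Lemma hdet_adj u : hdet (adj u) = hdet u ^+ 2.
Proof.
apply: (mulfI (x := 3%:R)); first by rewrite pnatr_eq0.
by rewrite -bform_adjxx adj_adj bformZl (bformC u) bform_adjxx; ring.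
Qed.

Definition hinv u : H3 R := (hdet u)^-1 *: adj u.

Lemma hdet_hinv u : hdet u != 0 -> hdet (hinv u) = (hdet u)^-1.
Proof. by move=> u0; rewrite /hinv hdetZ hdet_adj; field. Qed.

Lemma hinvK u : hdet u != 0 -> hinv (hinv u) = u.
Proof.
move=> u0; rewrite {1}/hinv hdet_hinv // invrK /hinv adjZ adj_adj !scalerA.
have -> : hdet u * ((hdet u)^-1 ^+ 2 * hdet u) = 1 by field.
by rewrite scale1r.
Qed.

Lemma hinvZ c u : c != 0 -> hdet u != 0 -> hinv (c *: u) = c^-1 *: hinv u.
Proof.
move=> c0 u0; rewrite /hinv hdetZ adjZ !scalerA; congr (_ *: _); field.
by rewrite c0 u0.
Qed.

Lemma adj_hinv u : hdet u != 0 -> adj (hinv u) = (hdet u)^-1 *: u.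
Proof.
by move=> u0; rewrite /hinv adjZ adj_adj scalerA; congr (_ *: _); field.
Qed.

(** The right-hand side says that [hinv e] is [cj e] and that the determinant is a phase: maximal
    tripotents are the unitary elements. This form suits the Cayley transform. *)
Lemma maximal_adjP e : maximal_tripotent e <->
  adj e = hdet e *: cj e /\ hdet e * conjc (hdet e) = 1.
Proof.
split=> [/maximal_tripotentP[eT e3]|[ea ed]].
  have [z [zz [k [kA ke]]]] := tripotent_hm3 eT e3.
  have dz : hdet e = z by rewrite -(aut_hdet kA) ke hdet_dg !mul1r.
  rewrite dz; split=> //; rewrite -[LHS]cjK -[RHS]cjK; congr cj; apply: (aut_inj kA).
  rewrite cjZ cjK (autZ kA) ke -[LHS]cjK -(aut_adj kA) ke adj_dg.
  rewrite dg_scale /dg cj_h3 bar0 !mul1r !mulr1 (rmorph1 conjc).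
  by congr (h3 _ _ _ _ _ _); rewrite mulrC zz.
have d0 : hdet e != 0 by apply/eqP => h; move: ed; rewrite h mul0r => /eqP; rewrite eq_sym oner_eq0.
have e3 : hm e e = 3%:R.
  apply: (mulfI d0); rewrite [RHS]mulrC -bform_adjxx ea bformZl (bformC (cj e)).
  by rewrite bformE cjK.
apply/maximal_detP; split=> //; first by rewrite sqr_normc.
by rewrite ea hmZl hmZr mulrA ed mul1r hm_cj e3 conjc_nat.
Qed.

(** Since 2 - b is the conjugate of b, the element is formally (conj b) b^-1, a unitary one of
    determinant conj D / D. Both sides of [maximal_adjP] are expanded in [one], [adj b] and b. *)
Lemma cayley_maximal b : b + cj b = 2%:R *: one -> hdet b != 0 ->
  maximal_tripotent (2%:R *: hinv b - one).
Proof.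
move=> b2 D0; have cb : cj b = 2%:R *: one + (-1) *: b.
  by rewrite -b2 scaleN1r addrC addKr.
set D := hdet b in D0 *.
(* The determinant of 2 - b expanded by [hdet_one_add]; the comparisons of coefficients below rest
   on this relation between D and the two traces. *)
have cD : conjc D = 8%:R - 4%:R * trace b + 2%:R * trace (adj b) - D.
  rewrite -hdet_cj cb hdet_one_add traceZ adjZ traceZ hdetZ.
  by rewrite /D; ring.
have cD0 : conjc D != 0 by rewrite conjc_eq0.
have eE : 2%:R *: hinv b - one = (-1) *: one + 2%:R *: hinv b by rewrite scaleN1r addrC.
have de : hdet (2%:R *: hinv b - one) = conjc D / D.
  rewrite eE hdet_one_add traceZ adjZ traceZ hdetZ hdet_hinv // adj_hinv // traceZ.
  rewrite /hinv traceZ cD -/D; field.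
  exact: D0.
apply/maximal_adjP; rewrite de; split; last first.
  by rewrite conjcM conjc_inv conjcK; field; rewrite D0 cD0.
have wE : 2%:R *: hinv b = (2%:R / D) *: adj b by rewrite /hinv scalerA.
have -> : adj (2%:R *: hinv b - one) =
    (1 - 2%:R / D * trace (adj b)) *: one + (2%:R / D) *: adj b + (4%:R / D) *: b.
  rewrite eE adj_one_add wE traceZ adjZ adj_adj scalerA -/D scaleN1r opprK sqrrN expr1n mulN1r.
  by congr (_ + _ *: _); field.
have -> : cj (2%:R *: hinv b - one) = (2%:R / conjc D * (4%:R - 2%:R * trace b) - 1) *: one
    + (2%:R / conjc D) *: adj b + (4%:R / conjc D) *: b.
  rewrite cjB cj_one cjZ conjc_nat /hinv cjZ conjc_inv -/D -adj_cj cb adj_one_add.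
  rewrite traceZ adjZ; apply: hm_inj => w; rewrite !(hmDl, hmZl, hmNl).
  by move: (hm _ _) (hm _ _) (hm _ _) => p q r; field.
have -> : 1 - 2%:R / D * trace (adj b)
    = conjc D / D * (2%:R / conjc D * (4%:R - 2%:R * trace b) - 1).
  transitivity ((D - 2%:R * trace (adj b)) / D); first by field.
  transitivity ((2%:R * (4%:R - 2%:R * trace b) - conjc D) / D); last first.
    by field; rewrite D0 cD0.
  by congr (_ / _); rewrite cD; ring.
apply: hm_inj => w; rewrite (hmZl (conjc D / D)).
rewrite (hmDl _ (_ *: b)) (hmDl (_ *: one)) (hmDl _ (_ *: b)) (hmDl (_ *: one)) !hmZl.
move: (hm one w) (hm (adj b) w) (hm b w) => p q r.
by field; rewrite D0 cD0.
Qed.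

(** For unitary e the conjugate of (e + 1)^-1 is (e^-1 + 1)^-1 = e (e + 1)^-1, and the two add up to
    1. *)
Lemma inverse_cayley e : maximal_tripotent e -> hdet (e + one) != 0 ->
  2%:R *: hinv (e + one) + cj (2%:R *: hinv (e + one)) = 2%:R *: one.
Proof.
move=> /maximal_adjP[ea ed] a0; set d := hdet e in ea ed.
have aE : e + one = 1 *: one + e by rewrite scale1r addrC.
have daE : hdet (e + one) = 1 + trace e + d * conjc (trace e) + d.
  by rewrite aE hdet_one_add ea traceZ trace_cj -/d; ring.
have aaE : adj (e + one) = (1 + trace e) *: one - e + d *: cj e.
  by rewrite aE adj_one_add ea expr1n mul1r scale1r.
have caE : d *: cj (adj (e + one)) = (d + d * conjc (trace e)) *: one - d *: cj e + e.
  rewrite aaE cjD cjB !cjZ cj_one cjK conjcD (rmorph1 conjc) scalerDr scalerBr !scalerA.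
  by rewrite ed scale1r mulrDr mulr1.
(* The counterpart of det(e) det(e^-1 + 1) = det(1 + e), with [cj e] as the inverse of e. *)
have cda : d * conjc (hdet (e + one)) = hdet (e + one).
  rewrite daE !conjcD conjcM conjcK (rmorph1 conjc).
  transitivity (d + d * conjc (trace e) + (d * conjc d) * trace e + d * conjc d).
    by ring.
  by rewrite ed; ring.
have d0 : d != 0.
  by apply/eqP => h; move: ed; rewrite h mul0r => /eqP; rewrite eq_sym oner_eq0.
have ca0 : conjc (hdet (e + one)) != 0 by rewrite conjc_eq0.
have -> : cj (2%:R *: hinv (e + one)) =
    (2%:R / hdet (e + one)) *: (d *: cj (adj (e + one))).
  rewrite cjZ conjc_nat /hinv cjZ conjc_inv !scalerA; congr (_ *: _).
  rewrite -[in RHS]cda; move: (conjc _) ca0 => z z0; field.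
  by rewrite d0 z0.
rewrite /hinv scalerA caE aaE; apply: hm_inj => w; rewrite !(hmDl, hmZl, hmNl).
move: (hm one w) (hm e w) (hm (cj e) w) => p q r.
transitivity (2%:R / hdet (e + one) * (1 + trace e + d * conjc (trace e) + d) * p); first by ring.
by rewrite -daE; field.
Qed.
End Inverse.

(** * The Cayley chart of the maximal tripotents *)

Section CayleyChart.
Variable R : realType.
Local Notation C := R[i].
Implicit Types (e u v w : H3 R) (p : 'rV[R]_(3 + 3 * (1 + 7))).

Definition complexify p : H3 R :=
  (map_mx (real_complex R) (lsubmx p), map_mx (real_complex R) (vec_mx (rsubmx p))).

Definition re_row u : 'rV[R]_(3 + 3 * (1 + 7)) :=
  row_mx (map_mx (@complex.Re R) u.1) (mxvec (map_mx (@complex.Re R) u.2)).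

Lemma complexifyK p : re_row (complexify p) = p.
Proof.
rewrite /re_row /= -[RHS]hsubmxK -[rsubmx p in RHS]vec_mxK.
by congr (row_mx _ (mxvec _)); apply/matrixP => i j; rewrite !mxE.
Qed.

Lemma cjE u : cj u = (map_mx conjc u.1, map_mx conjc u.2).
Proof. by rewrite cj.unlock. Qed.

Lemma cj_complexify p : cj (complexify p) = complexify p.
Proof.
by rewrite cjE; congr pair; apply/matrixP => i j; rewrite !mxE conjc_real.
Qed.

Lemma re_rowK u : cj u = u -> complexify (re_row u) = u.
Proof.
rewrite cjE => uu; rewrite -[RHS]uu /complexify row_mxKl row_mxKr mxvecK.
have E (x : C) : conjc x = x -> (complex.Re x)%:C%C = conjc x.
  case: x => a b [b0]; have -> : b = 0 by lra.
  by rewrite /= oppr0.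
have [u1 u2] : map_mx conjc u.1 = u.1 /\ map_mx conjc u.2 = u.2 by case: (u) uu => u1 u2 [].
congr pair; apply/matrixP => i j; rewrite !mxE; apply: E.
  by rewrite -{2}u1 mxE.
by rewrite -{2}u2 mxE.
Qed.

Lemma complexify_fun (V : normedModType R) (U : set V) (p : V -> 'rV[R]_(3 + 3 * (1 + 7))) :
  open U -> smooth_on U p -> hfun (smooth_on U) (fun x => complexify (p x)).
Proof.
move=> Uo pS; have PA := smooth_fun_alg Uo; have pj j := smooth_coord j Uo pS.
apply: hfun_ext (hfun_mk_H3 PA (f := fun i x => (complexify (p x)).1 0 i)
  (g := fun i x => row i (complexify (p x)).2) _ _) => [x|i|i j].
- by rewrite -[RHS]mk_H3K; congr pair; apply/matrixP => i j; rewrite !mxE.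
- apply: cfun_ext (cfun_real PA (pj (lshift _ i))) => x.
  by rewrite /complexify !mxE.
- apply: cfun_ext (cfun_real PA (pj (rshift _ (mxvec_index i j)))) => x.
  by rewrite /complexify !mxE.
Qed.

Lemma re_row_fun (X : Type) (P : (X -> R) -> Prop) (F : X -> H3 R) : fun_alg P ->
  hfun P F -> forall j, P (fun x => re_row (F x) 0 j).
Proof.
move=> PA FP; apply: row_mx_fun => j.
  by apply: fun_alg_ext (cfun_diag PA j FP).1 => x; rewrite /diag mxE.
case/mxvec_indexP: j => i k.
by apply: fun_alg_ext (cfun_off PA i k FP).1 => x; rewrite mxvecE /off !mxE.
Qed.

Lemma hinv_fun (V : normedModType R) (U : set V) (F : V -> H3 R) : open U ->
  hfun (smooth_on U) F -> (forall x, U x -> hdet (F x) != 0) ->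
  hfun (smooth_on U) (fun x => hinv (F x)).
Proof.
move=> Uo FS F0; have PA := smooth_fun_alg Uo.
exact: (hfun_scale PA (smooth_cinv Uo (cfun_hdet PA FS) F0) (hfun_adj PA FS)).
Qed.

Definition maximal_set : set (H3 R) := [set e | maximal_tripotent e].

(* [complexify p] is a real element x: the denominator is 1 - i x. *)
Definition cayley_den p : H3 R := one R - 'i%C *: complexify p.
Definition cayley p : H3 R := 2%:R *: hinv (cayley_den p) - one R.
(** Solves 2 (u + 1)^-1 = 1 - i x for the real element x, which has 3 + 24 real coordinates. *)
Definition cayley_coord u :=
  re_row ('i%C *: (2%:R *: hinv (u + one R) - one R)).

Lemma ii : 'i%C * 'i%C = -1 :> C.
Proof. by rewrite -expr2 sqr_i. Qed.

Lemma cayley_den_real p : cayley_den p + cj (cayley_den p) = 2%:R *: one R.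
Proof.
have ci : conjc 'i%C = - 'i%C :> C by apply/eqP; rewrite eq_complex /= oppr0 !eqxx.
rewrite /cayley_den cjB cj_one cjZ cj_complexify ci scaleNr opprK.
by rewrite addrACA addNr addr0 scaler_nat.
Qed.

Lemma cayleyD1 p : cayley p + one R = 2%:R *: hinv (cayley_den p).
Proof. by rewrite /cayley subrK. Qed.

Lemma two_neq0 : 2%:R != 0 :> C. Proof. by rewrite pnatr_eq0. Qed.

Lemma hdet_cayleyD1 p : hdet (cayley_den p) != 0 -> hdet (cayley p + one R) != 0.
Proof.
by move=> b0; rewrite cayleyD1 hdetZ hdet_hinv // mulf_neq0 ?invr_eq0 // expf_neq0 ?two_neq0.
Qed.

Lemma cayley_denK p : hdet (cayley_den p) != 0 ->
  2%:R *: hinv (cayley p + one R) = cayley_den p.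
Proof.
move=> b0; rewrite cayleyD1 hinvZ ?two_neq0 // ?hinvK ?scalerA ?mulfV ?two_neq0 ?scale1r //.
by rewrite hdet_hinv // invr_eq0.
Qed.

Lemma cayleyK p : hdet (cayley_den p) != 0 -> cayley_coord (cayley p) = p.
Proof.
move=> b0; rewrite /cayley_coord cayley_denK // /cayley_den addrC addKr scalerN scalerA.
by rewrite ii scaleN1r opprK complexifyK.
Qed.

Lemma cayley_den_coord e : maximal_tripotent e -> hdet (e + one R) != 0 ->
  cayley_den (cayley_coord e) = 2%:R *: hinv (e + one R).
Proof.
move=> eM a0; have H := inverse_cayley eM a0.
have ci : conjc 'i%C = - 'i%C :> C by apply/eqP; rewrite eq_complex /= oppr0 !eqxx.
have cB : cj (2%:R *: hinv (e + one R)) = 2%:R *: one R - 2%:R *: hinv (e + one R).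
  by rewrite -H addrAC subrr add0r.
move: cB {H}; rewrite /cayley_den /cayley_coord; move: (_ *: hinv _) => B cB.
rewrite re_rowK; first by rewrite scalerA ii scaleN1r opprK addrC subrK.
rewrite cjZ cjB cj_one ci cB; apply: hm_inj => w; rewrite !(hmZl, hmDl, hmNl).
by ring.
Qed.

Lemma hdet_cayley_den_coord e : maximal_tripotent e -> hdet (e + one R) != 0 ->
  hdet (cayley_den (cayley_coord e)) != 0.
Proof.
by move=> eM a0; rewrite cayley_den_coord // hdetZ hdet_hinv // mulf_neq0 ?invr_eq0 // expf_neq0 ?two_neq0.
Qed.

Lemma cayley_coordK e : maximal_tripotent e -> hdet (e + one R) != 0 ->
  cayley (cayley_coord e) = e.
Proof.
move=> eM a0; rewrite /cayley cayley_den_coord // hinvZ ?two_neq0 // ?hinvK //; last first.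
  by rewrite hdet_hinv // invr_eq0.
by rewrite scalerA mulfV ?two_neq0 // scale1r addrK.
Qed.

(** [chart] describes domains by positive polynomials, so a determinant is required to be nonzero
    through its squared modulus. *)
Lemma sqr_norm_gt0 (z : C) : (0 < complex.Re (z * conjc z)) = (z != 0).
Proof.
have := mulcJ_ge0 z; rewrite lecE => /andP[/eqP im re]; rewrite lt_def re andbT.
have -> : (complex.Re (z * conjc z) == 0) = (z * conjc z == 0).
  by rewrite [RHS]eq_complex im /= eqxx andbT.
by rewrite mulf_eq0 conjc_eq0 orbb.
Qed.

Lemma cayley_den_smooth (V : normedModType R) (U : set V)
    (p : V -> 'rV[R]_(3 + 3 * (1 + 7))) : open U -> smooth_on U p ->
  hfun (smooth_on U) (fun x => cayley_den (p x)).
Proof.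
move=> Uo pS; have PA := smooth_fun_alg Uo.
rewrite /cayley_den; apply: hfun_add => //; first exact: hfun_cst.
apply: hfun_opp => //; apply: hfun_scale => //; first exact: cfun_cst.
exact: complexify_fun.
Qed.

Lemma maximal_chart0 : chart 27 maximal_set (one R).
Proof.
pose f u : R := complex.Re (hdet (u + one R) * conjc (hdet (u + one R))).
have fP : polynomial_fun f.
  move=> X P PA F FP; have dP := cfun_hdet PA (hfun_add PA FP (hfun_cst PA (one R))).
  exact: (cfun_mul PA dP (cfun_conj PA dP)).1.
pose U : set 'rV[R]_27 := [set p | 0 < complex.Re (hdet (cayley_den p)
  * conjc (hdet (cayley_den p)))].
have Uo : open U.
  have dS := cfun_hdet (smooth_fun_alg openT) (cayley_den_smooth openT (@smooth_id R _ setT)).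
  have := (cfun_mul (smooth_fun_alg openT) dS (cfun_conj (smooth_fun_alg openT) dS)).1.
  move=> /(_ 0%N) fc.
  apply: (@open_comp _ _ (fun p : 'rV[R]_27 => complex.Re (hdet (cayley_den p)
    * conjc (hdet (cayley_den p)))) [set r | 0 < r]); last exact: open_gt.
  by move=> x _; exact: fc.
exists f, (fun _ => 1), (fun _ => 1), U, cayley, cayley_coord => W; split.
- by split => //; exact: polynomial_cst.
- rewrite /W /=; split=> //; rewrite /f sqr_norm_gt0 -[one R + _]/(one R + one R).
  have -> : one R + one R = 2%:R *: one R by rewrite scaler_nat mulr2n.
  by rewrite hdetZ hdet_one mulr1 expf_neq0 ?two_neq0.
- split=> //; have PA := smooth_fun_alg Uo.
  apply: hfun_add => //; last by apply: hfun_opp => //; exact: hfun_cst.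
  apply: hfun_scale => //; first exact: cfun_cst.
  apply: hinv_fun => //; first by apply: cayley_den_smooth => //; exact: smooth_id.
  by move=> p; rewrite /U /= sqr_norm_gt0.
- move=> j V U' F U'o FS FW; have PA := smooth_fun_alg U'o.
  apply: (re_row_fun PA); apply: hfun_scale => //; first exact: cfun_cst.
  apply: hfun_add => //; last by apply: hfun_opp => //; exact: hfun_cst.
  apply: hfun_scale => //; first exact: cfun_cst.
  apply: hinv_fun => //; first by apply: hfun_add => //; exact: hfun_cst.
  by move=> x /FW[]; rewrite /f sqr_norm_gt0.
split=> [p|e eM []]; rewrite /U /= /f sqr_norm_gt0 => p0.
  split; last exact: cayleyK.
    exact: cayley_maximal (cayley_den_real p) p0.
  by rewrite /W /=; split=> //; rewrite /f sqr_norm_gt0 hdet_cayleyD1.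
move=> _ _; rewrite sqr_norm_gt0; split; last exact: cayley_coordK.
exact: hdet_cayley_den_coord.
Qed.

Lemma aut_maximal k e : aut k -> maximal_set e -> maximal_set (k e).
Proof.
move=> kA /maximal_tripotentP[eT e1]; apply/maximal_tripotentP.
by rewrite (aut_hm kA); split=> //; exact/(aut_tripotent _ kA).
Qed.

Lemma scale_maximal c e : c * conjc c = 1 -> maximal_set e -> maximal_set (c *: e).
Proof.
move=> cc /maximal_tripotentP[/tripotentE eT e1]; apply/maximal_tripotentP.
split; last by rewrite hmZl hmZr mulrA cc mul1r.
apply/tripotentE; rewrite tpZl tpZm tpZr eT !scalerA.
by congr (_ *: _); rewrite cc !mul1r mulrC.
Qed.

Lemma unit_cubic_root (z : C) : z * conjc z = 1 ->
  exists2 c, c ^+ 3 = z & c * conjc c = 1.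
Proof.
move=> zz; pose c : C := 3.-root z; have c3 : c ^+ 3 = z by exact: rootCK.
exists c => //; have c0 : 0 <= c * conjc c by exact: mulcJ_ge0.
have : (c * conjc c) ^+ 3 = 1 by rewrite exprMn -(rmorphXn conjc) c3 zz.
by move/eqP; rewrite pexpr_eq1 // => /eqP.
Qed.

(** Automorphisms preserve the determinant and cannot move every maximal tripotent to [one].
    Multiplication by the conjugate of a cube root of the phase z first makes the determinant 1. *)
Lemma maximal_one e : maximal_set e ->
  exists c, c * conjc c = 1 /\ conjugate (one R) (c *: e).
Proof.
move=> /maximal_tripotentP[eT e3]; have [z [zz ez]] := tripotent_hm3 eT e3.
have [d dz dd] := unit_cubic_root zz.
have cc : conjc d * conjc (conjc d) = 1 by rewrite conjcK mulrC.
exists (conjc d); split=> //.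
have : conjugate (conjc d *: e) (one R).
  apply: conjugate_trans (_ : conjugate _ (conjc d *: dg 1 1 z)) _.
    by have [k [kA <-]] := ez; exists k; rewrite (autZ kA).
  rewrite dg_scale !mulr1.
  have := conjugate_dg3 (conjc d * z) cc cc.
  have -> : conjc d * conjc d * (conjc d * z) = 1 => //.
  rewrite -dz; transitivity ((d * conjc d) ^+ 3); first by ring.
  by rewrite dd expr1n.
exact: conjugate_sym.
Qed.

Lemma maximal_submanifold : real_submanifold 27 maximal_set.
Proof.
apply: chart_submanifold => [|e eM].
  exists (one R); apply/maximal_tripotentP; split.
    exact: (tripotent_dg01 R true true true).
  by apply: hm_dg11; rewrite (rmorph1 conjc) mulr1.
have [c [cc [k [kA kc]]]] := maximal_one eM.
have -> : e = conjc c *: (k (one R)).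
  by rewrite kc scalerA mulrC cc scale1r.
have cc' : conjc c * conjc (conjc c) = 1 by rewrite conjcK mulrC.
apply: (@chart_linear R 27 maximal_set (k (one R)) (fun u => conjc c *: u) (fun u => c *: u)).
- by move=> d u v; rewrite scalerDr !scalerA mulrC.
- by move=> d u v; rewrite scalerDr !scalerA mulrC.
- by move=> u; rewrite scalerA cc scale1r.
- by move=> u; rewrite scalerA mulrC cc scale1r.
- by move=> u; exact: scale_maximal.
- by move=> u; exact: scale_maximal.
exact: (chart_aut kA (fun l x lA => @aut_maximal l x lA) maximal_chart0).
Qed.
End CayleyChart.

(** * Tripotents of rank two *)

Section RankTwoRealForm.
Variable R : realType.
Local Notation C := R[i].
Local Notation rV10 := 'rV[R]_(1 + (1 + (1 + 7))).
Implicit Types (e f u v w : H3 R) (r s : rV10).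

(* A conjugation of the Peirce space V_0(f): the rank 2 tripotents e with
   e# = cj f form a sphere in its space of fixed points. *)
Definition peirceJ f u : H3 R := cj (cross f u).
(** On V_0(f) this averages u with its conjugate. The square of [peirceJ f] stands for u in the
    average, because it is the projection onto V_0(f) when f is minimal. *)
Definition real_proj f u : H3 R := 2%:R^-1 *: (peirceJ f (peirceJ f u) + peirceJ f u).

Lemma peirceJ_linear f (c : R) u v :
  peirceJ f (c%:C%C *: u + v) = c%:C%C *: peirceJ f u + peirceJ f v.
Proof. by rewrite /peirceJ cross_linearr cj_lin conjc_real. Qed.

Lemma real_proj_linear f (c : R) u v :
  real_proj f (c%:C%C *: u + v) = c%:C%C *: real_proj f u + real_proj f v.
Proof.
rewrite /real_proj !peirceJ_linear; apply: hm_inj => w.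
by rewrite !(hmZl, hmDl); ring.
Qed.

Lemma aut_peirceJ k f u : aut k -> peirceJ (k f) (k u) = k (peirceJ f u).
Proof. by move=> kA; rewrite /peirceJ (aut_cross kA) cjK. Qed.

Lemma aut_real_proj k f u : aut k -> real_proj (k f) (k u) = k (real_proj f u).
Proof. by move=> kA; rewrite /real_proj !aut_peirceJ // -(autD kA) -(autZ kA). Qed.

Lemma bar_bar (a : oct C) : map_mx conjc (map_mx conjc a) = a.
Proof. by apply/rowP => j; rewrite !mxE conjcK. Qed.

Lemma barN (a : oct C) : map_mx conjc (- a) = - map_mx conjc a.
Proof. by apply/rowP => j; rewrite !mxE rmorphN. Qed.

Lemma peirceJ_dg1 z1 z2 z3 a1 a2 a3 : peirceJ (dg 1 0 0) (h3 z1 z2 z3 a1 a2 a3) =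
  h3 0 (conjc z3) (conjc z2) (- map_mx conjc a1) 0 0.
Proof.
rewrite /peirceJ /dg cross_h3 !(omulr0, omul0r, addr0, add0r, ocj0, oform0r, oform0l, mul0r,
  mulr0, mul1r, mulr1, scaler0, scale0r, scale1r, subr0, sub0r, oppr0).
by rewrite cj_h3 bar0 (rmorph0 conjc) barN.
Qed.

(* Real coordinates of the fixed points of [peirceJ (dg 1 0 0)]. *)
Definition beta r : H3 R :=
  let x := (lsubmx r 0 0 +i* lsubmx (rsubmx r) 0 0)%C in
  h3 0 x (conjc x) ('i%C *: map_mx (real_complex R) (rsubmx (rsubmx r))) 0 0.

Definition gamma u : rV10 :=
  row_mx ((complex.Re (diag u (inord 1)) + complex.Re (diag u (inord 2))) / 2%:R)%:M
   (row_mx ((complex.Im (diag u (inord 1)) - complex.Im (diag u (inord 2))) / 2%:R)%:M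
     (map_mx (@complex.Im R) (off u ord0))).

Lemma betaK r : gamma (beta r) = r.
Proof.
rewrite /gamma /beta !diag_h3 off_h3 !inordK //= -[RHS]hsubmxK -[rsubmx r in RHS]hsubmxK.
congr row_mx; last congr row_mx.
- by rewrite [RHS]mx11_scalar; congr _%:M; field.
- by rewrite [RHS]mx11_scalar; congr _%:M; field.
by apply/rowP => j; rewrite !mxE /= mulr0 mul1r add0r.
Qed.

Lemma gammaK u : beta (gamma u) = real_proj (dg 1 0 0) u.
Proof.
case: (h3P u) => z1 z2 z3 a1 a2 a3.
rewrite /real_proj !peirceJ_dg1 !h3_add h3_scale !addr0 !mulr0 !scaler0 !conjcK.
rewrite /beta /gamma !diag_h3 !off_h3 !inordK //= !row_mxKr !row_mxKl !mxE eqxx !mulr1n.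
congr (h3 _ _ _ _ _ _).
- by case: z2 z3 => [x y] [x' y']; apply/eqP; rewrite eq_complex /=;
    apply/andP; split; apply/eqP; field.
- by case: z2 z3 => [x y] [x' y']; apply/eqP; rewrite eq_complex /=;
    apply/andP; split; apply/eqP; field.
apply/rowP => j; rewrite !mxE; case: (a1 0 j) => x y.
by apply/eqP; rewrite eq_complex /=; apply/andP; split; apply/eqP; field.
Qed.

Lemma gamma_linear (c : R) u v : gamma (c%:C%C *: u + v) = c *: gamma u + gamma v.
Proof.
have rE (x y : C) : complex.Re (c%:C%C * x + y) = c * complex.Re x + complex.Re y.
  by case: x y => x x' [y y'] /=; ring.
have iE (x y : C) : complex.Im (c%:C%C * x + y) = c * complex.Im x + complex.Im y.
  by case: x y => x x' [y y'] /=; ring.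
rewrite /gamma !diagP offP !rE !iE !scale_row_mx !add_row_mx; congr row_mx; last congr row_mx.
- by apply/rowP => j; rewrite !mxE !ord1 eqxx !mulr1n; field.
- by apply/rowP => j; rewrite !mxE !ord1 eqxx !mulr1n; field.
by apply/rowP => j; rewrite !mxE iE.
Qed.

Lemma beta_linear (c : R) r s : beta (c *: r + s) = c%:C%C *: beta r + beta s.
Proof.
rewrite /beta h3_lin !mulr0 !scaler0 !addr0; congr (h3 _ _ _ _ _ _).
- by rewrite !mxE; apply/eqP; rewrite eq_complex /=; apply/andP; split; apply/eqP; ring.
- by rewrite !mxE; apply/eqP; rewrite eq_complex /=; apply/andP; split; apply/eqP; ring.
apply/rowP => j; rewrite !mxE.
by apply/eqP; rewrite eq_complex /=; apply/andP; split; apply/eqP; ring.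
Qed.

Lemma peirceJ3_minimal f u : minimal_tripotent f ->
  peirceJ f (peirceJ f (peirceJ f u)) = peirceJ f u.
Proof.
move=> /minimal_tripotentP[fT f1].
have /conjugate_sym[k [kA <-]] := tripotent_hm1 fT f1.
have [l [_ _ lk]] := aut_inverse kA; rewrite -(lk u) !aut_peirceJ //; congr k.
case: (h3P (l u)) => z1 z2 z3 a1 a2 a3; rewrite !peirceJ_dg1 !conjcK.
by rewrite !barN !bar_bar !opprK.
Qed.

Lemma real_proj_fixed f u : minimal_tripotent f -> peirceJ f (real_proj f u) = real_proj f u.
Proof.
move=> fM; have J3 := peirceJ3_minimal u fM.
have h2 : 2%:R^-1 = (2%:R^-1)%:C%C :> C by rewrite rmorphV ?rmorph_nat // unitfE pnatr_eq0.
have J0 : peirceJ f 0 = 0 :> H3 R by rewrite /peirceJ cross0r cj0.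
have JD v w : peirceJ f (v + w) = peirceJ f v + peirceJ f w.
  by have := peirceJ_linear f 1 v w; rewrite !scale1r.
have JZ v : peirceJ f (2%:R^-1 *: v) = 2%:R^-1 *: peirceJ f v.
  by have := peirceJ_linear f 2%:R^-1 v 0; rewrite J0 !addr0 -h2.
by rewrite /real_proj JZ JD J3 addrC.
Qed.

Lemma real_proj_id f u : peirceJ f u = u -> real_proj f u = u.
Proof.
move=> Ju; rewrite /real_proj !Ju -[u in u + u]scale1r -scalerDl scalerA.
by rewrite mulVf ?scale1r // pnatr_eq0.
Qed.

Lemma beta_fixed u : peirceJ (dg 1 0 0) u = u -> beta (gamma u) = u.
Proof. by move=> Ju; rewrite gammaK real_proj_id. Qed.

(** On the real form, [adj] is half the squared norm times a fixed vector. The fiber over [dg 1 0 0]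
    is therefore the sphere of squared norm 2. *)
Lemma adj_beta r : adj (beta r) = (2%:R^-1 * hm (beta r) (beta r)) *: dg 1 0 0.
Proof.
rewrite dg_scale !mulr0 /beta /dg adj_h3 hm_h3 bar_scale bar0.
set a := map_mx (real_complex R) _; set x : C := Complex _ _.
have ar : map_mx conjc a = a by apply/rowP => j; rewrite !mxE conjc_real.
have ci : conjc 'i%C = - 'i%C :> C by apply/eqP; rewrite eq_complex /= oppr0 !eqxx.
rewrite ar ci onormZ sqr_i scaleNr oformC oformNl oformZl oformC oformZl oformxx conjcK.
rewrite !(omulr0, omul0r, ocj0, onorm0, oform0l, mul0r, mulr0, add0r, addr0, subr0, scaler0,
  scale0r, subrr, rmorph0).
congr (h3 _ _ _ _ _ _); rewrite ?oppr0 // mulN1r opprK.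
transitivity (2%:R^-1 * (2%:R * (x * conjc x) - 2%:R * ('i%C * 'i%C) * onorm a)); last by ring.
by rewrite -expr2 sqr_i; field.
Qed.

Lemma adj_fixed f u : minimal_tripotent f -> peirceJ f u = u -> hm u u = 2%:R ->
  adj u = cj f.
Proof.
move=> /minimal_tripotentP[fT f1].
have /conjugate_sym[k [kA <-]] := tripotent_hm1 fT f1.
have [l [_ _ lk]] := aut_inverse kA; rewrite -(lk u) aut_peirceJ // => /(aut_inj kA) Ju.
rewrite (aut_hm kA) (aut_adj kA) => u2; congr cj; congr k.
move: u2; rewrite -(beta_fixed Ju) adj_beta => ->.
rewrite mulVf ?pnatr_eq0 // scale1r /dg cj_h3 bar0 (rmorph0 conjc) (rmorph1 conjc).
by [].
Qed.

Lemma hdet_fixed f u : minimal_tripotent f -> peirceJ f u = u -> hm u u = 2%:R ->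
  hdet u = 0.
Proof.
move=> /minimal_tripotentP[fT f1].
have /conjugate_sym[k [kA <-]] := tripotent_hm1 fT f1.
have [l [_ _ lk]] := aut_inverse kA; rewrite -(lk u) aut_peirceJ // => /(aut_inj kA) Ju _.
rewrite (aut_hdet kA) hdetE -(beta_fixed Ju) adj_beta bformZl.
rewrite /beta /dg bform_h3 !oform0l !(mul0r, mulr0, addr0).
by [].
Qed.

Lemma rank2_fixed f u : minimal_tripotent f -> peirceJ f u = u -> hm u u = 2%:R ->
  has_rank 2 u.
Proof.
move=> fM Ju u2; apply/rank2_detP; split=> //; first exact: hdet_fixed Ju u2.
rewrite (adj_fixed fM Ju u2) hm_cj; have [_ ->] := (minimal_tripotentP f).1 fM.
by rewrite (rmorph1 conjc).
Qed.

Lemma fixed_rank2 e : has_rank 2 e ->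
  minimal_tripotent (cj (adj e)) /\ peirceJ (cj (adj e)) e = e.
Proof.
move=> /rank2_tripotentP[eT e2]; have /conjugate_sym[k [kA <-]] := tripotent_hm2 eT e2.
have aE : cj (adj (dg 0 1 1)) = dg 1 0 0 :> H3 R.
  by rewrite adj_dg /dg cj_h3 bar0 !mul0r !mulr0 mulr1 (rmorph0 conjc) (rmorph1 conjc).
have -> : cj (adj (k (dg 0 1 1))) = k (dg 1 0 0) by rewrite (aut_adj kA) cjK aE.
split; first by apply: aut_minimal kA _; exact: minimal_dg1.
rewrite aut_peirceJ // {2}/dg peirceJ_dg1 bar0 oppr0 (rmorph1 conjc).
by [].
Qed.

(** Projects the fixed frame [beta] to the fixed points of [peirceJ f] and reads the result by
    [gamma]. It is the identity at [dg 1 0 0]; where it is invertible, [gamma] is injective on those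
    fixed points. *)
Definition gram f : 'M[R]_(1 + (1 + (1 + 7))) :=
  \matrix_(i, j) gamma (real_proj f (beta (delta_mx 0 i))) 0 j.

Lemma row_linear_comb (h : rV10 -> rV10) :
  (forall (c : R) r s, h (c *: r + s) = c *: h r + h s) ->
  forall r, r *m (\matrix_(i, j) h (delta_mx 0 i) 0 j) = h r.
Proof.
move=> hP r.
pose lin := GRing.isLinear.Build _ _ _ _ h hP.
pose H : {linear rV10 -> rV10} := HB.pack h lin.
rewrite -[RHS]/(H r) -[RHS]mul_rV_lin1; congr (_ *m _).
by apply/matrixP => i j; rewrite !mxE.
Qed.

Lemma gramE f r : r *m gram f = gamma (real_proj f (beta r)).
Proof.
rewrite (@row_linear_comb (fun r => gamma (real_proj f (beta r)))) // => c r' s.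
by rewrite beta_linear real_proj_linear gamma_linear.
Qed.

(* The Gram matrix of f = k e_1 factors through the matrix of [gamma] on the fixed
   points of the conjugation of f. *)
Lemma gamma_inj f u : minimal_tripotent f -> \det (gram f) != 0 ->
  peirceJ f u = u -> gamma u = 0 -> u = 0.
Proof.
move=> /minimal_tripotentP[fT f1].
have /conjugate_sym[k [kA <-]] := tripotent_hm1 fT f1.
have [l [lA kl lk]] := aut_inverse kA => d0.
rewrite -(lk u) aut_peirceJ // => /(aut_inj kA) Ju.
have kL (c : R) v w : k (c%:C%C *: v + w) = c%:C%C *: k v + k w by exact: aut_linear.
have lL (c : R) v w : l (c%:C%C *: v + w) = c%:C%C *: l v + l w by exact: (aut_linear lA).
pose N : 'M[R]_(1 + (1 + (1 + 7))) := \matrix_(i, j) gamma (k (beta (delta_mx 0 i))) 0 j.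
have NE r : r *m N = gamma (k (beta r)).
  apply: (row_linear_comb (h := fun r => gamma (k (beta r)))) => c r' s.
  by rewrite beta_linear kL gamma_linear.
pose N' : 'M[R]_(1 + (1 + (1 + 7))) := \matrix_(i, j) gamma (l (beta (delta_mx 0 i))) 0 j.
have N'E r : r *m N' = gamma (l (beta r)).
  apply: (row_linear_comb (h := fun r => gamma (l (beta r)))) => c r' s.
  by rewrite beta_linear lL gamma_linear.
have gE : gram (k (dg 1 0 0)) = N' *m N.
  apply/row_matrixP => i; rewrite !rowE gramE mulmxA N'E NE gammaK.
  by rewrite -{1}(lk (beta _)) aut_real_proj.
have N0 : N \in unitmx.
  by rewrite unitmxE unitfE; move: d0; rewrite gE det_mulmx mulf_eq0 negb_or => /andP[].
rewrite -(beta_fixed Ju) -NE => /(congr1 (mulmx^~ (invmx N))).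
rewrite mulmxK // mul0mx => ->.
have -> : beta 0 = 0.
  by have := beta_linear (-1) 0 0; rewrite scaler0 addr0 rmorphN1 scaleN1r addNr.
exact: aut0.
Qed.
End RankTwoRealForm.

(** * The chart of the rank two tripotents *)

Section RankTwoChart.
Variable R : realType.
Local Notation C := R[i].
Local Notation n33 := (1 + ((1 + 7 + (1 + 7)) + (1 + 7 + (1 + 7))))%N.
Local Notation rV10 := 'rV[R]_(1 + (1 + (1 + 7))).
Implicit Types (e f v w : H3 R) (r s : rV10) (u : 'rV[R]_(n33 + (1 + (1 + 7)))).

Section Functions.
Variables (X : Type) (P : (X -> R) -> Prop) (PA : fun_alg P).

Lemma fun_alg_sum (I : Type) (l : seq I) (Q : pred I) (F : I -> X -> R) :
  (forall i, P (F i)) -> P (fun x => \sum_(i <- l | Q i) F i x).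
Proof.
move=> FP; elim: l => [|i l IH].
  by apply: fun_alg_ext (fun_alg_cst PA 0) => x; rewrite big_nil.
have [Qi|Qi] := boolP (Q i).
  by apply: fun_alg_ext (fun_alg_add PA (FP i) IH) => x; rewrite big_cons Qi.
by apply: fun_alg_ext IH => x; rewrite big_cons (negbTE Qi).
Qed.

Lemma fun_alg_prod (I : Type) (l : seq I) (Q : pred I) (F : I -> X -> R) :
  (forall i, P (F i)) -> P (fun x => \prod_(i <- l | Q i) F i x).
Proof.
move=> FP; elim: l => [|i l IH].
  by apply: fun_alg_ext (fun_alg_cst PA 1) => x; rewrite big_nil.
have [Qi|Qi] := boolP (Q i).
  by apply: fun_alg_ext (fun_alg_mul PA (FP i) IH) => x; rewrite big_cons Qi.
by apply: fun_alg_ext IH => x; rewrite big_cons (negbTE Qi).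
Qed.

Lemma det_fun m (A : X -> 'M[R]_m) :
  (forall i j, P (fun x => A x i j)) -> P (fun x => \det (A x)).
Proof.
move=> AP; apply: fun_alg_sum => s; apply: fun_alg_mul => //; first exact: fun_alg_cst.
by apply: fun_alg_prod => i.
Qed.

Lemma adjugate_fun m (A : X -> 'M[R]_m) i j :
  (forall i j, P (fun x => A x i j)) -> P (fun x => (\adj (A x)) i j).
Proof.
move=> AP.
suff : P (fun x => cofactor (A x) j i) by apply: fun_alg_ext => x; rewrite mxE.
apply: fun_alg_mul => //; first exact: fun_alg_cst.
apply: det_fun => k l.
by apply: fun_alg_ext (AP (lift j k) (lift i l)) => x; rewrite !mxE.
Qed.

Lemma mulmx_fun m m' (r : X -> 'rV[R]_m) (A : X -> 'M[R]_(m, m')) j :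
  (forall i, P (fun x => r x 0 i)) -> (forall i j, P (fun x => A x i j)) ->
  P (fun x => (r x *m A x) 0 j).
Proof.
move=> rP AP; apply: (@fun_alg_ext _ _ P (fun x => \sum_i r x 0 i * A x i j)) => [x|].
  by rewrite mxE.
by apply: fun_alg_sum => i; exact: fun_alg_mul.
Qed.

Lemma gamma_fun (F : X -> H3 R) j : hfun P F -> P (fun x => gamma (F x) 0 j).
Proof.
move=> FP; have d1 := cfun_diag PA (inord 1) FP; have d2 := cfun_diag PA (inord 2) FP.
move: j; apply: row_mx_fun => [j|].
  apply: fun_alg_ext (fun_alg_mul PA (fun_alg_add PA d1.1 d2.1)
    (fun_alg_cst PA 2%:R^-1)) => x.
  by rewrite [j]ord1 mxE eqxx.
apply: row_mx_fun => j.
  apply: fun_alg_ext (fun_alg_mul PA (fun_alg_add PA d1.2 (fun_alg_opp PA d2.2))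
    (fun_alg_cst PA 2%:R^-1)) => x.
  by rewrite [j]ord1 mxE eqxx.
apply: fun_alg_ext (cfun_off PA ord0 j FP).2 => x.
by rewrite [RHS]mxE.
Qed.

Lemma beta_fun (r : X -> rV10) : (forall j, P (fun x => r x 0 j)) ->
  hfun P (fun x => beta (r x)).
Proof.
move=> rP; have z0 := cfun_cst PA 0.
have xP : cfun P (fun x => lsubmx (r x) 0 0 +i* lsubmx (rsubmx (r x)) 0 0)%C.
  split; [apply: fun_alg_ext (rP (lshift _ 0))|
    apply: fun_alg_ext (rP (rshift _ (lshift _ 0)))] => x; by rewrite !mxE.
have zP (k : 'I_(1 + 7)) : cfun P (fun x : X => (0 : oct C) 0 k).
  by apply: cfun_ext z0 => x; rewrite mxE.
apply: hfun_h3 => //; first exact: cfun_conj.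
move=> j; apply: cfun_ext (cfun_mul PA (cfun_cst PA 'i%C)
  (cfun_real PA (rP (rshift _ (rshift _ j))))) => x.
by rewrite !mxE.
Qed.

Lemma real_proj_fun (F G : X -> H3 R) : hfun P F -> hfun P G ->
  hfun P (fun x => real_proj (F x) (G x)).
Proof.
move=> FP GP; have JP H : hfun P H -> hfun P (fun x => peirceJ (F x) (H x)).
  by move=> HP; apply: hfun_cj => //; exact: hfun_cross.
apply: hfun_scale => //; first exact: cfun_cst.
by apply: hfun_add => //; [exact: JP (JP _ GP)|exact: JP].
Qed.

Lemma gram_fun (F : X -> H3 R) i j : hfun P F -> P (fun x => gram (F x) i j).
Proof.
move=> FP; have := gamma_fun j (real_proj_fun FP (hfun_cst PA (beta (delta_mx 0 i)))).
by apply: fun_alg_ext => x; rewrite [RHS]mxE.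
Qed.
End Functions.

(** Central projection: a half sphere in the real 10-space is parametrized by the directions (1, t),
    with 9 slopes t. With the 33 coordinates of the base this makes 42. *)
Definition fiber_row (t : 'rV[R]_(1 + (1 + 7))) : rV10 := row_mx 1%:M t.

Section Param.
Variable u : 'rV[R]_(n33 + (1 + (1 + 7))).
Definition rank2_base : H3 R := rank1_param (lsubmx u).
(** The adjugate takes the place of the inverse of the Gram matrix: the coordinates [gamma] of this
    point are the determinant times [fiber_row], a positive multiple on the chart domain, and
    [rank2_scale] normalizes afterwards. *)
Definition rank2_point : H3 R := real_proj rank2_base
  (beta (fiber_row (rsubmx u) *m \adj (gram rank2_base))).
Definition rank2_scale : R := Num.sqrt (2 * (complex.Re (hm rank2_point rank2_point))^-1).
Definition rank2_param : H3 R := rank2_scale%:C%C *: rank2_point.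

Lemma rank2_base_minimal : minimal_tripotent rank2_base.
Proof. exact: minimal_rank1_param. Qed.

Lemma gamma_rank2_point :
  gamma rank2_point = \det (gram rank2_base) *: fiber_row (rsubmx u).
Proof. by rewrite /rank2_point -gramE -mulmxA mul_adj_mx mul_mx_scalar. Qed.

Lemma rank2_point_fixed : peirceJ rank2_base rank2_point = rank2_point.
Proof. exact: real_proj_fixed rank2_base_minimal. Qed.

Lemma hm_real v : hm v v = (complex.Re (hm v v))%:C%C.
Proof. by rewrite (RRe_real (ger0_real (hm_ge0 v))). Qed.

Lemma gamma0 : gamma 0 = 0 :> rV10.
Proof. by have := gamma_linear (-1) 0 (0 : H3 R); rewrite scaler0 addr0 scaleN1r addNr. Qed.

Lemma gammaZ (c : R) v : gamma (c%:C%C *: v) = c *: gamma v.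
Proof. by have := gamma_linear c v 0; rewrite gamma0 !addr0. Qed.

Lemma peirceJZ f (c : R) v : peirceJ f (c%:C%C *: v) = c%:C%C *: peirceJ f v.
Proof.
have := peirceJ_linear f c v 0; rewrite addr0 => ->.
by rewrite {2}/peirceJ cross0r cj0 addr0.
Qed.

Lemma hm_rank2_point_gt0 : 0 < \det (gram rank2_base) ->
  0 < complex.Re (hm rank2_point rank2_point).
Proof.
move=> d0; have := hm_ge0 rank2_point; rewrite lecE => /andP[_ h0].
rewrite lt_def h0 andbT; apply/eqP => p0.
have {}p0 : rank2_point = 0 by apply: hm_eq0; rewrite hm_real p0.
have := gamma_rank2_point; rewrite p0 gamma0 => /esym/eqP.
rewrite scaler_eq0 gt_eqF //= => /eqP/(congr1 lsubmx); rewrite row_mxKl linear0.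
by move/matrixP/(_ 0 0)/eqP; rewrite !mxE oner_eq0.
Qed.

Lemma rank2_scale_gt0 : 0 < \det (gram rank2_base) -> 0 < rank2_scale.
Proof. by move=> /hm_rank2_point_gt0 h0; rewrite sqrtr_gt0 mulr_gt0 ?invr_gt0. Qed.

Lemma hm_rank2_param : 0 < \det (gram rank2_base) -> hm rank2_param rank2_param = 2%:R.
Proof.
move=> /hm_rank2_point_gt0 h0; rewrite hmZl hmZr conjc_real hm_real.
rewrite -!rmorphM mulrA -expr2 sqr_sqrtr ?mulr_ge0 ?invr_ge0 ?(ltW h0) //.
by rewrite mulfVK ?gt_eqF // (rmorph_nat (real_complex R)).
Qed.

Lemma rank2_param_fixed : peirceJ rank2_base rank2_param = rank2_param.
Proof. by rewrite peirceJZ rank2_point_fixed. Qed.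

Lemma adj_rank2_param : 0 < \det (gram rank2_base) -> cj (adj rank2_param) = rank2_base.
Proof.
move=> d0; rewrite (adj_fixed rank2_base_minimal rank2_param_fixed (hm_rank2_param d0)).
exact: cjK.
Qed.
End Param.

Definition rank2_coord e : 'rV[R]_(n33 + (1 + (1 + 7))) :=
  row_mx (rank1_coord (cj (adj e))) ((lsubmx (gamma e) 0 0)^-1 *: rsubmx (gamma e)).

Lemma rank2_paramK u : 0 < \det (gram (rank2_base u)) -> rank2_coord (rank2_param u) = u.
Proof.
move=> d0; have s0 := rank2_scale_gt0 d0.
rewrite /rank2_coord adj_rank2_param // /rank2_base rank1_paramK -[RHS]hsubmxK.
congr row_mx; rewrite /rank2_param gammaZ gamma_rank2_point scalerA.
rewrite /fiber_row scale_row_mx row_mxKl row_mxKr !mxE eqxx mulr1 scalerA mulVf ?scale1r //.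
by rewrite mulf_neq0 ?gt_eqF.
Qed.

Lemma rank2_coordK e : has_rank 2 e -> 0 < complex.Re (diag (cj (adj e)) ord0) ->
  0 < lsubmx (gamma e) 0 0 -> 0 < \det (gram (cj (adj e))) ->
  rank2_base (rank2_coord e) = cj (adj e) /\ rank2_param (rank2_coord e) = e.
Proof.
move=> e2 f0 g0 d0; have [fM Je] := fixed_rank2 e2.
have bE : rank2_base (rank2_coord e) = cj (adj e).
  by rewrite /rank2_base /rank2_coord row_mxKl rank1_coordK.
split=> //; have Jp := rank2_point_fixed (rank2_coord e); rewrite bE in Jp.
pose t := \det (gram (cj (adj e))) / lsubmx (gamma e) 0 0.
have t0 : 0 < t by rewrite divr_gt0.
(* Both sides are fixed by the conjugation attached to [cj (adj e)] and have the same image under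
   [gamma], so [gamma_inj] identifies them. *)
have pE : rank2_point (rank2_coord e) = t%:C%C *: e.
  apply/eqP; rewrite -subr_eq0; apply/eqP; apply: (gamma_inj fM); first by rewrite gt_eqF.
    have := peirceJ_linear (cj (adj e)) (- t) e (rank2_point (rank2_coord e)).
    by rewrite Je Jp rmorphN scaleNr addrC.
  have := gamma_linear (- t) e (rank2_point (rank2_coord e)).
  rewrite rmorphN scaleNr addrC => ->; rewrite gamma_rank2_point bE /rank2_coord row_mxKr.
  have -> : fiber_row ((lsubmx (gamma e) 0 0)^-1 *: rsubmx (gamma e)) =
      (lsubmx (gamma e) 0 0)^-1 *: gamma e.
    rewrite /fiber_row -[X in _ = _ *: X]hsubmxK scale_row_mx; congr row_mx.
    by apply/rowP => j; rewrite [j]ord1 [LHS]mxE eqxx [RHS]mxE mulVf ?gt_eqF.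
  by rewrite scalerA -/t scaleNr addNr.
have hE : complex.Re (hm e e) = 2%:R.
  have [_ ->] := (rank2_tripotentP e).1 e2.
  by rewrite -(rmorph_nat (real_complex R)).
rewrite /rank2_param /rank2_scale pE hmZl hmZr conjc_real mulrA -rmorphM hm_real hE.
rewrite -rmorphM /= scalerA -rmorphM.
have -> : 2 * (t * t * 2%:R)^-1 = (t^-1) ^+ 2 by field; rewrite gt_eqF.
by rewrite sqrtr_sqr ger0_norm ?invr_ge0 ?(ltW t0) // mulVf ?gt_eqF // scale1r.
Qed.

Definition rank2_set : set (H3 R) := [set e | has_rank 2 e].

Lemma aut_rank2 k e : aut k -> rank2_set e -> rank2_set (k e).
Proof.
move=> kA /rank2_tripotentP[eT e1]; apply/rank2_tripotentP.
by rewrite (aut_hm kA); split=> //; exact/(aut_tripotent _ kA).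
Qed.

Lemma rank2_dg011 : rank2_set (dg 0 1 1).
Proof.
apply/rank2_tripotentP; split; first exact: (tripotent_dg01 R false true true).
exact: hm_dg011.
Qed.

Lemma cj_adj_dg011 : cj (adj (dg 0 1 1)) = dg 1 0 0 :> H3 R.
Proof.
by rewrite adj_dg /dg cj_h3 bar0 !mul0r !mulr0 mulr1 (rmorph0 conjc) (rmorph1 conjc).
Qed.

Lemma gram_dg1 : gram (dg 1 0 0) = 1%:M :> 'M[R]_(1 + (1 + (1 + 7))).
Proof.
apply/row_matrixP => i; rewrite rowE gramE -gammaK !betaK.
by rewrite row1.
Qed.

Lemma rank2_base_smooth (V : normedModType R) (U : set V)
    (p : V -> 'rV[R]_(n33 + (1 + (1 + 7)))) : open U -> smooth_on U p ->
  hfun (smooth_on U) (fun x => rank2_base (p x)).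
Proof.
move=> Uo pS; apply: (rank1_param_smooth Uo); apply: smooth_row => // j.
by apply: fun_alg_ext (smooth_coord (lshift _ j) Uo pS) => x; rewrite mxE.
Qed.

Lemma rank2_param_smooth (U : set 'rV[R]_(n33 + (1 + (1 + 7)))) : open U ->
  (forall u, U u -> 0 < \det (gram (rank2_base u))) -> hfun (smooth_on U) rank2_param.
Proof.
move=> Uo U0; have PA := smooth_fun_alg Uo; have idS := @smooth_id R _ U.
have bS := rank2_base_smooth Uo idS.
have fS (j : 'I_(1 + (1 + (1 + 7)))) : smooth_on U (fun u => fiber_row (rsubmx u) 0 j).
  move: j; apply: row_mx_fun => // j.
    by apply: fun_alg_ext (fun_alg_cst PA (j == 0)%:R) => u; rewrite mxE [j]ord1.
  by apply: fun_alg_ext (smooth_coord (rshift _ j) Uo idS) => u; rewrite mxE.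
have pS : hfun (smooth_on U) rank2_point.
  apply: (real_proj_fun PA bS); apply: (beta_fun PA) => j; apply: (mulmx_fun PA) => // i k.
  by apply: (adjugate_fun PA) => i' k'; exact: gram_fun.
have nS := (cfun_hm PA pS pS).1.
have h0 u : U u -> 0 < complex.Re (hm (rank2_point u) (rank2_point u)).
  by move=> /U0; exact: hm_rank2_point_gt0.
have iS := smooth_inv Uo nS (fun u Uu => lt0r_neq0 (h0 u Uu)).
have sS := fun_alg_mul PA (fun_alg_cst PA 2%:R) iS.
apply: (hfun_scale PA _ pS); apply: (cfun_real PA).
by apply: (smooth_sqrt Uo sS) => u Uu; rewrite mulr_gt0 ?invr_gt0 ?h0.
Qed.

Lemma polynomial_cj_adj (phi : H3 R -> R) : polynomial_fun phi ->
  polynomial_fun (fun e => phi (cj (adj e))).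
Proof.
by move=> phiP X P PA F FP; apply: phiP => //; apply: hfun_cj => //; exact: hfun_adj.
Qed.

Lemma polynomial_det_gram : polynomial_fun (fun f => \det (gram f)).
Proof. by move=> X P PA F FP; apply: (det_fun PA) => i j; exact: gram_fun. Qed.

Lemma polynomial_gamma0 : polynomial_fun (fun e => lsubmx (gamma e) 0 0).
Proof.
move=> X P PA F FP; apply: fun_alg_ext (gamma_fun PA (lshift _ 0) FP) => x.
by rewrite [RHS]mxE.
Qed.

Lemma rank2_chart0 : chart 42 rank2_set (dg 0 1 1).
Proof.
pose U : set 'rV[R]_42 := [set u | 0 < \det (gram (rank2_base u))].
have Uo : open U.
  have bS := rank2_base_smooth openT (@smooth_id R _ setT).
  have fc := polynomial_det_gram (smooth_fun_alg openT) bS 0%N.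
  apply: (@open_comp _ _ (fun u : 'rV[R]_42 => \det (gram (rank2_base u)))
    [set r | 0 < r]); last exact: open_gt.
  by move=> x _; exact: fc.
(* The three conditions: the base point lies in the domain of the chart of E1, the point lies in the
   open half sphere, and [gamma] gives coordinates on the fiber. *)
exists (fun e => complex.Re (diag (cj (adj e)) ord0)), (fun e => lsubmx (gamma e) 0 0),
  (fun e => \det (gram (cj (adj e)))), U, rank2_param, rank2_coord => W; split.
- split; [|exact: polynomial_gamma0|].
    exact: (polynomial_cj_adj (phi := fun f => complex.Re (diag f ord0)) (@polynomial_diag R ord0)).
  exact: (polynomial_cj_adj (phi := fun f => \det (gram f)) polynomial_det_gram).
- rewrite /W /= cj_adj_dg011 gram_dg1 det1 /gamma row_mxKl mxE eqxx /dg !diag_h3 !inordK //=.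
- by split=> //; exact: rank2_param_smooth.
- move=> j V U' F U'o FS FW; have PA := smooth_fun_alg U'o.
  have aS := hfun_cj PA (hfun_adj PA FS).
  move: j; apply: (@row_mx_fun _ _ _ n33 (1 + (1 + 7)) (fun x => rank1_coord (cj (adj (F x))))
    (fun x => (lsubmx (gamma (F x)) 0 0)^-1 *: rsubmx (gamma (F x)))) => j.
    exact: (rank1_coord_smooth j U'o aS (fun x Ux => let: And3 h _ _ := FW x Ux in h)).
  have gS := polynomial_gamma0 PA FS.
  have iS := smooth_inv U'o gS (fun x Ux => lt0r_neq0 (let: And3 _ h _ := FW x Ux in h)).
  apply: fun_alg_ext (fun_alg_mul PA iS (gamma_fun PA (rshift _ j) FS)) => x.
  by rewrite [RHS]mxE; congr (_ * _); rewrite [RHS]mxE.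
split=> [u Uu|e eM [f0 g0 d0]].
  split; last exact: rank2_paramK Uu.
    exact: rank2_fixed (rank2_base_minimal u) (rank2_param_fixed u) (hm_rank2_param Uu).
  rewrite /W /= (adj_rank2_param Uu); split; last exact: Uu.
    by rewrite Re_diag_rank1_param rank1_scale_gt0.
  rewrite /rank2_param gammaZ gamma_rank2_point scalerA /fiber_row scale_row_mx row_mxKl.
  by rewrite !mxE eqxx mulr1 mulr_gt0 // rank2_scale_gt0.
by have [bE pE] := rank2_coordK eM f0 g0 d0; split; [rewrite /U /= bE|].
Qed.

Lemma rank2_submanifold : real_submanifold 42 rank2_set.
Proof.
apply: chart_submanifold => [|e /rank2_tripotentP[eT e1]].
  by exists (dg 0 1 1); exact: rank2_dg011.
have /conjugate_sym[k [kA <-]] := tripotent_hm2 eT e1.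
exact: (chart_aut kA (fun l x lA => @aut_rank2 l x lA) rank2_chart0).
Qed.
End RankTwoChart.

(** * Tangent vectors *)

Section TangentVectors.
Variable R : realType.
Local Notation C := R[i].
Local Notation n := (\dim {:H3 R}).
Local Notation RV := ('rV[R]_n * 'rV[R]_n)%type.
Implicit Types (M : set (H3 R)) (p v w : H3 R) (t : R) (F G q : R -> H3 R).

Definition continuous0 (f : R -> R) : Prop := {for 0, continuous f}.

Lemma continuous0_fun_alg : fun_alg continuous0.
Proof.
split=> [r|f g fc gc|f g fc gc]; first exact: cst_continuous.
  exact: continuousD.
exact: continuousM.
Qed.

Lemma continuous0_eq0 G : hfun continuous0 G -> (\forall t \near 0^', G t = 0) -> G 0 = 0.
Proof.
move=> Gc G0; have E (f : R -> R) : continuous0 f -> (\forall t \near 0^', f t = 0) -> f 0 = 0.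
  move=> /continuous_withinNx fc f0.
  have fc0 : f x @[x --> 0^'] --> (0 : R).
    by apply: cvg_near_cst; exact: f0.
  by rewrite -(cvg_lim _ fc) // (cvg_lim _ fc0).
rewrite (hcoord_sum (G 0)) big1 // => i _; have [G1 G2] := Gc i.
have -> : hcoord i (G 0) = 0; last by rewrite scale0r.
have h0 : hcoord i (0 : H3 R) = 0 by rewrite /hcoord linear0.
have := E _ G1; have := E _ G2; case: (hcoord i (G 0)) => x y /= -> //; last first.
  by near=> t; rewrite (near G0 t) // h0.
move=> -> //; near=> t; rewrite (near G0 t) // h0.
Unshelve. all: by end_near.
Qed.

Lemma unrealify_lin t (a b : RV) :
  unrealify (a + t *: b) = unrealify a + t%:C%C *: unrealify b.
Proof.
rewrite /unrealify scaler_sumr -big_split; apply: eq_bigr => i _ /=.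
rewrite scalerA -scalerDl !mxE; congr (_ *: _).
by apply/eqP; rewrite eq_complex /=; apply/andP; split; apply/eqP; ring.
Qed.

(** q is the difference quotient of the curve, completed at 0 by the derivative; differentiability
    at 0 is exactly its continuity there. *)
Lemma curve_velocity M p v : real_tangent M p v ->
  exists F q (eps : R), [/\ 0 < eps, forall t, ball (0 : R) eps t -> M (F t),
    hfun continuous0 q, q 0 = v & forall t, F t = p + t%:C%C *: q t].
Proof.
move=> [c [eps [eps0 cS cM c0 cv]]].
pose Q t : RV := if t == 0 then 'D_1 c 0 else t^-1 *: (c t - c 0).
have Qc : {for 0, continuous Q}.
  apply/continuous_withinNx; rewrite {2}/Q eqxx.
  have [cD _] := cS 1%N; have : derivable c 0 1.
    by apply/diff_derivable/cD; exact: ballxx.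
  rewrite /derivable /derive => cc.
  apply: cvg_trans cc; apply: near_eq_cvg; near=> t.
  have t0 : t != 0 by near: t; exact: nbhs_dnbhs_neq.
  by rewrite /Q (negbTE t0) /= addr0 /GRing.scale /= mulr1.
exists (fun t => unrealify (c t)), (fun t => unrealify (Q t)), eps; split=> //.
- by move=> t /cM[x Mx <-]; rewrite realifyK.
- move=> i; have [U1 U2] := @continuous_unrealify R i.
  by split; [exact: (continuous_comp Qc (U1 _))|exact: (continuous_comp Qc (U2 _))].
- by rewrite /Q eqxx cv realifyK.
move=> t; rewrite -[p]realifyK -c0 -unrealify_lin; congr unrealify.
rewrite /Q; case: eqVneq => [->|t0]; first by rewrite scale0r addr0.
by rewrite scalerA mulfV // scale1r addrC subrK.
Unshelve. all: by end_near.
Qed.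

Lemma telescope_eq0 (V : lmodType C) (x y z u : V) :
  2%:R *: z + (-1) *: x + (x + (-1) *: y) + (y + (-1) *: (2%:R *: u))
  + (- 2%:R) *: (z + (-1) *: u) = 0.
Proof. by rewrite !scaleN1r scaleNr scalerBr !subrKA subrr. Qed.

(** The equation {e, e, e} = 2 e is differentiated without a chain rule: the difference of its
    values at F t and at p is divided by t, and the quotient G stays continuous at 0. *)
Lemma tangent_tripotent M p v : (forall e, M e -> tripotent e) -> real_tangent M p v ->
  2%:R *: tp p p v + tp p v p = 2%:R *: v.
Proof.
move=> MT /curve_velocity[F [q [eps [eps0 FM qc qv Fq]]]].
have Fp : F 0 = p by rewrite Fq (rmorph0 (real_complex R)) scale0r addr0.
have Ftp t : ball (0 : R) eps t -> tp (F t) (F t) (F t) = 2%:R *: F t.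
  by move=> /FM /MT; rewrite tripotentE.
have pT : tp p p p = 2%:R *: p by rewrite -Fp; apply: Ftp; exact: ballxx.
have PA := continuous0_fun_alg.
have Fc : hfun continuous0 F.
  apply: (@hfun_ext _ _ _ (fun t => p + t%:C%C *: q t)) => [t|]; first by rewrite Fq.
  apply: hfun_add => //; first exact: hfun_cst.
  by apply: hfun_scale => //; apply: cfun_real => //; exact: cvg_id.
(* By telescoping, t G t = {F, F, F} - {p, p, p} - 2 (F - p), which vanishes on the curve. *)
pose G t := tp (q t) (F t) (F t) + tp p (q t) (F t) + tp p p (q t) + (- 2%:R) *: q t.
have Gc : hfun continuous0 G.
  have pc := hfun_cst PA p.
  apply: (hfun_add PA); last by apply: (hfun_scale PA) => //; exact: cfun_cst.
  apply: (hfun_add PA); last exact: hfun_tp.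
  by apply: (hfun_add PA); exact: hfun_tp.
have G0 : G 0 = 0.
  apply: (continuous0_eq0 Gc); near=> t.
  have t0 : t != 0 by near: t; exact: nbhs_dnbhs_neq.
  have tb : ball (0 : R) eps t by near: t; apply: nbhs_dnbhs; exact: nbhsx_ballx.
  have tC0 : t%:C%C != 0 :> C by rewrite (fmorph_eq0 (real_complex R)).
  apply: (scalerI tC0); rewrite scaler0.
  have FE : t%:C%C *: q t = F t + (-1) *: p by rewrite Fq; apply: hm_inj => w;
    rewrite !(hmDl, hmZl); ring.
  have -> : t%:C%C *: G t = tp (t%:C%C *: q t) (F t) (F t) + tp p (t%:C%C *: q t) (F t)
      + tp p p (t%:C%C *: q t) + (- 2%:R) *: (t%:C%C *: q t).
    rewrite tpZl tpZm tpZr conjc_real; apply: hm_inj => w.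
    by rewrite !(hmDl, hmZl); ring.
  rewrite FE tpDl tpDm tpDr tpZl tpZm tpZr (Ftp _ tb) pT rmorphN (rmorph1 conjc).
  exact: telescope_eq0.
move: G0; rewrite /G Fp qv (tpC v) => G0; apply/eqP; rewrite -subr_eq0 -G0; apply/eqP.
by apply: hm_inj => w; rewrite -scaleNr !(hmDl, hmZl); ring.
Unshelve. all: by end_near.
Qed.

Lemma complex_tangent_peirce1 M p (H : {vspace H3 R}) :
  (forall e, M e -> tripotent e) -> [set` H] `<=` real_tangent M p -> (H <= peirce 1 p)%VS.
Proof.
move=> MT HT; apply/subvP => v vH; apply/peirceE.
have e1 := tangent_tripotent MT (HT v vH).
pose j : C := 'i%C; have cj1 : conjc j = - j by apply/eqP; rewrite eq_complex /= oppr0 !eqxx.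
have j0 : j != 0 by rewrite eq_complex /= oner_eq0 andbF.
have {HT} := tangent_tripotent MT (HT (j *: v) (memvZ _ vH)).
rewrite tpZr tpZm cj1; clearbody j => e2.
(* The middle argument is conjugate linear, so i times the equation of v plus the equation of i v
   eliminates {p, v, p} and leaves 4 i {p, p, v} = 4 i v. *)
apply: (scalerI (a := 4%:R * j)); first by rewrite mulf_neq0 // pnatr_eq0.
apply: hm_inj => w.
have h1 := congr1 (fun u => hm u w) e1; have h2 := congr1 (fun u => hm u w) e2.
rewrite !(hmDl, hmZl) in h1.
rewrite !(hmDl, hmZl) in h2.
rewrite !hmZl; move: (hm (tp p p v) w) (hm (tp p v p) w) (hm v w) h1 h2 => x y z h1 h2.
have -> : 4%:R * j * x = j * (2%:R * x + y) + (2%:R * (j * x) + - j * y) by ring.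
by rewrite h1 h2; ring.
Qed.
End TangentVectors.

(** * Velocities of explicit curves *)

Section TangentCurves.
Variable R : realType.
Local Notation C := R[i].
Local Notation bar := (map_mx conjc).
Local Notation U := (ball (0 : R) 1).
Implicit Types (M : set (H3 R)) (f p v w : H3 R) (t : R) (F q : R -> H3 R).

(** The curve is given through its difference quotient q. Automorphisms and triple products then act
    on q algebraically, and a derivative is computed once, in [velocity_tangent]. *)
Definition velocity M p v : Prop := exists q,
  [/\ hfun (smooth_on U) q, forall t, M (p + t%:C%C *: q t) & q 0 = v].

Let U_open : open U. Proof. exact: ball_open. Qed.
Let UA := smooth_fun_alg U_open.

Lemma smooth_segment p q : hfun (smooth_on U) q ->
  hfun (smooth_on U) (fun t => p + t%:C%C *: q t).
Proof.
move=> qS; apply: (hfun_add UA); first exact: hfun_cst.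
by apply: (hfun_scale UA) => //; apply: (cfun_real UA); exact: smooth_id.
Qed.

Lemma realify_lin t p v : realify (p + t%:C%C *: v) = realify p + t *: realify v.
Proof.
by apply: (can_inj (@unrealifyK R)); rewrite unrealify_lin !realifyK.
Qed.

Lemma derive_segment (W : normedModType R) (b : W) (Q : R -> W) :
  {for 0, continuous Q} -> 'D_1 (fun t => b + t *: Q t) 0 = Q 0.
Proof.
move=> /continuous_withinNx Qc; rewrite /derive; apply: cvg_lim => //.
apply: cvg_trans Qc; apply: near_eq_cvg; near=> t.
have t0 : t != 0 by near: t; exact: nbhs_dnbhs_neq.
rewrite /= addr0 scale0r addr0 [t *: 1]mulr1 [b + _]addrC addrK.
by rewrite scalerA mulVf // scale1r.
Unshelve. all: by end_near.
Qed.

Lemma velocity_tangent M p v : velocity M p v -> real_tangent M p v.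
Proof.
move=> [q [qS qM <-]]; have rS := realify_smooth U_open qS.
have cS := realify_smooth U_open (smooth_segment p qS).
exists (fun t => realify (p + t%:C%C *: q t)), 1; split=> //.
- by move=> t _; exists (p + t%:C%C *: q t).
- by rewrite (rmorph0 (real_complex R)) scale0r addr0.
have -> : (fun t => realify (p + t%:C%C *: q t)) = (fun t => realify p + t *: realify (q t)).
  by apply/funext => t; rewrite realify_lin.
apply: (@derive_segment _ (realify p) (fun t => realify (q t))).
exact: (rS 0%N 0 (ballxx _ ltr01)).
Qed.

Lemma aut_velocity M p v k : aut k -> (forall u, M u -> M (k u)) ->
  velocity M p v -> velocity M (k p) (k v).
Proof.
move=> kA kM [q [qS qM qv]]; exists (fun t => k (q t)); split; last by rewrite qv.
  by apply: (hfun_linear UA) qS; exact: aut_linear.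
by move=> t; rewrite -(autZ kA) -(autD kA); exact: kM.
Qed.

Lemma scale_segment (V : lmodType C) (c s r : C) (x y : V) : s = 1 + c * r ->
  x + c *: (s *: y + r *: x) = s *: (x + c *: y).
Proof.
move=> sE; rewrite scalerDr [RHS]scalerDr !scalerA (mulrC c s) addrCA addrC.
by congr (_ + _); rewrite sE scalerDl scale1r.
Qed.

(** As g is orthogonal to p, the squared norm of p + t g is 1 + t^2 a; dividing by the norm puts
    this rank one curve on E1 without changing its velocity. *)
Lemma minimal_velocity p g : minimal_tripotent p -> hfun (smooth_on U) g ->
  (forall t, hm p (g t) = 0) -> (forall t, adj (p + t%:C%C *: g t) = 0) ->
  velocity (@minimal_set R) p (g 0).
Proof.
move=> /minimal_adjP[_ p1] gS pg adj0.
pose a t := complex.Re (hm (g t) (g t)).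
have aE t : hm (g t) (g t) = (a t)%:C%C by exact: hm_real.
have a0 t : 0 <= a t by have := hm_ge0 (g t); rewrite lecE => /andP[].
have d0 t : 0 < 1 + t ^+ 2 * a t.
  by rewrite ltr_wpDr // mulr_ge0 // sqr_ge0.
pose s t := (Num.sqrt (1 + t ^+ 2 * a t))^-1.
have s0 t : 0 < s t by rewrite invr_gt0 sqrtr_gt0.
have sE t : s t ^+ 2 * (1 + t ^+ 2 * a t) = 1.
  by rewrite exprVn sqr_sqrtr ?(ltW (d0 t)) // mulVf ?gt_eqF.
(* This is (s - 1) / t, written so as to be smooth at t = 0: from s^2 (1 + t^2 a) = 1 one gets (1 -
   s) (1 + s) = t^2 a s^2. *)
pose r t := - (t * a t * s t ^+ 2 * (s t + 1)^-1).
have rE t : 1 + t * r t = s t.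
  have h := sE t; have n0 : s t + 1 != 0 by rewrite gt_eqF // addr_gt0.
  have : (1 + t * r t - s t) * (s t + 1) = 0.
    rewrite /r; have -> : (1 + t * - (t * a t * s t ^+ 2 * (s t + 1)^-1) - s t) * (s t + 1) =
      1 - s t ^+ 2 * (1 + t ^+ 2 * a t) by field.
    by rewrite h subrr.
  by move/eqP; rewrite mulf_eq0 (negbTE n0) orbF subr_eq0 => /eqP.
have idS := @smooth_id R R U.
have aS : smooth_on U a := (cfun_hm UA gS gS).1.
have dS : smooth_on U (fun t => 1 + t ^+ 2 * a t).
  apply: (fun_alg_add UA); first exact: fun_alg_cst.
  by apply: (fun_alg_mul UA) => //; exact: (fun_alg_mul UA).
have sS : smooth_on U s.
  apply: (smooth_inv U_open); first exact: smooth_sqrt.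
  by move=> t _; rewrite gt_eqF // sqrtr_gt0.
have rS : smooth_on U r.
  apply: (fun_alg_opp UA); apply: (fun_alg_mul UA).
    by apply: (fun_alg_mul UA); [exact: (fun_alg_mul UA)|exact: (fun_alg_mul UA)].
  apply: (smooth_inv U_open); last by move=> t _; rewrite gt_eqF // addr_gt0.
  by apply: (fun_alg_add UA) => //; exact: fun_alg_cst.
exists (fun t => (s t)%:C%C *: g t + (r t)%:C%C *: p); split.
- apply: (hfun_add UA); apply: (hfun_scale UA); try exact: cfun_real.
    exact: gS.
  exact: hfun_cst.
- move=> t; apply/minimal_adjP.
  have -> : p + t%:C%C *: ((s t)%:C%C *: g t + (r t)%:C%C *: p) =
      (s t)%:C%C *: (p + t%:C%C *: g t).
    apply: scale_segment; rewrite -{1}(rE t) rmorphD rmorphM.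
    by rewrite (rmorph1 (real_complex R)).
  split; first by rewrite adjZ adj0 scaler0.
  rewrite hmZl hmZr conjc_real hmDl !hmDr !hmZl !hmZr conjc_real p1 pg aE.
  have -> : hm (g t) p = 0 by rewrite hm_conj pg (rmorph0 conjc).
  rewrite !mulr0 addr0 add0r -[1](rmorph1 (real_complex R)) -!rmorphM -rmorphD -!rmorphM.
  congr (_%:C)%C; rewrite -[RHS](sE t); ring.
rewrite /r !mul0r oppr0 (rmorph0 (real_complex R)) scale0r addr0.
have -> : s 0 = 1 by rewrite /s expr0n mul0r addr0 sqrtr1 invr1.
by rewrite (rmorph1 (real_complex R)) scale1r.
Qed.

(** The curve is [rank1] at t b and t c, before normalization. *)
Lemma minimal_velocity_dg1 (b c : oct C) : velocity (@minimal_set R) (dg 1 0 0) (h3 0 0 0 0 b c).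
Proof.
pose g t : H3 R := h3 0 (t%:C%C * onorm c) (t%:C%C * onorm b) (t%:C%C *: ocj (omul b c)) b c.
have -> : h3 0 0 0 0 b c = g 0.
  by rewrite /g (rmorph0 (real_complex R)) !mul0r scale0r.
have tS : cfun (smooth_on U) (fun t => t%:C%C) by apply: (cfun_real UA); exact: smooth_id.
apply: minimal_velocity; first exact: minimal_dg1.
- have cS (a : oct C) j : cfun (smooth_on U) (fun _ => a 0 j) by exact: cfun_cst.
  apply: (hfun_h3 UA) => //; try exact: cfun_cst.
  + by apply: (cfun_mul UA) => //; exact: cfun_cst.
  + by apply: (cfun_mul UA) => //; exact: cfun_cst.
  move=> j; apply: cfun_ext (cfun_mul UA tS (cS (ocj (omul b c)) j)) => t.
  by rewrite mxE.
- by move=> t; rewrite /dg hm_h3 !oform0l (rmorph0 conjc) !mulr0 !mul0r !addr0.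
move=> t; rewrite -[RHS](adj_rank1 (t%:C%C *: b) (t%:C%C *: c)); congr adj.
rewrite /g /dg h3_scale h3_add /rank1 !onormZ omulZl omulZr !ocjZ.
by rewrite !mulr0 !addr0 !add0r scalerA !mulrA -!expr2.
Qed.

Lemma peirce1_velocity_minimal e v : minimal_tripotent e -> v \in peirce 1 e ->
  velocity (@minimal_set R) e v.
Proof.
move=> /minimal_tripotentP[eT e1].
have [k [kA <-]] := conjugate_sym (tripotent_hm1 eT e1).
have [l [lA kl lk]] := aut_inverse kA.
rewrite -[v]lk (aut_peirce _ _ _ kA) => vP; apply: (aut_velocity kA).
  by move=> u; exact: aut_minimal.
move: vP; case: (h3P (l v)) => z1 z2 z3 a1 a2 a3.
move=> /(peirce_dg01 true false false 1)[[/eqP-> /eqP-> /eqP->] [/eqP-> _ _]].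
exact: minimal_velocity_dg1.
Qed.

(* Equal to 1 on V_0(f) and V_2(f), to -1 on V_1(f). *)
Definition reflection f u : H3 R :=
  2%:R *: tp f f (tp f f u) + (- 4%:R) *: tp f f u + u.

Lemma reflection_dg1 u : reflection (dg 1 0 0) u = torus 1 (-1) (-1) u.
Proof.
case: (h3P u) => z1 z2 z3 a1 a2 a3; rewrite /reflection !tp_dg2 torus_h3.
rewrite !h3_scale !h3_add (rmorph0 conjc) (rmorph1 conjc) !(mulr0, mul0r, addr0, add0r).
rewrite !scale0r !scaler0 !add0r !mulr1 !scale1r sqrrN expr1n !mul1r.
have cN : conjc (-1) = -1 :> C by rewrite rmorphN (rmorph1 conjc).
have E (a : oct C) : 2%:R *: a + (- 4%:R) *: a + a = -1 *: a.
  by apply/rowP => j; rewrite !mxE; ring.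
by rewrite !E cN; congr h3; ring.
Qed.

Lemma aut_reflection f : minimal_tripotent f -> aut (reflection f).
Proof.
move=> /minimal_tripotentP[fT f1].
have [k [kA <-]] := conjugate_sym (tripotent_hm1 fT f1).
have [l [lA kl lk]] := aut_inverse kA.
have -> : reflection (k (dg 1 0 0)) = k \o (torus 1 (-1) (-1) \o l).
  apply/funext => u; rewrite /= -reflection_dg1 -{1}[u]lk /reflection.
  by rewrite !(aut_tp kA) -!(autZ kA) -!(autD kA).
apply: aut_comp kA (aut_comp _ lA); apply: aut_torus.
- by rewrite mul1r mulrNN mulr1.
- by rewrite (rmorph1 conjc) mulr1.
- by rewrite rmorphN (rmorph1 conjc) mulrNN mulr1.
- by rewrite rmorphN (rmorph1 conjc) mulrNN mulr1.
Qed.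

(** Obtained from {1, v, 1} by expanding 1 = e1 + (e2 + e3): the two pure terms vanish and the two
    mixed ones coincide. *)
Lemma tp_dg1_dg011 (b c : oct C) : tp (dg 1 0 0) (h3 0 0 0 0 b c) (dg 0 1 1) =
  h3 0 0 0 0 (bar b) (bar c).
Proof.
have z : 2%:R *: h3 0 0 0 0 (0 *: bar b) (0 *: bar c) = 0 :> H3 R.
  by rewrite !scale0r h3_scale !mulr0 !scaler0 -h3_zero.
have e1 : tp (dg 1 0 0) (h3 0 0 0 0 b c) (dg 1 0 0) = 0.
  by rewrite tp_dg bar0 (rmorph0 conjc) !(mulr0, mul0r, scaler0) z.
have e2 : tp (dg 0 1 1) (h3 0 0 0 0 b c) (dg 0 1 1) = 0.
  by rewrite tp_dg bar0 (rmorph0 conjc) !(mulr0, mul0r, scaler0) z.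
have D : dg 1 1 1 = dg 1 0 0 + dg 0 1 1 :> H3 R.
  by rewrite /dg h3_add !addr0 !add0r.
have n2 : 2%:R != 0 :> C by rewrite pnatr_eq0.
apply: (scalerI n2); have := tp_dg 1 1 1 0 0 0 0 b c.
rewrite {1 2}D tpDl !tpDr e1 e2 (tpC (dg 0 1 1)) add0r addr0 -mulr2n -scaler_nat => ->.
by rewrite (rmorph0 conjc) bar0 !mulr0 scaler0 mulr1 !scale1r.
Qed.

Lemma rank2_velocity_dg011 (b c : oct C) :
  velocity (@rank2_set R) (dg 0 1 1) (h3 0 0 0 0 b c).
Proof.
(* Along a curve f on E1 starting at e1 with velocity u, D(f, f) e = t y with y(0) = {e1, u, e},
   whose nonzero entries are the conjugates of those of u. The reflection then moves e with velocity
   2 y(0) - 4 y(0), so y(0) has to be -1/2 times the given vector. *)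
pose h : C := - 2%:R^-1; pose u : H3 R := h3 0 0 0 0 (h *: bar b) (h *: bar c).
have ch : conjc h = h by rewrite /h rmorphN fmorphV (rmorph_nat conjc).
have [q [qS qM q0]] := minimal_velocity_dg1 (h *: bar b) (h *: bar c); rewrite -/u in q0.
pose f t := dg 1 0 0 + t%:C%C *: q t; have fS := smooth_segment (dg 1 0 0) qS.
pose y t := tp (q t) (f t) (dg 0 1 1) + tp (dg 1 0 0) (q t) (dg 0 1 1).
have cS w : hfun (smooth_on U) (fun _ => w) by exact: hfun_cst.
have yS : hfun (smooth_on U) y by apply: (hfun_add UA); exact: (hfun_tp UA).
have e0 : tp (dg 1 0 0) (dg 1 0 0) (dg 0 1 1) = 0 :> H3 R.
  by rewrite [dg 0 1 1]/dg tp_dg2 (rmorph0 conjc) !(mulr0, mul0r, scaler0) -h3_zero.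
have fy t : tp (f t) (f t) (dg 0 1 1) = t%:C%C *: y t.
  by rewrite {1}/f tpDl tpZl {1}/f tpDm tpZm conjc_real e0 add0r addrC -scalerDr.
exists (fun t => 2%:R *: tp (f t) (f t) (y t) + (- 4%:R) *: y t); split.
- by apply: (hfun_add UA); apply: (hfun_scale UA) => //;
    [exact: cfun_cst|exact: (hfun_tp UA)|exact: cfun_cst].
- move=> t; have -> : dg 0 1 1 + t%:C%C *: (2%:R *: tp (f t) (f t) (y t) + (- 4%:R) *: y t)
      = reflection (f t) (dg 0 1 1).
    by rewrite /reflection !fy tpZr scalerDr !scalerA -!(mulrC t%:C%C) addrC.
  exact: aut_rank2 (aut_reflection (qM t)) (rank2_dg011 R).
have f0 : f 0 = dg 1 0 0 by rewrite /f (rmorph0 (real_complex R)) scale0r addr0.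
have -> : y 0 = h3 0 0 0 0 (h *: b) (h *: c).
  rewrite /y f0 q0 tpC /u tp_dg2 tp_dg1_dg011 (rmorph0 conjc) (rmorph1 conjc).
  rewrite !bar_scale !bar_bar !ch !(mulr0, mul0r, scaler0, addr0, scale0r) h3_add.
  by rewrite !(addr0, add0r).
rewrite f0 tp_dg2 (rmorph0 conjc) (rmorph1 conjc) !h3_scale h3_add.
rewrite !(mulr0, mul0r, scaler0, addr0, add0r, mulr1, scale1r) !scalerA -!scalerDl.
by have -> : 2%:R * h + - 4%:R * h = 1; [rewrite /h; field|rewrite !scale1r].
Qed.

Lemma peirce1_velocity_rank2 e v : has_rank 2 e -> v \in peirce 1 e ->
  velocity (@rank2_set R) e v.
Proof.
move=> /rank2_tripotentP[eT e1].
have [k [kA <-]] := conjugate_sym (tripotent_hm2 eT e1).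
have [l [lA kl lk]] := aut_inverse kA.
rewrite -[v]lk (aut_peirce _ _ _ kA) => vP; apply: (aut_velocity kA).
  by move=> u; exact: aut_rank2.
move: vP; case: (h3P (l v)) => z1 z2 z3 a1 a2 a3.
move=> /(peirce_dg01 false true true 1)[[/eqP-> /eqP-> /eqP->] [/eqP-> _ _]].
exact: rank2_velocity_dg011.
Qed.
End TangentCurves.

Section CauchyRiemann.
Variable R : realType.
Implicit Types (M : set (H3 R)).

Lemma peirce1_CR_manifold t M : (forall e, M e -> tripotent e) ->
  (forall e, M e -> \dim (peirce 1 e) = 16%N) ->
  (forall e v, M e -> v \in peirce 1 e -> velocity M e v) ->
  real_submanifold (32 + t) M -> CR_manifold 16 t M.
Proof.
move=> MT Md Mv Ms; split=> // p Mp; exists (peirce 1 p); split; last exact: Md.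
split=> [v /(Mv _ _ Mp)|H' /(complex_tangent_peirce1 MT)//].
exact: velocity_tangent.
Qed.

(** For maximal e the space V_1(e) is zero, so [complex_tangent_peirce1] leaves no nonzero complex
    subspace; the constant curve realizes the zero vector. *)
Lemma maximal_totally_real : totally_real (@maximal_set R).
Proof.
move=> p pM; split=> [v|H' H'T].
  rewrite /= memv0 => /eqP->; apply: velocity_tangent.
  have UA := smooth_fun_alg (ball_open (0 : R) 1).
  exists (fun _ => 0); split; [exact: hfun_cst|move=> t|by []].
  by rewrite scaler0 addr0.
have MT (e : H3 R) : maximal_set e -> tripotent e by case.
have /subvP HP := complex_tangent_peirce1 MT H'T.
apply/subvP => v /HP/peirceE; rewrite scale1r => /(peirce1_maximal pM) ->.
exact: mem0v.
Qed.
End CauchyRiemann.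

Theorem proposition3p4 (R : realType) :
  (* minimal tripotents *)
  (let E1 : set (H3 R) := [set e | minimal_tripotent e] in
   [/\ E1 = [set e | tripotent e /\ herm e e = 1],
       E1 = [set e | sharp e = 0 /\ herm e e = 1],
       forall e, E1 e -> peirce 2%N e = <[e]>%VS /\ \dim (peirce 1%N e) = 16%N,
       real_submanifold 33%N E1 &
       CR_manifold 16%N 1%N E1]) /\
  (* tripotents of rank 2 *)
  (let E2 : set (H3 R) := [set e | has_rank 2%N e] in
   [/\ E2 = [set e | tripotent e /\ herm e e = 2],
       E2 = [set e | [/\ detH e = 0, herm (sharp e) (sharp e) = 1 &
                        herm e e = 2]],
       forall e, E2 e -> \dim (peirce 2%N e) = 10%N /\ \dim (peirce 1%N e) = 16%N,
       real_submanifold 42%N E2 &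
       CR_manifold 16%N 10%N E2]) /\
  (* maximal tripotents *)
  (let E3 : set (H3 R) := [set e | maximal_tripotent e] in
   [/\ E3 = [set e | tripotent e /\ herm e e = 3],
       E3 = [set e | [/\ `|detH e| ^+ 2 = 1, herm (sharp e) (sharp e) = 3 &
                        herm e e = 3]],
       real_submanifold 27%N E3 &
       totally_real E3]).
Proof.
split; [|split]; split.
- apply/seteqP; split=> e /=; have := minimal_tripotentP e; rewrite hm.unlock; tauto.
- by apply/seteqP; split=> e /=; have := minimal_adjP e; rewrite hm.unlock adj.unlock; tauto.
- by move=> e eM; split; [exact: peirce2_minimal|exact: dim_peirce1_minimal].
- exact: minimal_submanifold.
- apply: peirce1_CR_manifold => [e []//|e|e v|]; first exact: dim_peirce1_minimal.
    exact: peirce1_velocity_minimal.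
  exact: minimal_submanifold.
- apply/seteqP; split=> e /=; have := rank2_tripotentP e; rewrite hm.unlock; tauto.
- apply/seteqP; split=> e /=; have := rank2_detP e; rewrite hm.unlock adj.unlock hdet.unlock; tauto.
- by move=> e eM; split; [exact: dim_peirce2_rank2|exact: dim_peirce1_rank2].
- exact: rank2_submanifold.
- apply: peirce1_CR_manifold => [e /rank2_tripotentP[eT _]|e|e v|]; [exact: eT|exact: dim_peirce1_rank2| |].
    exact: peirce1_velocity_rank2.
  exact: rank2_submanifold.
- apply/seteqP; split=> e /=; have := maximal_tripotentP e; rewrite hm.unlock; tauto.
- apply/seteqP; split=> e /=; have := maximal_detP e; rewrite hm.unlock adj.unlock hdet.unlock; tauto.
- exact: maximal_submanifold.
exact: maximal_totally_real.
Qed.
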